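(* Let $f\in L_2(\Omega)$ and assume that there are $C_{\mathrm{PF}}>0$ and $c_{\mathrm{is}}>0$ such that \[ \|v\|\le C_{\mathrm{PF}}\|Av\|\quad\forall v\in H_0(A),\qquad \sup_{w\in H(A^* ),\ \|w\|_{A^*}=1}(A^*w,v)\ge c_{\mathrm{is}}\|v\|\quad\forall v\in L_2(\Omega). \] Let $(w,u,\phi)\in\widetilde H(A^*,\mathcal T)\times L_2(\Omega)\times H_0(A,\mathcal S)$ be the solution of \[ (\mathcal C^{-1}w,\delta w)-(u,A^*\delta w)_{\mathcal T}-\langle\phi,\delta w\rangle_{\mathcal S}=0\quad\forall\delta w\in\widetilde H(A^*,\mathcal T), \] \[ -(A^*w,\delta u)_{\mathcal T}-\langle\delta\phi,w\rangle_{\mathcal S}=-(f,\delta u)\quad\forall\delta u\in L_2(\Omega),\ \forall\delta\phi\in H_0(A,\mathcal S). \] Let $\widetilde H_h(A^*,\mathcal T)\subset\widetilde H(A^*,\mathcal T)$, $H_h(\mathcal T)\subset L_2(\Omega)$, $H_h(A,\mathcal S)\subset H_0(A,\mathcal S)$ be finite-dimensional subspaces such that the elementwise operator $A^*_{\mathcal T}$ satisfies $A^*_{\mathcal T}\bigl(\widetilde H_h(A^*,\mathcal T)\bigr)\subset H_h(\mathcal T)$, and assume that there are operators \[ \mathcal F_1:\widetilde H(A^*,\mathcal T)\to\widetilde H_h(A^*,\mathcal T)\cap H(A^* ),\qquad \mathcal F_2:\widetilde H(A^*,\mathcal T)\to\widetilde H_h(A^*,\mathcal T) \] and constants $C_1,C_2>0$,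 independent of $\mathcal T$ and the discrete subspaces, such that for all $z\in\widetilde H(A^*,\mathcal T)$ \[ (A^*(z-\mathcal F_1z),\delta u)_{\mathcal T}=0\ \ \forall\delta u\in H_h(\mathcal T),\qquad \langle\delta\phi,z-\mathcal F_2z\rangle_{\mathcal S}=0\ \ \forall\delta\phi\in H_h(A,\mathcal S), \] \[ \|\mathcal F_1z\|_{A^*,\mathcal T}\le C_1\|z\|_{A^*,\mathcal T},\qquad \|\mathcal F_2z\|_{A^*,\mathcal T}\le C_2\|z\|_{A^*,\mathcal T}. \] Then the scheme: find $w_h\in\widetilde H_h(A^*,\mathcal T)$, $u_h\in H_h(\mathcal T)$, $\phi_h\in H_h(A,\mathcal S)$ such that \[ (\mathcal C^{-1}w_h,\delta w)-(u_h,A^*\delta w)_{\mathcal T}-\langle\phi_h,\delta w\rangle_{\mathcal S}=0\quad\forall\delta w\in\widetilde H_h(A^*,\mathcal T), \] \[ -(A^*w_h,\delta u)_{\mathcal T}-\langle\delta\phi,w_h\rangle_{\mathcal S}=-(f,\delta u)\quad\forall\delta u\in H_h(\mathcal T),\ \forall\delta\phi\in H_h(A,\mathcal S) \] has a unique solution $(w_h,u_h,\phi_h)$. It satisfies \[ \|w-w_h\|_{A^*,\mathcal T}+\|u-u_h\|+\|\phi-\phi_h\|_{A,\mathcal S}\le C\bigl(\|w-z\|_{A^*,\mathcal T}+\|u-v\|+\|\phi-\eta\|_{A,\mathcal S}\bigr) \] for any $z\in\widetilde H_h(A^*,\mathcal T)$, $v\in H_h(\mathcal T)$, and $\eta\in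 H_h(A,\mathcal S)$ with a constant $C$ that is independent of $f$, $\mathcal T$ and the discrete subspaces.
   Context: Setting. $\Omega\subset\mathbb R^d$ ($d\in\mathbb N$) is a bounded Lipschitz domain and $U\in\{\mathbb R,\mathbb R^d,\mathbb R^{d\times d}\}$ or $U=\mathbb S:=\{w\in\mathbb R^{d\times d}: w=w^\top\}$. $A$ is a linear differential operator with constant coefficients taking scalar functions to $U$-valued functions, and $A^*$ is its formal adjoint (taking $U$-valued functions to scalar functions); both are applied in the distributional sense. $(\cdot,\cdot)$ and $\|\cdot\|$ are the $L_2(\Omega)$ inner product and norm (for scalar or $U$-valued functions). Set $H(A)=\{v\in L_2(\Omega): Av\in L_2(\Omega;U)\}$ with $\|v\|_A^2=\|v\|^2+\|Av\|^2$, and $H(A^* )=\{w\in L_2(\Omega;U): A^*w\in L_2(\Omega)\}$ with $\|w\|_{A^*}^2=\|w\|^2+\|A^*w\|^2$. The trace operator $\gamma_{A,\Gamma}:H(A)\to H(A^* )^*$ is $\langle\gamma_{A,\Gamma}(v),w\rangle_\Gamma:=(Av,w)-(v,A^*w)$, and $H_0(A):=\{v\in H(A):\gamma_{A,\Gamma}(v)=0\}$. $\mathcal C\in L_\infty(\Omega;U\times U)$ is a symmetric, (uniformly) positive definite tensor field, acting pointwise as a linear map $U\to U$, with pointwise inverse $\mathcal C^{-1}$. $\mathcal T=\{T\}$ is a regular mesh of polyhedral elements covering $\Omega$, with skeleton $\mathcal S=\bigcup\{\partial T: T\in\mathcal T\}$. $(\cdot,\cdot)_{\mathcal T}$ is the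 sum over $T\in\mathcal T$ of the $L_2(T)$ inner products, differential operators inside it being taken elementwise, and $\|\cdot\|_{\mathcal T}^2=(\cdot,\cdot)_{\mathcal T}$. Set $H(A^*,\mathcal T)=\{w\in L_2(\Omega;U): A^*(w|_T)\in L_2(T)\ \forall T\in\mathcal T\}$ with $\|w\|_{A^*,\mathcal T}^2=\|w\|^2+\|A^*w\|_{\mathcal T}^2$. $\widetilde H(A^*,\mathcal T)$ is a given closed subspace of $H(A^*,\mathcal T)$ with $H(A^* )\subset\widetilde H(A^*,\mathcal T)\subset H(A^*,\mathcal T)$. Trace operator: $\gamma_{A,\mathcal S}:H(A)\to\widetilde H(A^*,\mathcal T)^*$, $\langle\gamma_{A,\mathcal S}(v),w\rangle_{\mathcal S}:=(Av,w)-(v,A^*w)_{\mathcal T}$. Trace spaces: $H(A,\mathcal S):=\gamma_{A,\mathcal S}(H(A))$ and $H_0(A,\mathcal S):=\gamma_{A,\mathcal S}(H_0(A))$ with norm $\|\phi\|_{A,\mathcal S}:=\inf\{\|v\|_A: v\in H(A),\ \gamma_{A,\mathcal S}(v)=\phi\}$; for $\phi\in H(A,\mathcal S)$ and $w\in\widetilde H(A^*,\mathcal T)$, $\langle\phi,w\rangle_{\mathcal S}:=\langle\gamma_{A,\mathcal S}(v),w\rangle_{\mathcal S}$ for any $v\in H(A)$ with $\gamma_{A,\mathcal S}(v)=\phi$. Under the two stated assumptions with $C_{\mathrm{PF}}$ and $c_{\mathrm{is}}$, the continuous problem has a unique solution. *)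

(* Defs.v *)
From HB Require Import structures.
From mathcomp Require Import all_boot all_order all_algebra.
From mathcomp Require Import all_classical all_reals all_analysis.
Set Implicit Arguments. Unset Strict Implicit. Unset Printing Implicit Defensive.
Import Order.TTheory GRing.Theory Num.Theory.
Import numFieldNormedType.Exports.
Local Open Scope classical_set_scope.
Local Open Scope ring_scope.

Section borel.
Context {R : realType} {n : nat}.
Let coord : 'I_n -> 'rV[R]_n -> R := fun i x => x ord0 i.
Let borel0 : g_sigma_preimage coord set0.
Proof. exact: sigma_algebra0. Qed.
Let borelC A : g_sigma_preimage coord A -> g_sigma_preimage coord (~` A).
Proof. exact: sigma_algebraC. Qed.
Let borelU (F : _^nat) : (forall i, g_sigma_preimage coord (F i)) ->
  g_sigma_preimage coord (\bigcup_i (F i)).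
Proof. exact: sigma_algebra_bigcup. Qed.
HB.instance Definition _ := @isMeasurable.Build default_measure_display
  'rV[R]_n (g_sigma_preimage coord) borel0 borelC borelU.

Lemma measurable_coord i : measurable_fun [set: 'rV[R]_n] (fun x => x ord0 i).
Proof.
move=> _ Y mY; rewrite setTI; apply: sub_sigma_algebra => /=.
rewrite -bigcup_seq/=; exists i => /=; first by rewrite mem_index_enum.
by exists Y => //; rewrite setTI.
Qed.

Lemma measurable_rowP d (T : measurableType d) (f : T -> 'rV[R]_n) :
  (forall i, measurable_fun [set: T] (fun t => f t ord0 i)) ->
  measurable_fun [set: T] f.
Proof.
move=> mf _ Y mY; rewrite setTI.
have sA : sigma_algebra setT [set Z | measurable (f @^-1` Z)].
  split => /=.
  - by rewrite preimage_set0; exact: measurable0.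
  - by move=> A mA; rewrite setTD preimage_setC; exact: measurableC.
  - by move=> F mF; rewrite preimage_bigcup; exact: bigcup_measurable.
apply: (smallest_sub sA _ mY) => Z; rewrite -bigcup_seq => -[i _ [B mB <-]] /=.
by have := mf i measurableT B mB; rewrite !setTI.
Qed.
End borel.

Section lebesgue.
Context {R : realType}.
Local Open Scope ereal_scope.

Definition vcons n (p : measurableTypeR R * 'rV[R]_n) : 'rV[R]_n.+1 :=
  row_mx (p.1)%:M p.2 : 'rV[R]_(1 + n).

Definition vuncons n (x : 'rV[R]_n.+1) : measurableTypeR R * 'rV[R]_n :=
  (x ord0 ord0, \row_j x ord0 (lift ord0 j)).

Lemma vconsE0 n p : @vcons n p ord0 ord0 = p.1.
Proof.
rewrite /vcons mxE; case: splitP => [j _|k /= /eqP]; last by rewrite eq_sym.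
by rewrite !ord1 mxE mulr1n.
Qed.
Lemma vconsES n p j : @vcons n p ord0 (lift ord0 j) = p.2 ord0 j.
Proof.
rewrite /vcons mxE; case: splitP => [i|k /= /eqP]; last first.
  by rewrite /bump leq0n add1n eqSS => /eqP/ord_inj ->.
by rewrite ord1.
Qed.
Lemma vconsK n : cancel (@vcons n) (@vuncons n).
Proof.
move=> [a b]; rewrite /vuncons vconsE0; congr pair.
by apply/rowP => j; rewrite mxE vconsES.
Qed.

Lemma measurable_vcons n : measurable_fun setT (@vcons n).
Proof.
apply: measurable_rowP => i.
have [->|[j ->]] : i = ord0 \/ exists j, i = lift ord0 j.
  by case: (unliftP ord0 i) => [j ->|->]; [right; exists j|left].
- by under eq_fun do rewrite vconsE0; exact: measurable_fst.
- under eq_fun do rewrite vconsES.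
  exact: (measurableT_comp (measurable_coord j) measurable_snd).
Qed.

Lemma measurable_vuncons n : measurable_fun setT (@vuncons n).
Proof.
apply: measurable_fun_pair; first exact: measurable_coord.
apply: measurable_rowP => i; under eq_fun do rewrite mxE.
exact: measurable_coord.
Qed.

Section step.
Context n (mu : {sigma_finite_measure set 'rV[R]_n -> \bar R}).

Definition lebesgue_step (A : set 'rV[R]_n.+1) : \bar R :=
  ((@lebesgue_measure R) \x mu) (@vcons n @^-1` A).

Let step0 : lebesgue_step set0 = 0.
Proof. by rewrite /lebesgue_step preimage_set0 measure0. Qed.
Let step_ge0 A : 0 <= lebesgue_step A.
Proof. exact: measure_ge0. Qed.
Let step_sigma_additive : semi_sigma_additive lebesgue_step.
Proof.
move=> F mF tF mUF; rewrite /lebesgue_step preimage_bigcup.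
apply: measure_semi_sigma_additive.
- by move=> k; rewrite -[X in measurable X]setTI; exact: measurable_vcons.
- apply/trivIsetP => /= i j _ _ ij; rewrite -preimage_setI.
  by move/trivIsetP : tF => /(_ _ _ _ _ ij) ->//; rewrite preimage_set0.
- by rewrite -preimage_bigcup -[X in measurable X]setTI; exact: measurable_vcons.
Qed.
HB.instance Definition _ := isMeasure.Build _ _ _
  lebesgue_step step0 step_ge0 step_sigma_additive.

Let step_sigma_finite : sigma_finite setT lebesgue_step.
Proof.
have /sigma_finiteP[F [TF ndF Foo]] := sigma_finiteT (@lebesgue_measure R).
have /sigma_finiteP[G [TG ndG Goo]] := sigma_finiteT mu.
exists (fun k => @vuncons n @^-1` (F k `*` G k)).
  rewrite -preimage_bigcup [X in _ @^-1` X](_ : _ = setT) ?preimage_setT//.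
  rewrite -setXTT TF TG predeqE => -[x y]; split.
    by move=> [k _ []/= ? ?]; split; exists k.
  move=> [/= [k _ Fkx] [l _ Gly]]; exists (maxn k l) => //; split.
  - by move: x Fkx; exact/subsetPset/ndF/leq_maxl.
  - by move: y Gly; exact/subsetPset/ndG/leq_maxr.
move=> k; have [? ?] := Foo k; have [? ?] := Goo k; split.
  rewrite -[X in measurable X]setTI; apply: measurable_vuncons => //.
  exact: measurableX.
rewrite /lebesgue_step -comp_preimage (_ : _ \o _ = id); last first.
  by apply/funext => p; exact: vconsK.
by rewrite preimage_id product_measure1E// lte_mul_pinfty// ge0_fin_numE.
Qed.
HB.instance Definition _ := Measure_isSigmaFinite.Build _ _ _
  lebesgue_step step_sigma_finite.
End step.

(* The n-fold product of the Lebesgue measure of R, on Borel sets. *)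
Fixpoint lebesgueN n : {sigma_finite_measure set 'rV[R]_n -> \bar R} :=
  match n with
  | 0 => \d_(0%R : 'rV[R]_0)
  | n.+1 => lebesgue_step (lebesgueN n)
  end.

Lemma lebesgueN_box n (a b : 'rV[R]_n) :
  (forall i, a ord0 i <= b ord0 i)%R ->
  lebesgueN n [set x | forall i, a ord0 i <= x ord0 i <= b ord0 i]%R =
  (\prod_(i < n) (b ord0 i - a ord0 i))%:E.
Proof.
elim: n a b => [|n IH] a b ab.
  rewrite big_ord0 /= diracE mem_set//; by case.
rewrite big_ord_recl EFinM /= /lebesgue_step.
rewrite (_ : _ @^-1` _ = `[a ord0 ord0, b ord0 ord0] `*`
   [set y : 'rV[R]_n | forall i, (\row_j a ord0 (lift ord0 j)) ord0 i <= y ord0 i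
     <= (\row_j b ord0 (lift ord0 j)) ord0 i]%R); last first.
  apply/seteqP; split => [[x y] /= H|[x y] /= [H1 H2] i].
    split; first by have := H ord0; rewrite vconsE0 in_itv.
    by move=> i; have := H (lift ord0 i); rewrite vconsES !mxE.
  case: (unliftP ord0 i) => [j ->|->]; last by move: H1; rewrite vconsE0 in_itv.
  by have := H2 j; rewrite vconsES !mxE.
rewrite product_measure1E; last 2 first.
  exact: measurable_itv.
  rewrite (_ : mkset _ = \bigcap_(i in [set: 'I_n])
     ((fun x : 'rV[R]_n => x ord0 i) @^-1` `[(\row_j a ord0 (lift ord0 j)) ord0 i,
        (\row_j b ord0 (lift ord0 j)) ord0 i])); last first.
    apply/seteqP; split => [y H i _|y H i] /=; first by rewrite in_itv /=; exact: H.
    by have := H i I; rewrite /= in_itv.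
  apply: fin_bigcap_measurable => // i _.
  by rewrite -[X in measurable X]setTI; apply: measurable_coord => //; exact: measurable_itv.
have abS i : ((\row_j a ord0 (lift ord0 j)) ord0 i <=
    (\row_j b ord0 (lift ord0 j)) ord0 i)%R.
  by rewrite !mxE; exact: ab.
rewrite [X in _ * X](IH _ _ abS); congr (_ * _).
  rewrite [LHS]lebesgue_measure_itv /= lte_fin.
  have := ab ord0; rewrite le_eqVlt => /orP[/eqP ->|->]; last by rewrite EFinB.
  by rewrite ltxx subrr.
by congr EFin; apply: eq_bigr => i _; rewrite !mxE.
Qed.
End lebesgue.

(* The four choices of U: R, R^d, R^(d x d) and the symmetric matrices, the
   first two as matrices with one column. *)
Inductive value_kind :=
  ScalarValued | VectorValued | MatrixValued | SymValued.

Definition nrow (d : nat) (k : value_kind) : nat :=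
  if k is ScalarValued then 1%N else d.

Definition ncol (d : nat) (k : value_kind) : nat :=
  match k with ScalarValued | VectorValued => 1%N | _ => d end.

Definition Uspace (R : realType) (d : nat) (k : value_kind) :
    {vspace 'M[R]_(nrow d k, ncol d k)} :=
  match k return {vspace 'M[R]_(nrow d k, ncol d k)} with
  | SymValued => fixedSpace (linfun (@trmx R d d))
  | _ => fullv
  end.

Lemma Uspace_SymValuedP (R : realType) (d : nat) (w : 'M[R]_d) :
  reflect (w^T = w) (w \in Uspace R d SymValued).
Proof.
have E : linfun (@trmx R d d) w = w^T by rewrite lfunE.
by apply: (iffP (@fixedSpaceP _ _ (linfun (@trmx R d d)) w)); rewrite E.
Qed.

Definition U (R : realType) (d : nat) (k : value_kind) : vectType R :=
  subvs_of (Uspace R d k).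

Definition entry (R : realType) (d : nat) (k : value_kind) (w : U R d k)
    (i : 'I_(nrow d k)) (j : 'I_(ncol d k)) : R := vsval w i j.

Definition dotU (R : realType) (d : nat) (k : value_kind) (a b : U R d k) : R :=
  \sum_i \sum_j entry a i j * entry b i j.

Section geometry.
Context {R : realType} {d : nat}.
Local Notation E := 'rV[R]_d.

Definition vdot (x y : E) : R := \sum_i x ord0 i * y ord0 i.

(* Near each boundary point, the domain is the part of the space lying above
   the graph of a Lipschitz function over the hyperplane orthogonal to a unit
   vector nu.  The function g is given on R^d, but only its values on that
   hyperplane are used. *)
Definition lipschitz_boundary (Omega : set E) : Prop :=
  forall x0, (closure Omega `\` interior Omega) x0 ->
  exists (nu : E) (r L : R) (g : E -> R),
    [/\ vdot nu nu = 1, 0 < r, L.-lipschitz g &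
        forall x, ball x0 r x ->
          (Omega x <-> g (x - vdot x nu *: nu) < vdot x nu)].

Definition bounded_lipschitz_domain (Omega : set E) : Prop :=
  [/\ Omega !=set0, open Omega, connected Omega, bounded_set Omega &
      lipschitz_boundary Omega].

(* A finite union of finite intersections of closed half-spaces, a half-space
   {x | n . x <= c} being coded by (n, c). *)
Definition polyhedral_set (s : seq (seq (E * R))) : set E :=
  [set x | exists2 P, P \in s & forall h, h \in P -> vdot h.1 x <= h.2].

Definition polyhedral_element (T : set E) : Prop :=
  [/\ T !=set0, connected T, bounded_set T &
      exists s, T = interior (polyhedral_set s)].

(* Elements are open.  They need not be convex, and flat faces may be
   subdivided at will, so that face-to-face matching is no restriction on the
   elements as sets and does not appear. *)
Definition mesh_of (Omega : set E) (N : nat) (T : 'I_N -> set E) : Prop :=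
  [/\ forall i, polyhedral_element (T i) /\ T i `<=` Omega,
      forall i j, i != j -> T i `&` T j = set0 &
      closure Omega = \bigcup_i closure (T i)].

End geometry.

Section diffop.
Context {R : realType} {d : nat}.
Local Notation E := 'rV[R]_d.

Definition partial (i : 'I_d) (f : E -> R) : E -> R :=
  fun x => 'D_(delta_mx ord0 i) f x.

Definition smooth (f : E -> R) : Prop :=
  forall s : seq 'I_d, continuous (foldr partial f s) /\
    forall i x, derivable (foldr partial f s) x (delta_mx ord0 i).

Definition test_function (D : set E) (f : E -> R) : Prop :=
  [/\ smooth f, compact (closure [set x | f x != 0]) &
      closure [set x | f x != 0] `<=` D].

Definition multi_partial (alpha : 'I_d -> nat) (f : E -> R) : E -> R :=
  foldr (fun i g => iter (alpha i) (partial i) g) f (enum 'I_d).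

Context {k : value_kind}.

Definition test_functionU (D : set E) (psi : E -> U R d k) : Prop :=
  forall i j, test_function D (fun x => entry (psi x) i j).

End diffop.

(* Scalar-to-U operators v |-> \sum_alpha (d^alpha v) a_alpha with constant
   coefficients, where every component of alpha is at most [maxdeg]. *)
Record diffop (R : realType) (d : nat) (k : value_kind) := DiffOp {
  maxdeg : nat;
  coef : {ffun 'I_d -> 'I_maxdeg.+1} -> U R d k
}.

Section operators.
Context {R : realType} {d : nat} {k : value_kind}.
Local Notation E := 'rV[R]_d.
Local Notation V := (U R d k).
Variable A : diffop R d k.

Definition apply_op (f : E -> R) : E -> V :=
  fun x => \sum_(alpha : {ffun 'I_d -> 'I_(maxdeg A).+1})
    multi_partial (fun i => alpha i) f x *: coef alpha.

Definition apply_adj (psi : E -> V) : E -> R :=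
  fun x => \sum_(alpha : {ffun 'I_d -> 'I_(maxdeg A).+1})
    (-1) ^+ (\sum_i alpha i)%N *
    multi_partial (fun i => alpha i) (fun y => dotU (coef alpha) (psi y)) x.

(* Functions are representatives, identified when they agree almost everywhere
   on the domain under consideration; their values outside it are irrelevant. *)
Local Notation mu := (lebesgueN d).

Definition L2 (D : set E) : set (E -> R) :=
  [set v | (v \_ D) \in Lfun mu 2%:E].

Definition L2U (D : set E) : set (E -> V) :=
  [set w | forall i j, L2 D (fun x => entry (w x) i j)].

Definition inner (D : set E) (u v : E -> R) : R :=
  \int[mu]_(x in D) (u x * v x).

Definition innerU (D : set E) (w z : E -> V) : R :=
  \int[mu]_(x in D) dotU (w x) (z x).

Definition norm2 (D : set E) (v : E -> R) : R := Num.sqrt (inner D v v).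

Definition norm2U (D : set E) (w : E -> V) : R := Num.sqrt (innerU D w w).

(* A v = g and A^* w = h on D in the sense of distributions. *)
Definition is_op (D : set E) (v : E -> R) (g : E -> V) : Prop :=
  forall psi : E -> V, test_functionU D psi ->
    innerU D g psi = inner D v (apply_adj psi).

Definition is_adj (D : set E) (w : E -> V) (h : E -> R) : Prop :=
  forall phi : E -> R, test_function D phi ->
    inner D h phi = innerU D w (apply_op phi).

Definition H_op (D : set E) : set (E -> R) :=
  [set v | L2 D v /\ exists2 g, L2U D g & is_op D v g].

Definition H_adj (D : set E) : set (E -> V) :=
  [set w | L2U D w /\ exists2 h, L2 D h & is_adj D w h].

(* Representatives on D of A v, for v in [H_op D], and of A^* w, for w in
   [H_adj D]. *)
Definition dop (D : set E) (v : E -> R) : E -> V :=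
  xget 0 [set g | L2U D g /\ is_op D v g].

Definition dadj (D : set E) (w : E -> V) : E -> R :=
  xget 0 [set h | L2 D h /\ is_adj D w h].

Definition norm_op (D : set E) (v : E -> R) : R :=
  Num.sqrt (inner D v v + innerU D (dop D v) (dop D v)).

Definition norm_adj (D : set E) (w : E -> V) : R :=
  Num.sqrt (innerU D w w + inner D (dadj D w) (dadj D w)).

(* Functionals on a space H of functions are represented by their extension by
   zero outside H, so that equality of functionals on H is equality. *)
Definition trace_bdry (Omega : set E) (v : E -> R) : (E -> V) -> R :=
  (fun w => innerU Omega (dop Omega v) w - inner Omega v (dadj Omega w))
    \_ (H_adj Omega).

Definition H_op0 (Omega : set E) : set (E -> R) :=
  [set v | H_op Omega v /\ trace_bdry Omega v = 0].

Section broken.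
Variables (Omega : set E) (N : nat) (T : 'I_N -> set E).

Definition H_adj_broken : set (E -> V) :=
  [set w | L2U Omega w /\
    forall i, exists2 h, L2 (T i) h & is_adj (T i) w h].

Definition inner_broken (v : E -> R) (w : E -> V) : R :=
  \sum_i inner (T i) v (dadj (T i) w).

Definition dadj_broken (w : E -> V) : E -> R :=
  fun x => \sum_i (dadj (T i) w \_ (T i)) x.

Definition norm_adj_broken (w : E -> V) : R :=
  Num.sqrt (innerU Omega w w +
    \sum_i inner (T i) (dadj (T i) w) (dadj (T i) w)).

Variable Ht : set (E -> V).

Definition trace_skel (v : E -> R) : (E -> V) -> R :=
  (fun w => innerU Omega (dop Omega v) w - inner_broken v w) \_ Ht.

Definition H_skel : set ((E -> V) -> R) := trace_skel @` H_op Omega.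

Definition H_skel0 : set ((E -> V) -> R) := trace_skel @` H_op0 Omega.

Definition norm_skel (phi : (E -> V) -> R) : R :=
  inf [set norm_op Omega v | v in [set v | H_op Omega v /\ trace_skel v = phi]].

End broken.

(* C lies in L_infty when its entries do; checking dotU (C x a) b for fixed a
   and b suffices as U is finite dimensional. *)
Definition admissible_tensor (Omega : set E) (C : E -> 'End(V)) : Prop :=
  [/\ forall a b : V, ((fun x => dotU (C x a) b) \_ Omega) \in Lfun mu +oo%E,
      {ae mu, forall x, Omega x -> forall a b, dotU (C x a) b = dotU a (C x b)} &
      exists2 c : R, 0 < c &
        {ae mu, forall x, Omega x -> forall a, c * dotU a a <= dotU (C x a) a}].

(* Almost everywhere in Omega the endomorphism C x is invertible, and there the
   generalized inverse of linear maps is its inverse. *)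
Definition apply_inv (C : E -> 'End(V)) (w : E -> V) : E -> V :=
  fun x => (C x)^-1%VF (w x).

Definition mixed_solution (Omega : set E) (N : nat) (T : 'I_N -> set E)
    (C : E -> 'End(V)) (f : E -> R)
    (W : set (E -> V)) (X : set (E -> R)) (Phi : set ((E -> V) -> R))
    (w : E -> V) (u : E -> R) (phi : (E -> V) -> R) : Prop :=
  [/\ W w, X u, Phi phi,
      forall dw, W dw ->
        innerU Omega (apply_inv C w) dw - inner_broken T u dw - phi dw = 0 &
      forall du dphi, X du -> Phi dphi ->
        - inner_broken T du w - dphi w = - inner Omega f du].

End operators.

Section subspaces.
Context {R : realType} {V : lmodType R}.

Definition linear_subspace (S : set V) : Prop :=
  S 0 /\ forall (c : R) u v, S u -> S v -> S (c *: u + v).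

(* Finite dimension modulo the identification [eqv] of vectors. *)
Definition finite_dim_subspace (eqv : V -> V -> Prop) (S : set V) : Prop :=
  linear_subspace S /\
  exists (n : nat) (e : 'I_n -> V), (forall i, S (e i)) /\
    forall v, S v -> exists c : 'I_n -> R, eqv v (\sum_i c i *: e i).

Definition closed_subspace (H : set V) (norm : V -> R) (S : set V) : Prop :=
  [/\ linear_subspace S, S `<=` H &
      forall v, H v ->
        (forall e, 0 < e -> exists2 s, S s & norm (v - s) < e) -> S v].

End subspaces.

Definition ae_equal (R : realType) (d : nat) (W : Type) (Omega : set 'rV[R]_d)
    (f g : 'rV[R]_d -> W) : Prop :=
  f = g %[ae lebesgueN d in Omega].

(* Main.v *)
Require Import Defs.
From HB Require Import structures.
From mathcomp Require Import all_boot all_order all_algebra.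
From mathcomp Require Import all_classical all_reals all_analysis.
From mathcomp Require Import ess_sup_inf measurable_realfun ring lra.
Set Implicit Arguments.
Unset Strict Implicit.
Unset Printing Implicit Defensive.
Import Order.TTheory GRing.Theory Num.Theory.
Import numFieldNormedType.Exports.
Local Open Scope classical_set_scope.
Local Open Scope ring_scope.

(* The discrete problem is stable with a constant that depends only on C, c_is,
   C1 and C2.  Since A^*_T maps the discrete stress space into the discrete
   space for u, testing with residuals bounds A^*_T w_h, and the coercivity of
   C^-1 bounds w_h in terms of the data and of u_h and phi_h.  By the inf-sup
   condition u_h is, up to a constant, bounded by (u_h, A^* z) for a conforming
   unit field z; the traces in H_0(A,S) vanish on conforming fields, so F1 z is
   an admissible discrete test function that sees u_h only.  For phi_h, the
   trace norm is the norm of the dual of H~(A^*,T): the Riesz representer w0 of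
   a trace phi satisfies A (A^*_T w0) = - w0, so that - A^*_T w0 is an extension
   of phi of the same norm; F2 transfers the dual norm to discrete test
   functions.  Stability gives uniqueness, hence existence in finite dimension,
   and, with Galerkin orthogonality, the quasi-optimal error estimate. *)

(** * Semi-inner product spaces *)

Section subspace.
Context {R : realType} {V : lmodType R}.
Implicit Types (S : set V).

Lemma subspace0 S : linear_subspace S -> S 0.
Proof. by case. Qed.

Lemma subspaceZ S c u : linear_subspace S -> S u -> S (c *: u).
Proof. by move=> [S0 SL] Su; rewrite -[_ *: _]addr0; exact: SL. Qed.

Lemma subspaceD S u v : linear_subspace S -> S u -> S v -> S (u + v).
Proof. by move=> [S0 SL] Su Sv; rewrite -[u]scale1r; exact: SL. Qed.

Lemma subspaceB S u v : linear_subspace S -> S u -> S v -> S (u - v).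
Proof. by move=> [S0 SL] Su Sv; rewrite addrC -scaleN1r; exact: SL. Qed.

Lemma subspace_sum S (I : finType) (c : I -> R) (e : I -> V) :
  linear_subspace S -> (forall i, S (e i)) -> S (\sum_i c i *: e i).
Proof.
move=> SL Se; elim/big_ind : _ => [|u v|i _].
- exact: subspace0.
- exact: subspaceD.
- exact: subspaceZ.
Qed.

Definition linear_on S (l : V -> R) : Prop :=
  forall c u v, S u -> S v -> l (c *: u + v) = c * l u + l v.

Section linear_on.
Variables (S : set V) (l : V -> R).
Hypotheses (SL : linear_subspace S) (lL : linear_on S l).

Lemma linear_on0 : l 0 = 0.
Proof.
have := lL 1 (subspace0 SL) (subspace0 SL).
rewrite scaler0 addr0 mul1r => /eqP; rewrite -subr_eq0 opprD addNKr oppr_eq0.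
by move/eqP.
Qed.

Lemma linear_onZ c u : S u -> l (c *: u) = c * l u.
Proof.
by move=> Su; rewrite -[c *: u]addr0 lL ?linear_on0 ?addr0//; exact: subspace0.
Qed.

Lemma linear_onD u v : S u -> S v -> l (u + v) = l u + l v.
Proof. by move=> Su Sv; rewrite -{1}[u]scale1r lL// mul1r. Qed.

Lemma linear_onB u v : S u -> S v -> l (u - v) = l u - l v.
Proof. by move=> Su Sv; rewrite addrC -scaleN1r lL// mulN1r addrC. Qed.

Lemma linear_on_sum (I : finType) (c : I -> R) (e : I -> V) :
  (forall i, S (e i)) -> l (\sum_i c i *: e i) = \sum_i c i * l (e i).
Proof.
move=> Se; rewrite -!big_enum /=; elim: (enum I) => [|i s IH].
  by rewrite !big_nil linear_on0.
rewrite !big_cons lL ?IH//; elim: (s) => [|j s' ?].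
  by rewrite big_nil; exact: subspace0.
by rewrite big_cons; case: SL => _; apply.
Qed.

End linear_on.
End subspace.

Section semi_inner.
Context {R : realType} {V : lmodType R}.

Record semi_inner (H : set V) (ip : V -> V -> R) : Prop := SemiInner {
  si_sub : linear_subspace H;
  si_sym : forall u v, H u -> H v -> ip u v = ip v u;
  si_lin : forall w, H w -> linear_on H (ip ^~ w);
  si_ge0 : forall u, H u -> 0 <= ip u u }.

Definition seminorm (ip : V -> V -> R) (u : V) : R := Num.sqrt (ip u u).

Definition si_complete (H : set V) (ip : V -> V -> R) : Prop :=
  forall u : nat -> V, (forall n, H (u n)) ->
    (forall n, seminorm ip (u n.+1 - u n) <= 2^-1 ^+ n) ->
    exists2 l, H l & seminorm ip (u n - l) @[n --> \oo] --> (0 : R).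

Variables (H : set V) (ip : V -> V -> R).
Hypothesis siH : semi_inner H ip.
Local Notation nrm := (seminorm ip).
Let HL := si_sub siH.

Lemma si_linr w : H w -> linear_on H (ip w).
Proof.
move=> Hw c u v Hu Hv.
have Hcuv : H (c *: u + v) by case: HL => _; exact.
by rewrite (si_sym siH)// (si_lin siH)// (si_sym siH Hu)// (si_sym siH Hv).
Qed.

Lemma seminorm_ge0 u : 0 <= nrm u. Proof. exact: sqrtr_ge0. Qed.

Lemma seminorm_sqr u : H u -> nrm u ^+ 2 = ip u u.
Proof. by move=> Hu; rewrite sqr_sqrtr//; exact: (si_ge0 siH). Qed.

Lemma si_sqrD c u v : H u -> H v ->
  ip (c *: u + v) (c *: u + v) = c ^+ 2 * ip u u + 2 * c * ip u v + ip v v.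
Proof.
move=> Hu Hv; have Hcuv : H (c *: u + v) by case: HL => _; exact.
rewrite (si_lin siH)// !si_linr// (si_sym siH Hv Hu); ring.
Qed.

Lemma si_CauchySchwarz u v : H u -> H v -> `|ip u v| <= nrm u * nrm v.
Proof.
move=> Hu Hv.
rewrite -(@ler_pXn2r _ 2)//; last by rewrite nnegrE mulr_ge0 ?seminorm_ge0.
rewrite exprMn !seminorm_sqr// real_normK ?num_real//.
have P t : 0 <= t ^+ 2 * ip u u + 2 * t * ip u v + ip v v.
  by rewrite -si_sqrD//; apply: (si_ge0 siH); case: HL => _; exact.
have a0 := si_ge0 siH Hu; have c0 := si_ge0 siH Hv.
have [a_eq0|a_neq0] := eqVneq (ip u u) 0.
  rewrite a_eq0 mul0r; have [->|b0] := eqVneq (ip u v) 0; first by rewrite expr0n.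
  have := P (- (ip v v + 1) / (2 * ip u v)).
  rewrite a_eq0 mulr0 add0r.
  have -> : 2 * (- (ip v v + 1) / (2 * ip u v)) * ip u v = - (ip v v + 1) by field.
  lra.
have a_gt0 : 0 < ip u u by rewrite lt_neqAle eq_sym a_neq0.
have := P (- ip u v / ip u u).
have -> : (- ip u v / ip u u) ^+ 2 * ip u u + 2 * (- ip u v / ip u u) * ip u v
  + ip v v = (ip u u * ip v v - ip u v ^+ 2) / ip u u by field.
by rewrite pmulr_lge0 ?invr_gt0// subr_ge0.
Qed.

Lemma seminormZ c u : H u -> nrm (c *: u) = `|c| * nrm u.
Proof.
move=> Hu; have Hcu : H (c *: u) by exact: subspaceZ.
rewrite /seminorm (linear_onZ HL (si_lin siH Hcu))//.
rewrite (linear_onZ HL (si_linr Hu))// mulrA -expr2 sqrtrM ?sqr_ge0//.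
by rewrite sqrtr_sqr.
Qed.

Lemma seminormD u v : H u -> H v -> nrm (u + v) <= nrm u + nrm v.
Proof.
move=> Hu Hv; rewrite -(@ler_pXn2r _ 2)//; last 2 first.
- by rewrite nnegrE seminorm_ge0.
- by rewrite nnegrE addr_ge0 ?seminorm_ge0.
rewrite seminorm_sqr; last exact: subspaceD.
rewrite -[u]scale1r si_sqrD// scale1r sqrrD !seminorm_sqr//.
have := si_CauchySchwarz Hu Hv; have := ler_norm (ip u v); lra.
Qed.

Lemma seminormC u v : H u -> H v -> nrm (u - v) = nrm (v - u).
Proof.
move=> Hu Hv; have Huv := subspaceB HL Hv Hu.
by rewrite -(opprB v u) -(scaleN1r (v - u)) seminormZ// normrN1 mul1r.
Qed.

Lemma seminorm_dist u v w : H u -> H v -> H w ->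
  nrm (u - w) <= nrm (u - v) + nrm (v - w).
Proof.
move=> Hu Hv Hw; rewrite -[u - w](subrKA v); apply: seminormD; exact: subspaceB.
Qed.

Lemma seminorm0_ip u v : H u -> H v -> nrm u = 0 -> ip u v = 0.
Proof.
move=> Hu Hv u0; have := si_CauchySchwarz Hu Hv.
by rewrite u0 mul0r normr_le0 => /eqP.
Qed.

Lemma si_cvg_ip (w : nat -> V) (l v : V) : (forall n, H (w n)) -> H l -> H v ->
  seminorm ip (w n - l) @[n --> \oo] --> (0 : R) ->
  ip (w n) v @[n --> \oo] --> ip l v.
Proof.
move=> Hw Hl Hv wl; apply/cvgrPdist_le => e e0.
have e1 : 0 < e / (nrm v + 1) by rewrite divr_gt0// ltr_wpDl// seminorm_ge0.
move/cvgrPdist_le : wl => /(_ _ e1); apply: filterS => n.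
rewrite sub0r normrN ger0_norm ?seminorm_ge0// => wne.
rewrite distrC -(linear_onB (si_lin siH Hv))//.
apply: (le_trans (si_CauchySchwarz _ Hv)); first exact: subspaceB.
apply: (@le_trans _ _ (e / (nrm v + 1) * nrm v)).
  by rewrite ler_wpM2r// seminorm_ge0.
rewrite mulrAC ler_pdivrMr ?ltr_wpDl ?seminorm_ge0//.
by rewrite ler_pM2l// lerDl.
Qed.

Lemma riesz_representation (L : V -> R) (M : R) :
  si_complete H ip -> linear_on H L ->
  (forall v, H v -> `|L v| <= M * nrm v) ->
  exists2 w, H w & forall v, H v -> L v = ip w v.
Proof.
move=> Hcpl LL LM.
have LB v : H v -> L v <= M * nrm v.
  by move=> Hv; apply: le_trans (LM _ Hv); exact: ler_norm.
pose J v := ip v v - 2 * L v.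
pose m := inf [set J v | v in H].
have hi : has_inf [set J v | v in H].
  split; first by exists (J 0); exists 0 => //; exact: subspace0.
  exists (- M ^+ 2) => _ [v Hv <-]; rewrite /J -seminorm_sqr//.
  have := LB _ Hv; have := sqr_ge0 (nrm v - M); rewrite sqrrB; lra.
have mJ v : H v -> m <= J v.
  by move=> Hv; apply: ge_inf; [exact: (proj2 hi)|exists v].
have /choice[w Hw] n : exists w, H w /\ J w < m + (4^-1) ^+ n.+1.
  have e0 : (0 : R) < (4^-1) ^+ n.+1 by rewrite exprn_gt0// invr_gt0.
  by have [_ [v Hv <-] ?] := inf_adherent e0 hi; exists v.
have EL n v t : H v -> - (4^-1) ^+ n.+1 <= t ^+ 2 * ip v v + 2 * t * (ip (w n) v - L v).
  move=> Hv; have [Hwn Jn] := Hw n.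
  have := mJ (t *: v + w n).
  rewrite /J si_sqrD// (LL t _ _ Hv Hwn) => /(_ _)/wrap[].
    by case: HL => _; exact.
  rewrite (si_sym siH Hv)//; move: Jn; rewrite /J; lra.
have cauchy n : nrm (w n.+1 - w n) <= 2^-1 ^+ n.
  have [Ha Ja] := Hw n; have [Hb Jb] := Hw n.+1.
  rewrite -(@ler_pXn2r _ 2)//; last 2 first.
  - by rewrite nnegrE seminorm_ge0.
  - by rewrite nnegrE exprn_ge0// invr_ge0.
  rewrite seminorm_sqr; last exact: subspaceB.
  have -> : w n.+1 - w n = (-1) *: w n + w n.+1 by rewrite scaleN1r addrC.
  rewrite si_sqrD// -exprM mulnC exprM.
  have -> : (2^-1 : R) ^+ 2 = 4^-1 by rewrite exprVn -natrX.
  have := mJ (2^-1 *: w n + 2^-1 *: w n.+1).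
  have H2 u : H u -> H (2^-1 *: u) by move=> Hu; exact: subspaceZ.
  move=> /(_ _)/wrap[]; first by apply: subspaceD => //; exact: H2.
  rewrite /J LL//; last exact: H2.
  rewrite si_sqrD//; last exact: H2.
  rewrite (linear_onZ HL LL)// (linear_onZ HL (si_linr Ha))//.
  rewrite (linear_onZ HL (si_linr (H2 _ Hb)))//.
  rewrite (si_sym siH (H2 _ Hb) Hb) (linear_onZ HL (si_linr Hb))//.
  move: Ja Jb; rewrite /J !exprS.
  have : (0 : R) <= 4^-1 ^+ n by rewrite exprn_ge0// invr_ge0.
  lra.
have [l Hl wl] := Hcpl w (fun n => proj1 (Hw n)) cauchy.
exists l => // v Hv.
have ipl : ip (w n) v @[n --> \oo] --> ip l v.
  by apply: si_cvg_ip => // n; have [] := Hw n.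
have E t : 0 <= t ^+ 2 * ip v v + 2 * t * (ip l v - L v).
  have c1 : (t ^+ 2 * ip v v + 2 * t * (ip (w n) v - L v)) @[n --> \oo] -->
      t ^+ 2 * ip v v + 2 * t * (ip l v - L v).
    apply: cvgD; first exact: cvg_cst.
    by apply: cvgMr; apply: cvgB => //; exact: cvg_cst.
  have c2 : (- (4^-1) ^+ n.+1 : R) @[n --> \oo] --> (- 0 : R).
    apply: cvgN; rewrite -/(cvg_to _ _).
    have := @cvg_expr R 4^-1; rewrite ger0_norm ?invr_ge0// => /(_ _)/wrap[].
      by rewrite invf_lt1// ltr1n.
    by rewrite -(cvg_shiftS (fun n => 4^-1 ^+ n : R)).
  rewrite -oppr0; apply: (@ler_cvg_to _ _ _ _ _ _ _ _ c2 c1).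
  by near=> n; exact: EL.
have v0 := si_ge0 siH Hv.
apply/eqP; rewrite eq_sym -subr_eq0; apply/negPn/negP => b0.
set b := ip l v - L v in b0 E; set a := ip v v in E v0.
have a1 : 0 < a + 1 by lra.
have := E (- b / (a + 1)).
have -> : (- b / (a + 1)) ^+ 2 * a + 2 * (- b / (a + 1)) * b =
  - (b ^+ 2 * (a + 2) / (a + 1) ^+ 2) by field; rewrite gt_eqF.
rewrite oppr_ge0 leNgt => /negP; apply.
by rewrite divr_gt0 ?exprn_gt0// mulr_gt0 ?exprn_even_gt0//; lra.
Unshelve. all: by end_near. Qed.

End semi_inner.

(** * Galerkin approximation of mixed problems *)

Lemma linear_system_solvable (F : fieldType) (I : finType) (M : I -> I -> F)
    (L : I -> F) :
  (forall c, (forall i, \sum_j c j * M i j = 0) -> \sum_j c j * L j = 0) ->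
  exists c, forall j, \sum_i c i * M i j = L j.
Proof.
move=> H.
pose B := \matrix_(i < #|I|, j < #|I|) M (enum_val i) (enum_val j).
pose b : 'rV[F]_#|I| := \row_j L (enum_val j).
have sum_val (G : I -> F) : \sum_i G i = \sum_(i < #|I|) G (enum_val i).
  by rewrite (reindex (@enum_val _ I))//; exact/onW_bij/enum_val_bij.
have bB : (b <= B)%MS.
  rewrite submxE; apply/eqP/matrixP => i0 j; rewrite ord1 [RHS]mxE.
  have := H (fun i => cokermx B (enum_rank i) j).
  rewrite sum_val => /(_ _)/wrap[] => [i|].
    transitivity ((B *m cokermx B) (enum_rank i) j).
      rewrite mxE sum_val; apply: eq_bigr => l _.
      by rewrite enum_valK [B _ _]mxE enum_rankK mulrC.
    by rewrite mulmx_coker mxE.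
  move=> <-; rewrite mxE; apply: eq_bigr => l _.
  by rewrite enum_valK [b _ _]mxE mulrC.
have /submxP[x bx] := bB.
exists (fun i => x ord0 (enum_rank i)) => j; rewrite sum_val.
have -> : L j = b ord0 (enum_rank j) by rewrite mxE enum_rankK.
rewrite bx mxE; apply: eq_bigr => l _.
by rewrite [B _ _]mxE enum_valK enum_rankK.
Qed.

Lemma stability_constant (R : realType) (alpha beta c C1 C2 : R) :
  0 < alpha -> 0 < beta -> 0 < c -> 0 < C1 -> 0 < C2 ->
  exists2 K : R, 0 < K & forall S x y p t : R,
    0 <= S -> 0 <= x -> 0 <= t -> t <= S ->
    y <= C1 / c * (S + beta * x) -> p <= C2 * (S + beta * x + y) ->
    alpha * x ^+ 2 <= S * (x + t) + S * (y + p) ->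
    x + t + y + p <= K * S.
Proof.
move=> a0 b0 c0 C10 C20; pose k1 := C1 / c * (1 + beta).
pose k2 := C2 * (1 + beta + k1); pose k3 := 1 + k1 + k2.
pose k4 := 1 + 2 * k3 / alpha.
have k10 : 0 < k1 by rewrite mulr_gt0 ?divr_gt0//; lra.
have k20 : 0 < k2 by rewrite mulr_gt0//; lra.
have k30 : 0 < k3 by rewrite /k3; lra.
have k40 : 0 < k4 by rewrite /k4 ltr_pwDl// divr_ge0//; lra.
exists (k4 + 1 + (k1 + k2) * (1 + k4)); first by nra.
move=> S x y p t S0 x0 t0 tS yS pS aS.
have Sx : S + beta * x <= (1 + beta) * (S + x) by nra.
have y1 : y <= k1 * (S + x).
  by apply: (le_trans yS); rewrite /k1 -(mulrA (C1 / c)) ler_wpM2l// divr_ge0// ltW.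
have p1 : p <= k2 * (S + x).
  by apply: (le_trans pS); rewrite /k2 -(mulrA C2) ler_wpM2l ?(ltW C20)// (mulrDl (1 + beta)) lerD.
have aS2 : alpha * x ^+ 2 <= S * (k3 * (S + x)).
  apply: (le_trans aS); rewrite -mulrDr ler_wpM2l// /k3; lra.
have x4 : x <= k4 * S.
  have [xS|Sx'] := leP x S.
    by apply: (le_trans xS); rewrite /k4 ler_peMl// lerDl divr_ge0//; lra.
  have x_gt0 : 0 < x by lra.
  have : alpha * x <= 2 * k3 * S.
    rewrite -(ler_pM2r x_gt0); apply: (@le_trans _ _ (S * (k3 * (S + x)))).
      by rewrite -mulrA -expr2.
    rewrite [X in _ <= X](_ : _ = S * (k3 * (x + x))); last by ring.
    by rewrite ler_wpM2l// ler_wpM2l ?(ltW k30)// lerD2r ltW.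
  move=> ax; have : x <= 2 * k3 / alpha * S.
    by rewrite mulrAC ler_pdivlMr// mulrC.
  by rewrite /k4; lra.
have : (k1 + k2) * (S + x) <= (k1 + k2) * (S + k4 * S).
  by rewrite ler_wpM2l ?lerD2l// addr_ge0 ?ltW.
lra.
Qed.

Section graph_form.
Context {R : realType} {W X : lmodType R}.
Variables (H : set W) (L : set X) (ipW : W -> W -> R) (ipX : X -> X -> R) (D : W -> X).

Definition graph_form (w z : W) : R := ipW w z + ipX (D w) (D z).

Hypotheses (siW : semi_inner H ipW) (siX : semi_inner L ipX).
Hypothesis (DL : forall w, H w -> L (D w)).
Hypothesis Dlin : forall x, L x -> linear_on H (fun w => ipX x (D w)).

Lemma graph_semi_inner : semi_inner H graph_form.
Proof.
have HL := si_sub siW.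
split => // [u v Hu Hv|w Hw e u v Hu Hv|u Hu]; rewrite /graph_form.
- by rewrite (si_sym siW)// (si_sym siX)//; exact: DL.
- have Huv : H (e *: u + v) by case: HL => _; exact.
  rewrite (si_lin siW)// (si_sym siX (DL Huv))//; last exact: DL.
  rewrite (Dlin (DL Hw))// (si_sym siX (DL Hw) (DL Hu)).
  rewrite (si_sym siX (DL Hw) (DL Hv)); ring.
- rewrite addr_ge0//; first exact: (si_ge0 siW).
  by apply: (si_ge0 siX); exact: DL.
Qed.

Lemma graph_ge_base w : H w -> seminorm ipW w <= seminorm graph_form w.
Proof.
by move=> Hw; rewrite ler_wsqrtr// lerDl; apply: (si_ge0 siX); exact: DL.
Qed.

Lemma graph_ge_image w : H w -> seminorm ipX (D w) <= seminorm graph_form w.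
Proof. by move=> Hw; rewrite ler_wsqrtr// lerDr; exact: (si_ge0 siW). Qed.

Lemma graph_le w : H w ->
  seminorm graph_form w <= seminorm ipW w + seminorm ipX (D w).
Proof.
move=> Hw; rewrite -(@ler_pXn2r _ 2)//; last 2 first.
- by rewrite nnegrE seminorm_ge0.
- by rewrite nnegrE addr_ge0// seminorm_ge0.
rewrite (seminorm_sqr graph_semi_inner)// sqrrD (seminorm_sqr siW)//.
rewrite (seminorm_sqr siX); last exact: DL.
by rewrite /graph_form -addrA lerD2l lerDr mulrn_wge0// mulr_ge0// seminorm_ge0.
Qed.

End graph_form.

Section mixed_galerkin.
Context {R : realType} {W X P : lmodType R}.
Variables (Ht Hc : set W) (L : set X) (S0 : set P).
Variables (ipW : W -> W -> R) (ipX : X -> X -> R) (a : W -> W -> R).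
Variables (D : W -> X) (tr : P -> W -> R) (nP : P -> R).
Variables (alpha beta c : R).

Local Notation graph_form := (graph_form ipW ipX D).
Local Notation nW := (seminorm ipW).
Local Notation nX := (seminorm ipX).
Local Notation nA := (seminorm graph_form).

Record mixed_setting : Prop := MixedSetting {
  ms_W : semi_inner Ht ipW;
  ms_X : semi_inner L ipX;
  ms_D : forall w, Ht w -> L (D w);
  ms_Dlin : forall x, L x -> linear_on Ht (fun w => ipX x (D w));
  ms_alin : forall z, Ht z -> linear_on Ht (a ^~ z);
  ms_asym : forall w z, Ht w -> Ht z -> a w z = a z w;
  ms_alpha : 0 < alpha;
  ms_acoer : forall w, Ht w -> alpha * ipW w w <= a w w;
  ms_beta : 0 < beta;
  ms_abound : forall w z, Ht w -> Ht z -> `|a w z| <= beta * (nW w * nW z);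
  ms_S0 : linear_subspace S0;
  ms_trlin : forall phi, S0 phi -> linear_on Ht (tr phi);
  ms_trlinl : forall w, Ht w -> linear_on S0 (tr ^~ w);
  ms_nP0 : forall phi, 0 <= nP phi;
  ms_trbound : forall phi w, S0 phi -> Ht w -> `|tr phi w| <= nP phi * nA w;
  ms_nPbound : forall phi M, S0 phi -> 0 <= M ->
    (forall w, Ht w -> `|tr phi w| <= M * nA w) -> nP phi <= M;
  ms_Hc : Hc `<=` Ht;
  ms_trHc : forall phi w, S0 phi -> Hc w -> tr phi w = 0;
  ms_c : 0 < c;
  ms_infsup : forall x, L x -> exists z, [/\ Hc z, nA z <= 1 &
    c * nX x <= ipX x (D z)] }.

Hypothesis ms : mixed_setting.
Let HtL := si_sub (ms_W ms).
Let LL := si_sub (ms_X ms).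
Let S0L := ms_S0 ms.

Let gr : semi_inner Ht graph_form :=
  graph_semi_inner (ms_W ms) (ms_X ms) (ms_D ms) (ms_Dlin ms).

Let nW_le w : Ht w -> nW w <= nA w.
Proof. exact: graph_ge_base (ms_X ms) (ms_D ms) _. Qed.

Let nD_le w : Ht w -> nX (D w) <= nA w.
Proof. exact: graph_ge_image (ms_W ms) _. Qed.

Let nA_le w : Ht w -> nA w <= nW w + nX (D w).
Proof. exact: graph_le (ms_W ms) (ms_X ms) (ms_D ms) (ms_Dlin ms) _. Qed.

Lemma ipXD_bound x w : L x -> Ht w -> `|ipX x (D w)| <= nX x * nA w.
Proof.
move=> Lx Hw; apply: (le_trans (si_CauchySchwarz (ms_X ms) Lx (ms_D ms Hw))).
by rewrite ler_wpM2l ?seminorm_ge0// nD_le.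
Qed.

Lemma a_bound w z : Ht w -> Ht z -> `|a w z| <= beta * (nW w * nA z).
Proof.
move=> Hw Hz; apply: (le_trans (ms_abound ms Hw Hz)).
by rewrite ler_wpM2l ?(ltW (ms_beta ms))// ler_wpM2l ?seminorm_ge0// nW_le.
Qed.

Lemma nP_zero : nP 0 = 0.
Proof.
apply/eqP; rewrite eq_le (ms_nP0 ms) andbT.
apply: (ms_nPbound ms) => // [|w Hw]; first exact: subspace0.
by rewrite (linear_on0 S0L (ms_trlinl ms Hw)) normr0 mul0r.
Qed.

Lemma nP_triangle phi psi : S0 phi -> S0 psi -> nP (phi + psi) <= nP phi + nP psi.
Proof.
move=> Hp Hq; apply: (ms_nPbound ms); first exact: subspaceD.
  by rewrite addr_ge0// (ms_nP0 ms).
move=> w Hw; rewrite (linear_onD (ms_trlinl ms Hw))// mulrDl.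
by apply: (le_trans (ler_normD _ _)); rewrite lerD// (ms_trbound ms).
Qed.

Lemma ms_alinr z : Ht z -> linear_on Ht (a z).
Proof.
move=> Hz e u v Hu Hv; have Huv : Ht (e *: u + v) by case: HtL => _; exact.
rewrite (ms_asym ms Hz Huv) (ms_alin ms)//.
by rewrite (ms_asym ms Hu Hz) (ms_asym ms Hv Hz).
Qed.

Definition mixed_eq (f : X) (W' : set W) (X' : set X) (P' : set P)
    (w : W) (u : X) (phi : P) : Prop :=
  [/\ W' w, X' u, P' phi,
      forall z, W' z -> a w z - ipX u (D z) - tr phi z = 0 &
      forall v eta, X' v -> P' eta -> - ipX v (D w) - tr eta w = - ipX f v].

Section discrete.
Variables (Wh : set W) (Xh : set X) (Ph : set P) (F1 F2 : W -> W) (C1 C2 : R).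
Hypotheses (WhL : linear_subspace Wh) (XhL : linear_subspace Xh)
  (PhL : linear_subspace Ph).
Hypotheses (WhHt : Wh `<=` Ht) (XhX : Xh `<=` L) (PhS0 : Ph `<=` S0).
Hypotheses (C1_gt0 : 0 < C1) (C2_gt0 : 0 < C2).
Hypothesis DWh : forall w, Wh w -> exists2 x, Xh x & nX (D w - x) = 0.
Hypothesis F1_in : forall z, Ht z -> (Wh `&` Hc) (F1 z).
Hypothesis F2_in : forall z, Ht z -> Wh (F2 z).
Hypothesis F1_orth : forall z, Ht z -> forall v, Xh v -> ipX v (D (z - F1 z)) = 0.
Hypothesis F2_orth : forall z, Ht z -> forall eta, Ph eta -> tr eta (z - F2 z) = 0.
Hypothesis F1_bound : forall z, Ht z -> nA (F1 z) <= C1 * nA z.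
Hypothesis F2_bound : forall z, Ht z -> nA (F2 z) <= C2 * nA z.

Variable K : R.
Hypothesis HK : forall S x y p t : R,
    0 <= S -> 0 <= x -> 0 <= t -> t <= S ->
    y <= C1 / c * (S + beta * x) -> p <= C2 * (S + beta * x + y) ->
    alpha * x ^+ 2 <= S * (x + t) + S * (y + p) ->
    x + t + y + p <= K * S.

Lemma discrete_stability w u phi S : 0 <= S -> Wh w -> Xh u -> Ph phi ->
  (forall z, Wh z -> `|a w z - ipX u (D z) - tr phi z| <= S * nA z) ->
  (forall v eta, Xh v -> Ph eta -> `|ipX v (D w) + tr eta w| <= S * (nX v + nP eta)) ->
  nA w + nX u + nP phi <= K * S.
Proof.
move=> S_ge0 Hw Hu Hphi E G.
have Htw := WhHt Hw; have Lu := XhX Hu; have Sphi := PhS0 Hphi.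
have nW0 := seminorm_ge0 ipW w.
have Dw : nX (D w) <= S.
  have [x Hx Dwx] := DWh Hw; have Lx := XhX Hx; have LDw := ms_D ms Htw.
  have xDw : ipX x (D w) = nX (D w) ^+ 2.
    rewrite (seminorm_sqr (ms_X ms))//; apply/eqP; rewrite eq_sym -subr_eq0.
    rewrite -(linear_onB (si_lin (ms_X ms) LDw))//.
    by rewrite (seminorm0_ip (ms_X ms) _ _ Dwx)//; exact: subspaceB.
  have nx : nX x <= nX (D w).
    have := seminormD (ms_X ms) LDw (subspaceB LL Lx LDw).
    by rewrite addrC subrK (seminormC (ms_X ms))// Dwx addr0.
  have := G _ 0 Hx (subspace0 PhL).
  rewrite (linear_on0 S0L (ms_trlinl ms Htw)) addr0 nP_zero addr0 xDw.
  rewrite ger0_norm ?sqr_ge0// => Sx.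
  have [->//|D0] := eqVneq (nX (D w)) 0.
  have D1 : 0 < nX (D w) by rewrite lt_neqAle eq_sym D0 seminorm_ge0.
  rewrite -(ler_pM2r D1) -expr2; apply: (le_trans Sx).
  by rewrite ler_wpM2l.
have main z : Wh z -> `|ipX u (D z) + tr phi z| <= (S + beta * nW w) * nA z.
  move=> Hz; have := E z Hz; have := a_bound Htw (WhHt Hz).
  move=> h1 h2; rewrite [X in `|X|](_ : _ = a w z - (a w z - ipX u (D z) - tr phi z)).
    by apply: (le_trans (ler_normB _ _)); lra.
  by ring.
have yS : nX u <= C1 / c * (S + beta * nW w).
  have [z [Hz z1 cz]] := ms_infsup ms Lu; have Htz := ms_Hc ms Hz.
  have [W1 Hc1] := F1_in Htz; have := main _ W1.
  rewrite (ms_trHc ms)// addr0.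
  have -> : ipX u (D (F1 z)) = ipX u (D z).
    apply/eqP; rewrite eq_sym -subr_eq0 -(linear_onB (ms_Dlin ms Lu))//.
      by rewrite F1_orth.
    exact: WhHt.
  move=> h; have cu : c * nX u <= (S + beta * nW w) * C1.
    apply: (le_trans cz); apply: (le_trans (ler_norm _)); apply: (le_trans h).
    rewrite ler_wpM2l ?addr_ge0 ?mulr_ge0 ?(ltW (ms_beta ms))//.
    apply: (le_trans (F1_bound Htz)).
    by rewrite -[leRHS]mulr1 ler_wpM2l// ltW.
  by rewrite mulrAC ler_pdivlMr ?(ms_c ms)// mulrC (mulrC C1).
have pS : nP phi <= C2 * (S + beta * nW w + nX u).
  apply: (ms_nPbound ms) => //.
    rewrite mulr_ge0 ?(ltW C2_gt0)// !addr_ge0 ?mulr_ge0 ?(ltW (ms_beta ms))//.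
    exact: seminorm_ge0.
  move=> z Htz; have W2 := F2_in Htz.
  have -> : tr phi z = tr phi (F2 z).
    apply/eqP; rewrite -subr_eq0 -(linear_onB (ms_trlin ms Sphi))//.
      by rewrite F2_orth.
    exact: WhHt.
  have h1 := main _ W2; have h2 := ipXD_bound Lu (WhHt W2).
  have : `|tr phi (F2 z)| <= (S + beta * nW w + nX u) * nA (F2 z).
    rewrite [X in `|X|](_ : _ = (ipX u (D (F2 z)) + tr phi (F2 z)) - ipX u (D (F2 z))).
      by apply: (le_trans (ler_normB _ _)); rewrite mulrDl; lra.
    by ring.
  move=> /le_trans; apply; rewrite (mulrC C2) -mulrA ler_wpM2l ?F2_bound//.
  by rewrite !addr_ge0 ?mulr_ge0 ?(ltW (ms_beta ms))// seminorm_ge0.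
have aw : alpha * nW w ^+ 2 <= S * (nW w + nX (D w)) + S * (nX u + nP phi).
  rewrite (seminorm_sqr (ms_W ms))//; apply: (le_trans (ms_acoer ms Htw)).
  have h1 := E w Hw; have h2 := G _ _ Hu Hphi.
  have -> : a w w = (a w w - ipX u (D w) - tr phi w) + (ipX u (D w) + tr phi w).
    by ring.
  apply: (le_trans (ler_norm _)); apply: (le_trans (ler_normD _ _)).
  apply: lerD => //; apply: (le_trans h1).
  by rewrite ler_wpM2l// nA_le.
have := HK S_ge0 nW0 (seminorm_ge0 ipX (D w)) Dw yS pS aw.
by apply: le_trans; rewrite !lerD2r nA_le.
Qed.

Lemma discrete_homogeneous w u phi : Wh w -> Xh u -> Ph phi ->
  (forall z, Wh z -> a w z - ipX u (D z) - tr phi z = 0) ->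
  (forall v eta, Xh v -> Ph eta -> ipX v (D w) + tr eta w = 0) ->
  [/\ nA w = 0, nX u = 0 & nP phi = 0].
Proof.
move=> Hw Hu Hphi E G.
have := @discrete_stability w u phi 0 (lexx _) Hw Hu Hphi.
rewrite mulr0 => /(_ _)/wrap[z Hz|]; first by rewrite E// normr0 mul0r.
move=> /(_ _)/wrap[v eta Hv Heta|]; first by rewrite G// normr0 mul0r.
have := seminorm_ge0 graph_form w; have := seminorm_ge0 ipX u.
have := ms_nP0 ms phi => h1 h2 h3 h4; split; apply/eqP; rewrite eq_le; apply/andP; split => //; lra.
Qed.

Lemma discrete_unique f w u phi w' u' phi' :
  mixed_eq f Wh Xh Ph w u phi -> mixed_eq f Wh Xh Ph w' u' phi' ->
  [/\ nA (w' - w) = 0, nX (u' - u) = 0 & nP (phi' - phi) = 0].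
Proof.
move=> [Hw Hu Hp E G] [Hw' Hu' Hp' E' G'].
apply: discrete_homogeneous; try exact: subspaceB.
- move=> z Hz; have Htz := WhHt Hz.
  rewrite (linear_onB (ms_alin ms Htz)); try exact: WhHt.
  rewrite (linear_onB (si_lin (ms_X ms) (ms_D ms Htz))); try exact: XhX.
  rewrite (linear_onB (ms_trlinl ms Htz)); try exact: PhS0.
  have := E z Hz; have := E' z Hz; lra.
- move=> v eta Hv Heta.
  rewrite (linear_onB (ms_Dlin ms (XhX Hv))); try exact: WhHt.
  rewrite (linear_onB (ms_trlin ms (PhS0 Heta))); try exact: WhHt.
  have := G v eta Hv Heta; have := G' v eta Hv Heta; lra.
Qed.

Lemma quasi_optimality f w u phi wh uh phih : 0 < K ->
  mixed_eq f Ht L S0 w u phi -> mixed_eq f Wh Xh Ph wh uh phih ->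
  forall z v eta, Wh z -> Xh v -> Ph eta ->
  nA (w - wh) + nX (u - uh) + nP (phi - phih) <=
  (1 + K * (beta + 1)) * (nA (w - z) + nX (u - v) + nP (phi - eta)).
Proof.
move=> K_gt0 [Hw Hu Hp E G] [Hwh Huh Hph Eh Gh] z v eta Hz Hv Heta.
have Htz := WhHt Hz; have Lv := XhX Hv; have Seta := PhS0 Heta.
have Htwh := WhHt Hwh; have Luh := XhX Huh; have Sph := PhS0 Hph.
set e := nA (w - z) + _ + _.
have n1 := seminorm_ge0 graph_form (w - z); have n2 := seminorm_ge0 ipX (u - v).
have n3 := ms_nP0 ms (phi - eta).
have b0 := ms_beta ms.
have e0 : 0 <= e by rewrite !addr_ge0.
have Hwz : Ht (w - z) := subspaceB HtL Hw Htz.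
have : nA (z - wh) + nX (v - uh) + nP (eta - phih) <= K * ((beta + 1) * e).
  apply: discrete_stability; try exact: subspaceB.
  - by rewrite mulr_ge0// addr_ge0// ltW.
  - move=> y Hy; have Hty := WhHt Hy.
    have aB := linear_onB (ms_alin ms Hty).
    have xB := linear_onB (si_lin (ms_X ms) (ms_D ms Hty)).
    have pB := linear_onB (ms_trlinl ms Hty).
    rewrite [X in `|X|](_ : _ = - (a (w - z) y - ipX (u - v) (D y) - tr (phi - eta) y)).
      rewrite normrN; apply: (le_trans (ler_normB _ _)).
      apply: (@le_trans _ _ (beta * (nA (w - z) * nA y) + nX (u - v) * nA y +
        nP (phi - eta) * nA y)).
        apply: lerD; last by apply: (ms_trbound ms) => //; exact: subspaceB.
        apply: (le_trans (ler_normB _ _)); apply: lerD.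
          apply: (le_trans (a_bound _ _)) => //.
          rewrite ler_wpM2l ?(ltW b0)// ler_wpM2r ?seminorm_ge0//.
          exact: nW_le.
        by apply: ipXD_bound => //; exact: subspaceB.
      rewrite mulrA -!mulrDl ler_wpM2r ?seminorm_ge0//.
      have := mulr_ge0 (ltW b0) n2; have := mulr_ge0 (ltW b0) n3.
      by rewrite /e !mulrDl !mulrDr !mul1r; lra.
    rewrite !aB ?xB ?pB//; have := E y Hty; have := Eh y Hy; lra.
  - move=> y q Hy Hq; have Ly := XhX Hy; have Sq := PhS0 Hq.
    have xB := linear_onB (ms_Dlin ms Ly); have pB := linear_onB (ms_trlin ms Sq).
    rewrite [X in `|X|](_ : _ = - (ipX y (D (w - z)) + tr q (w - z))).
      rewrite normrN; apply: (le_trans (ler_normD _ _)).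
      apply: (@le_trans _ _ (nA (w - z) * (nX y + nP q))).
        rewrite mulrDr [X in _ <= X + _]mulrC [X in _ <= _ + X]mulrC.
        by apply: lerD; [exact: ipXD_bound|exact: (ms_trbound ms)].
      rewrite ler_wpM2r ?addr_ge0 ?seminorm_ge0 ?(ms_nP0 ms)//.
      have := mulr_ge0 (ltW b0) e0; rewrite mulrDl mul1r /e; lra.
    rewrite !xB ?pB//; have := G y q Ly Sq; have := Gh y q Hy Hq; lra.
move=> st.
have t1 := seminorm_dist gr Hw Htz Htwh.
have t2 := seminorm_dist (ms_X ms) Hu Lv Luh.
have t3 := nP_triangle (subspaceB S0L Hp Seta) (subspaceB S0L Seta Sph).
rewrite subrKA in t3.
move: st; rewrite /e; lra.
Qed.

Lemma discrete_exists f (n1 n2 n3 : nat) (e1 : 'I_n1 -> W) (e2 : 'I_n2 -> X)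
    (e3 : 'I_n3 -> P) : L f ->
  (forall i, Wh (e1 i)) -> (forall i, Xh (e2 i)) -> (forall i, Ph (e3 i)) ->
  (forall w, Wh w -> exists k, nA (w - \sum_i k i *: e1 i) = 0) ->
  (forall u, Xh u -> exists k, nX (u - \sum_i k i *: e2 i) = 0) ->
  (forall p, Ph p -> exists k, p = \sum_i k i *: e3 i) ->
  exists w u phi, mixed_eq f Wh Xh Ph w u phi.
Proof.
move=> Lf We1 Xe2 Pe3 span1 span2 span3.
pose e (i : 'I_n1 + 'I_n2 + 'I_n3) : (W * X * P)%type :=
  match i with
  | inl (inl i) => (e1 i, 0, 0) | inl (inr i) => (0, e2 i, 0) | inr i => (0, 0, e3 i)
  end.
pose Z : set (W * X * P)%type := [set t | [/\ Wh t.1.1, Xh t.1.2 & Ph t.2]].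
have Wh0 := subspace0 WhL; have Xh0 := subspace0 XhL; have Ph0 := subspace0 PhL.
have ZL : linear_subspace Z.
  split => // k x y [? ? ?] [? ? ?]; split => /=.
  - by case: WhL => _; exact.
  - by case: XhL => _; exact.
  - by case: PhL => _; exact.
have Ze i : Z (e i) by case: i => [[i|i]|i]; split; rewrite /=.
pose bil (s t : (W * X * P)%type) := a s.1.1 t.1.1 - ipX s.1.2 (D t.1.1)
  - tr s.2 t.1.1 - ipX t.1.2 (D s.1.1) - tr t.2 s.1.1.
pose rhs (t : (W * X * P)%type) := - ipX f t.1.2.
have bil_sym s t : Z s -> Z t -> bil s t = bil t s.
  move=> [Hs _ _] [Ht' _ _]; rewrite /bil (ms_asym ms (WhHt Hs) (WhHt Ht')); ring.
have bil_lin t : Z t -> linear_on Z (bil t).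
  move=> [t1 t2 t3] k x y [x1 x2 x3] [y1 y2 y3]; rewrite /bil /=.
  move/WhHt: t1 => t1; move/XhX: t2 => t2; move/PhS0: t3 => t3.
  rewrite (ms_alinr t1); try exact: WhHt.
  rewrite (ms_Dlin ms t2); try exact: WhHt.
  rewrite (ms_trlin ms t3); try exact: WhHt.
  rewrite (si_lin (ms_X ms) (ms_D ms t1)); try exact: XhX.
  rewrite (ms_trlinl ms t1); try exact: PhS0.
  ring.
have rhs_lin : linear_on Z rhs.
  move=> k x y [x1 x2 x3] [y1 y2 y3]; rewrite /rhs /=.
  rewrite (si_linr (ms_X ms) Lf); try exact: XhX.
  ring.
have tripleE (r : R) (w w' : W) (x x' : X) (p p' : P) : r *: (w, x, p) + (w', x', p')
    = (r *: w + w', r *: x + x', r *: p + p') by [].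
(* The families span only up to null vectors, hence the last two hypotheses. *)
have ext (l : (W * X * P)%type -> R) : linear_on Z l -> (forall i, l (e i) = 0) ->
    (forall w, Wh w -> nA w = 0 -> l (w, 0, 0) = 0) ->
    (forall u, Xh u -> nX u = 0 -> l (0, u, 0) = 0) ->
    [/\ forall w, Wh w -> l (w, 0, 0) = 0, forall u, Xh u -> l (0, u, 0) = 0 &
        forall p, Ph p -> l (0, 0, p) = 0].
  move=> lL le l1 l2; split => x Hx.
  - have [k k0] := span1 _ Hx.
    have lW : linear_on Wh (fun w => l (w, 0, 0)).
      move=> r u v Hu Hv; rewrite -lL//; congr l.
      by rewrite tripleE !scaler0 !addr0.
    have Hs : Wh (\sum_i k i *: e1 i) by exact: subspace_sum.
    have := l1 _ (subspaceB WhL Hx Hs) k0; rewrite (linear_onB lW)//.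
    rewrite (linear_on_sum WhL lW)// big1 ?subr0// => i _.
    by rewrite (le (inl (inl i))) mulr0.
  - have [k k0] := span2 _ Hx.
    have lW : linear_on Xh (fun w => l (0, w, 0)).
      move=> r u v Hu Hv; rewrite -lL//; congr l.
      by rewrite tripleE !scaler0 !addr0.
    have Hs : Xh (\sum_i k i *: e2 i) by exact: subspace_sum.
    have := l2 _ (subspaceB XhL Hx Hs) k0; rewrite (linear_onB lW)//.
    rewrite (linear_on_sum XhL lW)// big1 ?subr0// => i _.
    by rewrite (le (inl (inr i))) mulr0.
  - have [k ->] := span3 _ Hx.
    have lW : linear_on Ph (fun w => l (0, 0, w)).
      move=> r u v Hu Hv; rewrite -lL//; congr l.
      by rewrite tripleE !scaler0 !addr0.
    rewrite (linear_on_sum PhL lW)// big1// => i _.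
    by rewrite (le (inr i)) mulr0.
have bil1 t w : Z t -> Wh w -> bil t (w, 0, 0) =
    a t.1.1 w - ipX t.1.2 (D w) - tr t.2 w.
  move=> [t1 t2 t3] Hw; rewrite /bil /=.
  rewrite (linear_on0 LL (si_lin (ms_X ms) (ms_D ms (WhHt t1)))).
  by rewrite (linear_on0 S0L (ms_trlinl ms (WhHt t1))) !subr0.
have bil2 t u : Z t -> Xh u -> bil t (0, u, 0) = - ipX u (D t.1.1).
  move=> [t1 t2 t3] Hu; rewrite /bil /=.
  rewrite (linear_on0 HtL (ms_alinr (WhHt t1))).
  rewrite (linear_on0 HtL (ms_Dlin ms (XhX t2))).
  rewrite (linear_on0 HtL (ms_trlin ms (PhS0 t3))).
  by rewrite (linear_on0 S0L (ms_trlinl ms (WhHt t1))) !subr0 sub0r.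
have bil3 t p : Z t -> Ph p -> bil t (0, 0, p) = - tr p t.1.1.
  move=> [t1 t2 t3] Hp; rewrite /bil /=.
  rewrite (linear_on0 HtL (ms_alinr (WhHt t1))).
  rewrite (linear_on0 HtL (ms_Dlin ms (XhX t2))).
  rewrite (linear_on0 HtL (ms_trlin ms (PhS0 t3))).
  by rewrite (linear_on0 LL (si_lin (ms_X ms) (ms_D ms (WhHt t1)))) !subr0 sub0r.
have null1 t w : Z t -> Wh w -> nA w = 0 -> bil t (w, 0, 0) = 0.
  move=> Zt Hw w0; rewrite bil1//; case: Zt => t1 t2 t3.
  have := a_bound (WhHt t1) (WhHt Hw); have := ipXD_bound (XhX t2) (WhHt Hw).
  have := ms_trbound ms (PhS0 t3) (WhHt Hw).
  by rewrite w0 !mulr0 !normr_le0 => /eqP-> /eqP-> /eqP->; rewrite !subr0.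
have null2 t u : Z t -> Xh u -> nX u = 0 -> bil t (0, u, 0) = 0.
  move=> Zt Hu u0; rewrite bil2//; case: Zt => t1 t2 t3.
  by rewrite (seminorm0_ip (ms_X ms) (XhX Hu) (ms_D ms (WhHt t1)) u0) oppr0.
have [|k Hk] := @linear_system_solvable R _ (fun i j => bil (e i) (e j)) (rhs \o e).
  move=> k Hk; set t := \sum_j k j *: e j.
  have Zt : Z t by exact: subspace_sum.
  have [E1 E2 E3] := @ext (bil t) (bil_lin _ Zt)
    (fun i => etrans (bil_sym _ _ Zt (Ze i))
      (etrans (linear_on_sum ZL (bil_lin _ (Ze i)) k Ze) (Hk i)))
    (null1 t ^~ Zt) (null2 t ^~ Zt).
  rewrite -(linear_on_sum ZL rhs_lin)// -/t /rhs.
  have [t1 t2 t3] := Zt.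
  have [_ u0 _] : [/\ nA t.1.1 = 0, nX t.1.2 = 0 & nP t.2 = 0].
    apply: discrete_homogeneous => // [z Hz|v eta Hv Heta].
      by rewrite -bil1// E1.
    by have := E2 _ Hv; have := E3 _ Heta; rewrite bil2// bil3//; lra.
  rewrite (si_sym (ms_X ms))//; last exact: XhX.
  by rewrite (seminorm0_ip (ms_X ms) (XhX t2) Lf u0) oppr0.
set t := \sum_j k j *: e j.
have Zt : Z t by exact: subspace_sum.
have lL : linear_on Z (fun z => bil t z - rhs z).
  by move=> r x y Hx Hy; rewrite (bil_lin _ Zt)// rhs_lin//; ring.
have [|||E1 E2 E3] := ext _ lL.
- move=> i; have := Hk i; rewrite /= => <-; rewrite bil_sym//.
  rewrite (linear_on_sum ZL (bil_lin _ (Ze i)))//.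
  by rewrite -sumrB big1// => j _; rewrite (bil_sym (e i))// subrr.
- move=> w Hw w0; rewrite null1// /rhs /=.
  by rewrite (linear_on0 LL (si_linr (ms_X ms) Lf)) oppr0 subr0.
- move=> u Hu u0; rewrite null2// /rhs /= (si_sym (ms_X ms))//; last exact: XhX.
  by rewrite (seminorm0_ip (ms_X ms) (XhX Hu) Lf u0) oppr0 subr0.
exists t.1.1, t.1.2, t.2; have [t1 t2 t3] := Zt.
have f0 := linear_on0 LL (si_linr (ms_X ms) Lf).
split => // [z Hz|v eta Hv Heta].
  by have := E1 _ Hz; rewrite bil1// /rhs /= f0 oppr0 subr0.
have := E2 _ Hv; have := E3 _ Heta; rewrite bil2// bil3// /rhs /= f0; lra.
Qed.

End discrete.
End mixed_galerkin.

(** * Square-integrable functions *)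

Section L2.
Context dd (T : measurableType dd) (R : realType).
Variable mu : {measure set T -> \bar R}.

Definition l2 : set (T -> R) := [set f | f \in Lfun mu 2%:E].

Definition l2ip (f g : T -> R) : R := \int[mu]_x (f x * g x).

Lemma l2P f : l2 f <->
  measurable_fun setT f /\ mu.-integrable setT (EFin \o (fun x => f x ^+ 2)).
Proof.
split=> [lf|[mf /integrableP[_ if2]]].
  split; last exact: Lfun2_integrable_sqr.
  by move: lf => /sub_Lfun_mfun; rewrite inE.
rewrite /l2 /= inE; apply/andP; split; rewrite inE //=.
rewrite /finite_norm unlock; apply: poweR_lty.
apply: le_lt_trans if2; rewrite le_eqVlt; apply/orP; left; apply/eqP.
apply: eq_integral => x _ /=.
by rewrite powR_mulrn// normrX.
Qed.

Lemma l2_measurable f : l2 f -> measurable_fun setT f.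
Proof. by case/l2P. Qed.

Lemma l2_subspace : linear_subspace l2.
Proof.
have [l0 lD] := @Lfun_submod_closed _ T R mu 2%:E (@lee1n R 2).
by split => // c u v; exact: lD.
Qed.

Lemma l2_mul_integrable f g : l2 f -> l2 g ->
  mu.-integrable setT (EFin \o (fun x => f x * g x)).
Proof. by move=> lf lg; apply/Lfun1_integrable; exact: Lfun2_mul_Lfun1. Qed.

Lemma l2_semi_inner : semi_inner l2 l2ip.
Proof.
split.
- exact: l2_subspace.
- by move=> u v _ _; apply: eq_Rintegral => x _; rewrite mulrC.
- move=> w lw c u v lu lv; rewrite /l2ip.
  have iuw := l2_mul_integrable lu lw; have ivw := l2_mul_integrable lv lw.
  rewrite -RintegralZl// -RintegralD//; last first.
    by have := integrableZl measurableT c iuw; apply: eq_integrable.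
  by apply: eq_Rintegral => x _; rewrite -[(c *: u + v) x]/(c * u x + v x) mulrDl mulrA.
- by move=> u _; apply: Rintegral_ge0 => x _; rewrite -expr2 sqr_ge0.
Qed.

Lemma l2ip_EFin f : l2 f -> (l2ip f f)%:E = (\int[mu]_x (f x ^+ 2)%:E)%E.
Proof.
move=> lf; rewrite /l2ip /Rintegral.
rewrite (eq_integral (EFin \o (fun x => f x ^+ 2))) => [|x _]; last first.
  by rewrite /= expr2.
by rewrite fineK//; apply: integrable_fin_num => //; case/l2P: lf.
Qed.

Lemma l2_norm f : l2 f -> l2 (fun x => `|f x|).
Proof.
move=> /l2P[mf if2]; apply/l2P; split; first exact: measurableT_comp.
by apply: eq_integrable if2 => // x _ /=; rewrite -normrX ger0_norm// sqr_ge0.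
Qed.

Lemma l2_seminorm_norm f : seminorm l2ip (fun x => `|f x|) = seminorm l2ip f.
Proof.
by congr Num.sqrt; apply: eq_Rintegral => x _; rewrite -expr2 -normrX ger0_norm ?expr2 ?sqr_ge0.
Qed.

Lemma l2_null f : l2 f -> seminorm l2ip f = 0 -> f = cst 0 %[ae mu].
Proof.
move=> lf f0; have : (\int[mu]_x `|(f x ^+ 2)%:E|)%E = 0%E.
  have ip0 : l2ip f f = 0 by rewrite -(seminorm_sqr l2_semi_inner lf) f0 expr0n.
  rewrite -[RHS]/(0%:E) -ip0 l2ip_EFin//.
  by apply: eq_integral => x _; rewrite gee0_abs// lee_fin sqr_ge0.
have [mf _] := iffLR (l2P _) lf.
have mf2 : measurable_fun setT (fun x => (f x ^+ 2)%:E).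
  by apply/measurable_EFinP; exact: measurable_funX.
move/(ae_eq_integral_abs mu measurableT mf2).
apply: filterS => x /= /(_ I)[/eqP]; rewrite sqrf_eq0 => /eqP fx0 _.
exact: fx0.
Qed.

Lemma l2_complete : si_complete l2 l2ip.
Proof.
move=> u lu cu; have si := l2_semi_inner; have L := l2_subspace.
pose g n x := `|u 0%N x| + \sum_(k < n) `|u k.+1 x - u k x|.
have lgd k : l2 (fun x => `|u k.+1 x - u k x|).
  by apply: (@l2_norm (u k.+1 - u k)); exact: subspaceB.
have gS n : g n.+1 = g n + (fun x => `|u n.+1 x - u n x|).
  by apply/funext => x; rewrite /g big_ord_recr /= addrA.
have lg n : l2 (g n).
  elim: n => [|n IH]; last by rewrite gS; exact: subspaceD.
  rewrite (_ : g 0%N = fun x => `|u 0%N x|); first exact: l2_norm.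
  by apply/funext => x; rewrite /g big_ord0 addr0.
pose M := seminorm l2ip (u 0%N) + 2.
have ng n : seminorm l2ip (g n) <= M - 2 * 2^-1 ^+ n.
  elim: n => [|n IH].
    rewrite expr0 mulr1 /M addrK -[leRHS]l2_seminorm_norm.
    rewrite le_eqVlt; apply/orP; left; apply/eqP; congr seminorm.
    by apply/funext => x; rewrite /g big_ord0 addr0.
  rewrite gS; apply: (le_trans (seminormD si (lg n) (lgd n))).
  rewrite (@l2_seminorm_norm (u n.+1 - u n)).
  have := cu n; rewrite exprS; move: IH; set q := 2^-1 ^+ n; lra.
have ngM n : seminorm l2ip (g n) <= M.
  apply: (le_trans (ng n)); rewrite gerBl.
  by rewrite mulr_ge0// exprn_ge0// invr_ge0.
have g_ge0 n x : 0 <= g n x by rewrite addr_ge0// sumr_ge0.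
have ndg x : nondecreasing_seq (g ^~ x).
  by apply/nondecreasing_seqP => n; rewrite gS lerDl.
pose G n x := ((g n x) ^+ 2)%:E.
have mG n : measurable_fun setT (G n).
  by apply/measurable_EFinP/measurable_funX; exact: l2_measurable.
have ndG x : nondecreasing_seq (G ^~ x).
  by move=> m n mn; rewrite lee_fin ler_pXn2r ?nnegrE//; exact: ndg.
have G0 n x : (0 <= G n x)%E by rewrite lee_fin sqr_ge0.
pose Gl x := limn (G ^~ x).
have GGl n x : (G n x <= Gl x)%E.
  rewrite /Gl (cvg_lim _ (ereal_nondecreasing_cvgn (ndG x)))//.
  by apply: ereal_sup_ubound; exists n.
have iGl : mu.-integrable setT Gl.
  apply/integrableP; split.
    by apply: emeasurable_fun_cvg mG _ => x _; exact: ereal_nondecreasing_is_cvgn.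
  rewrite (eq_integral Gl); last first.
    by move=> x _; rewrite gee0_abs// (le_trans (G0 0%N x)).
  rewrite monotone_convergence//.
  apply: (@le_lt_trans _ _ (M ^+ 2)%:E); last exact: ltry.
  apply: lime_le.
    apply: ereal_nondecreasing_is_cvgn => m n mn.
    by apply: ge0_le_integral => // x _; exact: ndG.
  apply: nearW => n; rewrite -l2ip_EFin// lee_fin -(seminorm_sqr si)//.
  rewrite ler_pXn2r ?nnegrE ?seminorm_ge0//.
  by rewrite (le_trans _ (ngM n))// seminorm_ge0.
have [N [mN N0 subN]] := integrable_ae measurableT iGl.
have fin x : ~ N x -> Gl x \is a fin_num.
  move=> Nx; apply: contrapT => h; apply: Nx; apply: subN => /= /(_ I).
  exact: h.
have boundg x : ~ N x -> forall n, g n x ^+ 2 <= fine (Gl x).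
  by move=> Nx n; rewrite -lee_fin fineK ?fin//; exact: GGl.
have ug n x : `|u n x| <= g n x.
  elim: n => [|n IH]; first by rewrite /g big_ord0 addr0.
  rewrite gS; have -> : u n.+1 x = u n x + (u n.+1 x - u n x) by ring.
  by apply: (le_trans (ler_normD _ _)); rewrite lerD.
have cvu x : ~ N x -> cvgn (u ^~ x).
  move=> Nx; have cS : cvgn (series (telescope (u ^~ x))).
    have nsE m : [normed series (telescope (u ^~ x))] m =
        \sum_(k < m) `|u k.+1 x - u k x|.
      by rewrite /= /series /= big_mkord.
    apply: normed_cvg; apply: nondecreasing_is_cvgn.
      by apply/nondecreasing_seqP => n; rewrite !nsE big_ord_recr /= lerDl.
    exists (fine (Gl x) + 1) => _ [n _ <-].
    have := boundg x Nx n; have : [normed series (telescope (u ^~ x))] n <= g n x.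
      by rewrite nsE /g lerDr.
    have := sqr_ge0 (g n x - 1); rewrite sqrrB; have := g_ge0 n x; nra.
  rewrite (_ : u ^~ x = fun n => u 0%N x + series (telescope (u ^~ x)) n).
    by apply: is_cvgD => //; exact: is_cvg_cst.
  by apply/funext => n; exact: eq_sum_telescope.
pose v n := u n \_ (~` N).
pose l x := limn (v ^~ x).
have vE n x : ~ N x -> v n x = u n x by move=> Nx; rewrite /v patchE mem_set.
have v0 n x : N x -> v n x = 0 by move=> Nx; rewrite /v patchE memNset//; exact.
have cvv x : v ^~ x @ \oo --> l x.
  have [Nx|Nx] := pselect (N x).
    by apply/cvg_ex; exists 0; rewrite (_ : v^~ x = cst 0);
      [exact: cvg_cst|apply/funext => n; exact: v0].
  rewrite /l (_ : v^~ x = u ^~ x); first exact: cvu.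
  by apply/funext => n; exact: vE.
have mv n : measurable_fun setT (v n).
  apply/(measurable_restrict _ _ _).1 => //; first exact: measurableC.
  by apply: measurable_funTS; exact: l2_measurable.
have ml : measurable_fun setT l.
  by apply: measurable_fun_cvg mv _ => x _; exact: cvv.
have l0 x : N x -> l x = 0.
  move=> Nx; rewrite /l (_ : v^~ x = cst 0); first exact: lim_cst.
  by apply/funext => n; exact: v0.
have lbound x : ((l x ^+ 2)%:E <= Gl x)%E.
  have [Nx|Nx] := pselect (N x).
    by rewrite l0// expr0n /=; exact: le_trans (GGl 0%N x).
  rewrite -[Gl x]fineK ?fin// lee_fin.
  have c2 : v n x ^+ 2 @[n --> \oo] --> l x ^+ 2 by apply: cvgM; exact: cvv.
  apply: (cvgr_to_le c2); near=> n.
  rewrite vE// -[u n x ^+ 2]ger0_norm ?sqr_ge0// normrX.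
  by apply: le_trans (boundg x Nx n); rewrite ler_pXn2r ?nnegrE.
have ll : l2 l.
  apply/l2P; split => //; apply: le_integrable iGl => //.
    by apply/measurable_EFinP; exact: measurable_funX.
  move=> x _ /=; have Gl0 : (0 <= Gl x)%E by exact: le_trans (GGl 0%N x).
  by rewrite ger0_norm ?sqr_ge0// gee0_abs.
exists l => //.
pose f_ n x := ((u n x - l x) ^+ 2)%:E.
have [|||||_ _] := @dominated_convergence _ _ _ mu _ measurableT f_ (cst 0%E)
    (fun x => 4%:E * Gl x)%E.
- move=> n; apply/measurable_EFinP/measurable_funX/measurable_funB => //.
  exact: l2_measurable.
- exact: measurable_cst.
- exists N; split => // x /= h; apply: contrapT => Nx; apply: h => _.
  apply/cvg_EFin; first exact: nearW.
  rewrite (_ : _ \o _ = fun n => (v n x - l x) ^+ 2); last first.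
    by apply/funext => n; rewrite /= vE.
  rewrite [X in _ --> X](_ : _ = (l x - l x) ^+ 2); last by rewrite subrr expr0n.
  by apply: cvgM; apply: cvgB; [exact: cvv|exact: cvg_cst|exact: cvv|exact: cvg_cst].
- exact: integrableZl.
- exists N; split => // x /= h; apply: contrapT => Nx; apply: h => n _.
  rewrite /f_ /= ger0_norm ?sqr_ge0// -[Gl x]fineK ?fin// -EFinM lee_fin.
  have := boundg x Nx n; have := lbound x.
  rewrite -[Gl x]fineK ?fin// lee_fin.
  have : u n x ^+ 2 <= g n x ^+ 2.
    rewrite -[u n x ^+ 2]ger0_norm ?sqr_ge0// normrX.
    by rewrite ler_pXn2r ?nnegrE.
  have := sqr_ge0 (u n x + l x); rewrite sqrrB sqrrD; lra.
rewrite integral0 => cv.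
have lul n : l2 (u n - l) by exact: subspaceB.
have cv' : l2ip (u n - l) (u n - l) @[n --> \oo] --> (0 : R).
  move: cv; rewrite (_ : (fun n => _) = fun n => (l2ip (u n - l) (u n - l))%:E).
    by move=> /fine_cvgP[_].
  by apply/funext => n; rewrite l2ip_EFin.
rewrite -[X in _ --> X]sqrtr0.
apply: (cvg_comp _ _ cv'); exact: sqrt_continuous.
Unshelve. all: by end_near. Qed.

End L2.

(** * Null sets and meshes *)

Section boxes.
Context {R : realType} {d : nat}.
Local Notation E := 'rV[R]_d.
Implicit Types (a b x : E) (D : set E).

Definition obox a b : set E := [set x | forall i, a ord0 i < x ord0 i < b ord0 i].

Definition cbox a b : set E := [set x | forall i, a ord0 i <= x ord0 i <= b ord0 i].

Lemma obox_cbox a b : obox a b `<=` cbox a b.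
Proof. by move=> x h i; have /andP[h1 h2] := h i; rewrite !ltW. Qed.

Lemma measurable_obox a b : measurable (obox a b).
Proof.
rewrite (_ : obox a b = \bigcap_(i in [set: 'I_d])
   ((fun x : E => x ord0 i) @^-1` `]a ord0 i, b ord0 i[)); last first.
  apply/seteqP; split => [y H i _|y H i] /=; first by rewrite in_itv /=; exact: H.
  by have := H i I; rewrite /= in_itv.
apply: fin_bigcap_measurable => // i _.
by rewrite -[X in measurable X]setTI; apply: measurable_coord.
Qed.

Lemma measurable_cbox a b : measurable (cbox a b).
Proof.
rewrite (_ : cbox a b = \bigcap_(i in [set: 'I_d])
   ((fun x : E => x ord0 i) @^-1` `[a ord0 i, b ord0 i])); last first.
  apply/seteqP; split => [y H i _|y H i] /=; first by rewrite in_itv /=; exact: H.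
  by have := H i I; rewrite /= in_itv.
apply: fin_bigcap_measurable => // i _.
by rewrite -[X in measurable X]setTI; apply: measurable_coord.
Qed.

Lemma cbox_finite a b : (lebesgueN d (cbox a b) < +oo)%E.
Proof.
have [ab|/existsNP[i ab]] := pselect (forall i, a ord0 i <= b ord0 i).
  by rewrite /cbox lebesgueN_box// ltry.
rewrite (_ : cbox a b = set0) ?measure0//.
apply/seteqP; split => // x /(_ i) /andP[h1 h2]; apply: ab.
exact: le_trans h1 h2.
Qed.

Definition rat_row (q : 'rV[rat]_d) : E := \row_j ratr (q ord0 j).

Lemma ball_rowP x (e : R) (y : E) : 0 < e ->
  ball x e y <-> forall i, `|x ord0 i - y ord0 i| < e.
Proof.
move=> e0; split => [[_ H] i|H]; first by exact: H.
by split => // i j; rewrite (ord1 i); exact: H.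
Qed.

Lemma open_ratbox D x : open D -> D x ->
  exists q : 'rV[rat]_d * 'rV[rat]_d,
    obox (rat_row q.1) (rat_row q.2) x /\ cbox (rat_row q.1) (rat_row q.2) `<=` D.
Proof.
move=> oD Dx.
have /nbhs_ballP[e /= e0 eD] : nbhs x D by exact: open_nbhs_nbhs.
have /choice[q1 Hq1] i : exists q : rat, x ord0 i - e < ratr q < x ord0 i.
  have [|q] := @rat_in_itvoo R (x ord0 i - e) (x ord0 i); first by rewrite ltrBlDr ltrDl.
  by rewrite in_itv /=; exists q.
have /choice[q2 Hq2] i : exists q : rat, x ord0 i < ratr q < x ord0 i + e.
  have [|q] := @rat_in_itvoo R (x ord0 i) (x ord0 i + e); first by rewrite ltrDl.
  by rewrite in_itv /=; exists q.
exists (\row_i q1 i, \row_i q2 i); split.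
  by move=> i; rewrite !mxE; have /andP[_ ->] := Hq1 i; have /andP[->] := Hq2 i.
move=> y Hy; apply: eD; apply/ball_rowP => // i.
have := Hy i; rewrite !mxE; have := Hq1 i; have := Hq2 i.
move=> /andP[h1 h2] /andP[h3 h4] /andP[h5 h6].
rewrite ltr_norml; apply/andP; split; lra.
Qed.

Lemma open_bigcup_ratbox D : open D ->
  D = \bigcup_(q in [set q : 'rV[rat]_d * 'rV[rat]_d |
        cbox (rat_row q.1) (rat_row q.2) `<=` D]) obox (rat_row q.1) (rat_row q.2).
Proof.
move=> oD; apply/seteqP; split => [x Dx|x [q /= qD qx]].
  by have [q [h1 h2]] := open_ratbox oD Dx; exists q.
by apply: qD; exact: obox_cbox.
Qed.

Lemma open_measurableN D : open D -> measurable D.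
Proof.
move=> oD; rewrite (open_bigcup_ratbox oD) bigcup_mkcond.
apply: countable_bigcupT_measurable => // q; case: ifP => // _.
exact: measurable_obox.
Qed.
End boxes.

Lemma continuous_measurableN (R : realType) (d : nat) (f : 'rV[R]_d -> R) :
  continuous f -> measurable_fun setT f.
Proof.
move=> cf mD; apply: (measurability _ (RGenOInfty.measurableE R)) => //.
move=> _ [_ [r ->] <-]; rewrite setTI.
apply: open_measurableN; apply: open_comp => //; exact: interval_open.
Qed.

Lemma coord_norm_le (R : realType) (d : nat) (x : 'rV[R]_d) i :
  `|x ord0 i| <= `|x|.
Proof.
have /mapP[j Hj ->] : `|x ord0 i| \in [seq `|x k.1 k.2| | k : 'I_1 * 'I_d].
  by apply/mapP; exists (ord0, i) => //=; rewrite mem_enum.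
by rewrite [leRHS]/Num.norm /= mx_normrE; apply/bigmax_geP; right => /=; exists j.
Qed.

Lemma sum_continuous (R : realType) (T : topologicalType) (I : Type) (s : seq I)
    (F : I -> T -> R) : (forall i, continuous (F i)) ->
  continuous (fun x => \sum_(i <- s) F i x).
Proof.
move=> cF; elim: s => [|i s IH] x.
  rewrite (_ : (fun _ => _) = cst 0); first exact: cvg_cst.
  by apply/funext => y; rewrite big_nil.
rewrite (_ : (fun _ => _) = fun x => F i x + \sum_(j <- s) F j x).
  by apply: cvgD; [exact: cF|exact: IH].
by apply/funext => y; rewrite big_cons.
Qed.

Lemma bounded_cbox (R : realType) (d : nat) (D : set 'rV[R]_d) :
  bounded_set D -> exists a b, D `<=` cbox a b.
Proof.
move=> [M [_ /(_ (M + 1))]]; rewrite ltrDl ltr01 => /(_ isT) H.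
exists (const_mx (- (M + 1))), (const_mx (M + 1)) => x /H /= xM i.
rewrite !mxE -ler_norml; apply: le_trans xM; exact: coord_norm_le.
Qed.

Section null_sets.
Context {R : realType}.

Lemma hyperplane_null d (n : 'rV[R]_d) (c : R) : n != 0 ->
  lebesgueN d [set x | vdot n x = c] = 0%E.
Proof.
elim: d n c => [|d IH] n c n0; first by rewrite (thinmx0 n) eqxx in n0.
pose n' : 'rV[R]_d := \row_j n ord0 (lift ord0 j).
have dotE p : vdot n (vcons p) = n ord0 ord0 * p.1 + vdot n' p.2.
  rewrite /vdot big_ord_recl vconsE0; congr (_ + _).
  by apply: eq_bigr => j _; rewrite vconsES mxE.
rewrite /= /lebesgue_step /=.
have [n'0|n'0] := eqVneq n' 0; last first.
  rewrite /product_measure1 integral0_eq// => x _ /=.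
  rewrite (_ : xsection _ _ = [set y | vdot n' y = c - n ord0 ord0 * x]).
    exact: IH.
  apply/seteqP; split => y; rewrite /xsection /= inE /= dotE /=; lra.
have n00 : n ord0 ord0 != 0.
  apply: contra_neq n0 => n00; apply/rowP => i; rewrite mxE.
  case: (unliftP ord0 i) => [j ->|->//].
  by have /rowP/(_ j) := n'0; rewrite !mxE.
rewrite (_ : _ @^-1` _ = [set c / n ord0 ord0] `*` setT).
  by rewrite product_measure1E// [X in (X * _)%E]lebesgue_measure_set1 mul0e.
have d0 (y : 'rV[R]_d) : vdot n' y = 0.
  by rewrite n'0 /vdot big1// => i _; rewrite mxE mul0r.
apply/seteqP; split => [[x y]|[x y] [/= -> _]] /=; rewrite dotE d0 addr0 /=.
  by move=> <-; split => //; rewrite mulrC mulKf.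
by rewrite mulrC divfK.
Qed.

Lemma negligible_seq dd (T : measurableType dd) (mu : {measure set T -> \bar R})
    (I : eqType) (s : seq I) (F : I -> set T) :
  (forall i, i \in s -> mu.-negligible (F i)) ->
  mu.-negligible [set x | exists2 i, i \in s & F i x].
Proof.
elim: s => [|i s IH] H.
  rewrite (_ : [set x | _] = set0); first exact: negligible_set0.
  by apply/seteqP; split => // x [].
rewrite (_ : [set x | _] = F i `|` [set x | exists2 i, i \in s & F i x]).
  apply: negligibleU; first by apply: H; rewrite mem_head.
  by apply: IH => j js; apply: H; rewrite in_cons js orbT.
apply/seteqP; split => [x [j]|x [Fx|[j js Fx]]].
- by rewrite in_cons => /predU1P[->|js] Fx; [left|right; exists j].
- by exists i => //; rewrite mem_head.
- by exists j => //; rewrite in_cons js orbT.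
Qed.

Variable d : nat.
Local Notation E := 'rV[R]_d.
Local Notation mu := (@lebesgueN R d).

Lemma vdot_continuous (n : E) : continuous (vdot n).
Proof.
apply: sum_continuous => i x.
by apply: continuousM; [exact: cst_continuous|exact: coord_continuous].
Qed.

Lemma halfspaces_near (P : seq (E * R)) (x : E) :
  (forall h, h \in P -> h.1 = 0 /\ 0 <= h.2 \/ vdot h.1 x < h.2) ->
  \forall y \near x, forall h, h \in P -> vdot h.1 y <= h.2.
Proof.
elim: P => [|h P IH] H; first by near=> y => h; rewrite in_nil.
have {}IH : \forall y \near x, forall g, g \in P -> vdot g.1 y <= g.2.
  by apply: IH => g gP; apply: H; rewrite in_cons gP orbT.
have hh : \forall y \near x, vdot h.1 y <= h.2.
  have [[-> h2]|xh] := H _ (mem_head _ _).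
    by near=> y; rewrite /vdot big1// => i _; rewrite mxE mul0r.
  have := @vdot_continuous h.1 x.
  move=> /cvgr_lt /(_ _ xh); apply: filterS => y; exact: ltW.
near=> y => g; rewrite in_cons => /predU1P[->|gP]; first by near: y.
by move: g gP; near: y.
Unshelve. all: by end_near. Qed.

Lemma polyhedral_set_closed (s : seq (seq (E * R))) : closed (polyhedral_set s).
Proof.
elim: s => [|P s IH].
  rewrite (_ : polyhedral_set _ = set0); first exact: closed0.
  by apply/seteqP; split => // x [].
have cP : closed [set x : E | forall h, h \in P -> vdot h.1 x <= h.2].
  rewrite (_ : mkset _ = \bigcap_(h in [set` P]) (vdot h.1 @^-1` [set r | r <= h.2])).
    apply: closed_bigI => h _; apply: preimage_closed; last exact: closed_le.
    by move=> x _; exact: vdot_continuous.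
  by apply/seteqP; split => x H h hP; exact: H.
rewrite (_ : polyhedral_set _ = [set x : E | forall h, h \in P -> vdot h.1 x <= h.2]
   `|` polyhedral_set s); first exact: closedU.
apply/seteqP; split => [x [Q]|x [H|[Q Qs H]]].
- by rewrite in_cons => /predU1P[->|Qs] H; [left|right; exists Q].
- by exists P => //; rewrite mem_head.
- by exists Q => //; rewrite in_cons Qs orbT.
Qed.

Lemma polyhedral_boundary_null (s : seq (seq (E * R))) :
  mu.-negligible (closure (interior (polyhedral_set s)) `\`
                  interior (polyhedral_set s)).
Proof.
apply: (@negligibleS _ _ _ _ [set x | exists2 h, h \in flatten s &
    h.1 != 0 /\ vdot h.1 x = h.2]).
  move=> x [clx nix].
  have Px : polyhedral_set s x.
    rewrite ((closure_id _).1 (@polyhedral_set_closed s)).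
    exact: closureS (@interior_subset _ _) _ clx.
  apply: contrapT => nx; apply: nix; have [P Ps PH] := Px.
  have : \forall y \near x, forall h, h \in P -> vdot h.1 y <= h.2.
    apply: halfspaces_near => h hP; have := PH h hP.
    have [h0|h0] := eqVneq h.1 0.
      rewrite /vdot big1; first by left.
      by move=> i _; rewrite h0 mxE mul0r.
    rewrite le_eqVlt => /orP[/eqP xh|]; last by right.
    exfalso; apply: nx; exists h => //.
    by apply/flattenP; exists P.
  by apply: filterS => y Hy; exists P.
apply: negligible_seq => h _.
have [h0|h0] := eqVneq h.1 0.
  by apply: (@negligibleS _ _ _ _ set0); [move=> x []|exact: negligible_set0].
apply: (@negligibleS _ _ _ _ [set x | vdot h.1 x = h.2]); first by move=> x [].
exists [set x | vdot h.1 x = h.2]; split => //; last exact: hyperplane_null.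
rewrite (_ : mkset _ = vdot h.1 @^-1` [set h.2])//.
rewrite -[X in measurable X]setTI; apply: continuous_measurableN => //.
exact: vdot_continuous.
Qed.

Lemma mesh_null (Omega : set E) N (T : 'I_N -> set E) : mesh_of Omega T ->
  mu.-negligible (Omega `\` \bigcup_i T i).
Proof.
move=> [HT _ cT].
apply: (@negligibleS _ _ _ _ [set x | exists2 i, i \in enum 'I_N &
    (closure (T i) `\` T i) x]).
  move=> x [Ox nx]; have : closure Omega x by exact: subset_closure.
  rewrite cT => -[i _ Tx]; exists i; first by rewrite mem_enum.
  by split => // Tix; apply: nx; exists i.
apply: negligible_seq => i _; have [[_ _ _ [s ->]] _] := HT i.
exact: polyhedral_boundary_null.
Qed.

Lemma mesh_open (Omega : set E) N (T : 'I_N -> set E) : mesh_of Omega T ->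
  forall i, open (T i).
Proof.
move=> [HT _ _] i; have [[_ _ _ [s ->]] _] := HT i; exact: open_interior.
Qed.

End null_sets.

(** * Smooth and test functions *)

Section line_derivative.
Context {R : realType} {V : normedModType R}.

Lemma is_derive_line (f : V -> R) (x v : V) (t : R) :
  derivable f (x + t *: v) v ->
  is_derive t 1 (fun s => f (x + s *: v)) ('D_v f (x + t *: v)).
Proof.
have E : (fun h : R => h^-1 *: (((fun s => f (x + s *: v)) \o shift t) (h *: (1 : R))
    - f (x + t *: v))) =
  (fun h => h^-1 *: ((f \o shift (x + t *: v)) (h *: v) - f (x + t *: v))).
  apply/funext => h /=; congr (_ *: (f _ - _)).
  by rewrite [h *: 1]mulr1 scalerDl addrCA.
move=> df; apply: DeriveDef; first by rewrite /derivable E.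
by rewrite /derive E.
Qed.

Lemma line_continuous (f : V -> R) (x v : V) : continuous f ->
  continuous (fun s : R => f (x + s *: v)).
Proof.
move=> cf s; apply: (@continuous_comp _ _ _ (fun s : R => x + s *: v)); last exact: cf.
apply: continuousD; first exact: cst_continuous.
by apply: continuousZl; exact: cvg_id.
Qed.

End line_derivative.

Lemma dist_splitr (R : realType) (a b c e : R) :
  `|a - c| <= e / 2 -> `|b - c| <= e / 2 -> `|a - b| <= e.
Proof.
move=> ac bc; rewrite -(subrKA c) [leRHS]splitr.
by apply: (le_trans (ler_normD _ _)); apply: lerD => //; rewrite distrC.
Qed.

Section smooth.
Context {R : realType} {d : nat}.
Local Notation E := 'rV[R]_d.
Local Notation dir i := (delta_mx ord0 i : E).
Implicit Types f g : E -> R.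

Lemma smooth_continuous f : smooth f -> continuous f.
Proof. by move=> /(_ [::])[]. Qed.

Lemma smooth_derivable f i x : smooth f -> derivable f x (dir i).
Proof. by move=> /(_ [::])[]. Qed.

Lemma smooth_partial f i : smooth f -> smooth (partial i f).
Proof. by move=> sf s; have := sf (rcons s i); rewrite foldr_rcons. Qed.

Lemma smooth_foldr f s : smooth f -> smooth (foldr partial f s).
Proof.
by move=> sf; elim: s => [|i s IH]; [exact: sf|exact: (smooth_partial i IH)].
Qed.

Lemma smooth_coind (P : set (E -> R)) :
  (forall f, P f -> continuous f) ->
  (forall f i x, P f -> derivable f x (dir i)) ->
  (forall f i, P f -> P (partial i f)) -> P `<=` smooth.
Proof.
move=> Pc Pd Pp f Pf s.
have Ps : P (foldr partial f s) by elim: s => //= i s; exact: Pp.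
by split; [exact: Pc|move=> i x; exact: Pd].
Qed.

Lemma partialD f g i : (forall x, derivable f x (dir i)) ->
  (forall x, derivable g x (dir i)) ->
  partial i (f + g) = partial i f + partial i g.
Proof. by move=> df dg; apply/funext => x; rewrite /partial deriveD. Qed.

Lemma partialZ c f i : (forall x, derivable f x (dir i)) ->
  partial i (c *: f) = c *: partial i f.
Proof. by move=> df; apply/funext => x; rewrite /partial deriveZ. Qed.

Lemma partialM f g i : (forall x, derivable f x (dir i)) ->
  (forall x, derivable g x (dir i)) ->
  partial i (f * g) = f * partial i g + partial i f * g.
Proof.
move=> df dg; apply/funext => x; rewrite /partial deriveM//.
by congr (_ + _); rewrite [LHS]mulrC.
Qed.

Lemma smooth0 : smooth (0 : E -> R).
Proof.
have : [set (0 : E -> R)] `<=` smooth.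
  apply: smooth_coind => f.
  - by move=> ->; exact: (@cst_continuous E R 0).
  - by move=> i x ->; exact: (@derivable_cst R E R 0).
  - by move=> i ->; apply/funext => x; exact: (@derive_cst R E R 0).
exact.
Qed.

Lemma smoothD f g : smooth f -> smooth g -> smooth (f + g).
Proof.
move=> sf sg.
have : [set h | exists f g, [/\ smooth f, smooth g & h = f + g]] `<=` smooth.
  apply: smooth_coind => h.
  - move=> [u [v [su sv ->]]] x.
    by apply: continuousD; exact: smooth_continuous.
  - move=> i x [u [v [su sv ->]]].
    by apply: derivableD; exact: smooth_derivable.
  - move=> i [u [v [su sv ->]]]; exists (partial i u), (partial i v).
    split; try exact: smooth_partial.
    by apply: partialD => x; exact: smooth_derivable.
by apply; exists f, g.
Qed.

Lemma smoothZ c f : smooth f -> smooth (c *: f).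
Proof.
move=> sf.
have : [set h | exists f, smooth f /\ h = c *: f] `<=` smooth.
  apply: smooth_coind => h.
  - move=> [u [su ->]] x.
    by apply: continuousM; [exact: cst_continuous|exact: smooth_continuous].
  - move=> i x [u [su ->]]; apply: derivableZ; exact: smooth_derivable.
  - move=> i [u [su ->]]; exists (partial i u).
    split; first exact: smooth_partial.
    by apply: partialZ => x; exact: smooth_derivable.
by apply; exists f.
Qed.

(* Both mixed derivatives are limits of the same second difference quotient. *)
Lemma second_difference f i j x (h : R) : smooth f -> 0 < h ->
  exists xi eta, [/\ 0 <= xi <= h, 0 <= eta <= h &
    f (x + h *: dir i + h *: dir j) - f (x + h *: dir i) - f (x + h *: dir j) + f x =
    h ^+ 2 * partial j (partial i f) (x + xi *: dir i + eta *: dir j)].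
Proof.
move=> sf h0; have sfi := smooth_partial i sf.
pose u (t : R) := f ((x + h *: dir j) + t *: dir i) - f (x + t *: dir i).
pose du (t : R) := partial i f ((x + h *: dir j) + t *: dir i) - partial i f (x + t *: dir i).
have [| |xi] := @MVT_segment R u du 0 h (ltW h0).
- move=> t _; apply: is_deriveB; apply: is_derive_line; exact: smooth_derivable.
- apply: continuous_subspaceT => t.
  by apply: continuousB; apply: line_continuous; exact: smooth_continuous.
rewrite in_itv /= => xih uE.
pose v (s : R) := partial i f (x + xi *: dir i + s *: dir j).
pose dv (s : R) := partial j (partial i f) (x + xi *: dir i + s *: dir j).
have [| |eta] := @MVT_segment R v dv 0 h (ltW h0).
- move=> t _; apply: is_derive_line; exact: smooth_derivable.
- apply: continuous_subspaceT => t.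
  by apply: line_continuous; exact: smooth_continuous.
rewrite in_itv /= => etah vE; exists xi, eta; split => //.
move: uE vE; rewrite /u /du /v /dv !scale0r !addr0 !subr0.
rewrite [x + h *: dir j + xi *: dir i]addrAC [x + h *: dir j + h *: dir i]addrAC.
by move=> uE vE; rewrite vE in uE; rewrite expr2; lra.
Qed.

Lemma partialC f i j : smooth f -> partial i (partial j f) = partial j (partial i f).
Proof.
move=> sf; apply/funext => x; apply/eqP; rewrite -subr_eq0 -normr_le0.
apply/ler_addgt0Pl => e e0; rewrite addr0.
have ci : continuous (partial i (partial j f)).
  by apply: smooth_continuous; do 2 apply: smooth_partial.
have cj : continuous (partial j (partial i f)).
  by apply: smooth_continuous; do 2 apply: smooth_partial.
have e2 : 0 < e / 2 by rewrite divr_gt0.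
have /nbhs_ballP[r1 /= r10 H1] : \forall y \near x,
    `|partial i (partial j f) x - partial i (partial j f) y| < e / 2.
  by move/cvgrPdist_lt : (ci x) => /(_ _ e2).
have /nbhs_ballP[r2 /= r20 H2] : \forall y \near x,
    `|partial j (partial i f) x - partial j (partial i f) y| < e / 2.
  by move/cvgrPdist_lt : (cj x) => /(_ _ e2).
pose h := Num.min r1 r2 / 3.
have h0 : 0 < h by rewrite divr_gt0// lt_min r10.
have near_x r (xi eta : R) k l : h * 3 <= r -> 0 <= xi <= h -> 0 <= eta <= h ->
    ball x r (x + xi *: dir k + eta *: dir l).
  move=> hr /andP[xi0 xih] /andP[eta0 etah].
  apply/ball_rowP; first by apply: lt_le_trans hr; rewrite mulr_gt0.
  move=> m; rewrite !mxE eqxx /=.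
  have b0 (b : bool) (y : R) : 0 <= y <= h -> 0 <= y * b%:R <= h.
    by case: b => /andP[? ?]; rewrite ?mulr1 ?mulr0; apply/andP; split => //; lra.
  have := b0 (m == k) xi; rewrite xi0 xih => /(_ isT)/andP[? ?].
  have := b0 (m == l) eta; rewrite eta0 etah => /(_ isT)/andP[? ?].
  by rewrite ltr_norml; apply/andP; split; lra.
have [xi [eta [Hxi Heta E1]]] := second_difference i j x sf h0.
have [xi' [eta' [Hxi' Heta' E2]]] := second_difference j i x sf h0.
have EE : partial j (partial i f) (x + xi *: dir i + eta *: dir j) =
    partial i (partial j f) (x + xi' *: dir j + eta' *: dir i).
  have h20 : h ^+ 2 != 0 by rewrite expf_neq0// gt_eqF.
  rewrite [x + h *: dir j + h *: dir i]addrAC in E2; apply: (mulfI h20).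
  move: E1 E2; move: (partial j _ _) (partial i (partial j f) _) => A1 A2.
  by move=> <- <-; ring.
have {}H1 := H1 _ (near_x r1 xi' eta' j i _ Hxi' Heta').
have {}H2 := H2 _ (near_x r2 xi eta i j _ Hxi Heta).
have h3 : h * 3 = Num.min r1 r2 by rewrite /h divfK.
have := H1; rewrite h3 ge_min lexx => /(_ isT) /ltW; rewrite -EE => A1.
have := H2; rewrite h3 ge_min lexx orbT => /(_ isT) /ltW => A2.
exact: dist_splitr A1 A2.
Qed.

Lemma partial_foldr f i s : smooth f ->
  partial i (foldr partial f s) = foldr partial (partial i f) s.
Proof.
move=> sf; elim: s => //= j s <-; apply: partialC; exact: smooth_foldr.
Qed.

Lemma foldr_partial_rev f s : smooth f ->
  foldr partial f (rev s) = foldr partial f s.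
Proof.
elim: s f => //= i s IH f sf.
rewrite rev_cons foldr_rcons IH; last exact: smooth_partial.
by rewrite partial_foldr.
Qed.

Lemma multi_partialE (alpha : 'I_d -> nat) f :
  multi_partial alpha f =
  foldr partial f (flatten [seq nseq (alpha i) i | i <- enum 'I_d]).
Proof.
rewrite /multi_partial; elim: (enum 'I_d) => //= i s IH.
rewrite foldr_cat -IH; elim: (alpha i) => //= n ->.
by [].
Qed.

End smooth.

Section test_functions.
Context {R : realType} {d : nat}.
Local Notation E := 'rV[R]_d.
Local Notation mu := (lebesgueN d).
Implicit Types (D : set E) (f g : E -> R).

Lemma test_smooth D f : test_function D f -> smooth f.
Proof. by case. Qed.

Lemma support0 f x : ~ closure [set x | f x != 0] x -> \forall y \near x, f y = 0.
Proof.
move=> nx; have : \forall y \near x, (~` closure [set x | f x != 0]) y.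
  apply: open_nbhs_nbhs; split => //; apply: closed_openC; exact: closed_closure.
apply: filterS => y ny; apply: contrapT => /eqP fy; apply: ny.
exact: subset_closure.
Qed.

Lemma test_function_sub D f g : test_function D f -> smooth g ->
  (forall x, (\forall y \near x, f y = 0) -> g x = 0) -> test_function D g.
Proof.
move=> [_ cf fD] sg fg.
have gf : closure [set x | g x != 0] `<=` closure [set x | f x != 0].
  rewrite [X in _ `<=` X]((closure_id _).1 (@closed_closure _ _)).
  apply: closureS => x /eqP gx; apply: contrapT => nx; apply: gx.
  by apply: fg; exact: support0.
split => //; last exact: subset_trans gf fD.
by apply: subclosed_compact cf gf; exact: closed_closure.
Qed.

Lemma test_function_partial D f i : test_function D f ->
  test_function D (partial i f).
Proof.
move=> tf; have sf := test_smooth tf.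
apply: (test_function_sub tf); first exact: smooth_partial.
move=> x fx; rewrite /partial (near_eq_derive (g := cst 0))//.
by rewrite derive_cst.
Qed.

Lemma test_function_foldr D f s : test_function D f ->
  test_function D (foldr partial f s).
Proof. by move=> tf; elim: s => //= i s; exact: test_function_partial. Qed.

Lemma test_function0 D : test_function D (0 : E -> R).
Proof.
have E0 : [set x | (0 : E -> R) x != 0] = set0.
  by apply/seteqP; split => // x /=; rewrite eqxx.
split; rewrite ?E0 ?closure0//; first exact: smooth0.
exact: compact0.
Qed.

Lemma test_functionD D f g : test_function D f -> test_function D g ->
  test_function D (f + g).
Proof.
move=> [sf cf fD] [sg cg gD].
have fg : closure [set x | (f + g) x != 0] `<=`
    closure [set x | f x != 0] `|` closure [set x | g x != 0].
  rewrite -closureU; apply: closureS => x /= fgx.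
  apply: contrapT => /not_orP[/negP fx /negP gx].
  have := fgx : f x + g x != 0; move: fx gx; rewrite !negbK => /eqP-> /eqP->.
  by rewrite addr0 eqxx.
split; first exact: smoothD.
- apply: subclosed_compact fg; first exact: closed_closure.
  exact: compactU.
- by move=> x /fg [/fD|/gD].
Qed.

Lemma test_functionZ D c f : test_function D f -> test_function D (c *: f).
Proof.
move=> tf; apply: (test_function_sub tf); first exact: smoothZ (test_smooth tf).
by move=> x /nbhs_singleton fx; have -> : (c *: f) x = c * f x by []; rewrite fx mulr0.
Qed.

Lemma test_function_sum D (I : finType) (F : I -> E -> R) :
  (forall i, test_function D (F i)) -> test_function D (\sum_i F i).
Proof.
move=> tF; elim/big_ind : _ => //; first exact: test_function0.
exact: test_functionD.
Qed.

Lemma test_support_box D f : test_function D f ->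
  exists a b, forall x, ~ cbox a b x -> f x = 0.
Proof.
move=> [_ cf _]; have [a [b ab]] := bounded_cbox (compact_bounded cf).
exists a, b => x nx; apply: contrapT => /eqP fx; apply: nx; apply: ab.
exact: subset_closure.
Qed.

Lemma test_function_restrict D f : test_function D f -> f \_ D = f.
Proof.
move=> [_ _ fD]; apply/funext => x; rewrite patchE; case: ifPn => // xD.
apply/esym; apply: contrapT => /eqP fx; move/negP : xD; apply.
by rewrite inE; apply: fD; exact: subset_closure.
Qed.

Lemma box_integrable f a b : continuous f -> (forall x, ~ cbox a b x -> f x = 0) ->
  mu.-integrable setT (EFin \o f).
Proof.
move=> cf f0; have mc := @measurable_cbox R d a b.
have mf := continuous_measurableN cf.
have fE : (EFin \o f) = (EFin \o f) \_ (cbox a b).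
  apply/funext => x; rewrite patchE; case: ifPn => //= xD.
  by rewrite f0//; move/negP : xD; rewrite inE.
rewrite fE; apply/(integrable_mkcond _ mc).
apply: measurable_bounded_integrable => //.
- exact: cbox_finite.
- exact: measurable_funTS.
have cc : compact (cbox a b).
  rewrite (_ : cbox a b = [set v : E | forall i, v ord0 i \in `[a ord0 i, b ord0 i]]).
    apply: (@rV_compact _ _ (fun i => `[a ord0 i, b ord0 i]%classic)) => i.
    exact: segment_compact.
  by apply/seteqP; split => x Hx i; have := Hx i; rewrite in_itv.
have := compact_bounded (continuous_compact (continuous_subspaceT cf) cc).
rewrite /bounded_set /bounded_near; apply: filterS => M HM x cx.
by apply: HM; exists x.
Qed.

Lemma test_l2 D f : test_function D f -> l2 mu f.
Proof.
move=> tf; have sf := test_smooth tf; have cf := smooth_continuous sf.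
have [a [b f0]] := test_support_box tf.
apply/l2P; split; first exact: continuous_measurableN.
apply: (@box_integrable _ a b).
  by move=> x; apply: continuousM; exact: cf.
by move=> x /f0 ->; rewrite expr0n.
Qed.

End test_functions.

Section integration_by_parts.
Context {R : realType}.

Lemma integral_derive_compact (F : R -> R) (M : R) :
  (forall t, derivable F t 1) -> continuous ('D_1 F) ->
  (forall t, M < `|t| -> F t = 0) ->
  (\int[@lebesgue_measure R]_t ('D_1 F t)%:E = 0)%E.
Proof.
move=> dF cF F0; pose m := Num.max M 0 + 1.
have Mm : M < m by rewrite ltr_pwDr// le_max lexx.
have m0 : 0 < m by rewrite ltr_pwDr// le_max lexx orbT.
have cont : continuous F.
  by move=> t; apply: differentiable_continuous; apply/derivable1_diffP.
have mm : - m < m by lra.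
have dLR : derivable_oo_LRcontinuous F (- m) m.
  split; first by move=> x _.
  - by apply: cvg_at_right_filter; exact: cont.
  - by apply: cvg_at_left_filter; exact: cont.
have := continuous_FTC2 mm (continuous_subspaceT cF) dLR.
move=> /(_ (fun x _ => derive1E F x)).
rewrite !F0 ?normrN ?gtr0_norm// subee// => <-.
rewrite [RHS]integral_mkcond; apply: eq_integral => t _.
rewrite patchE; case: ifPn => // /negP; rewrite inE /= in_itv /= => tm.
have tM : M < `|t|.
  apply: contra_notP tm => /negP; rewrite -leNgt => tM.
  by rewrite -ler_norml; apply: le_trans (ltW Mm).
congr EFin; rewrite (near_eq_derive (g := cst 0)) ?derive_cst//.
have : \forall s \near t, M < `|s|.
  have := @norm_continuous _ R t; move/cvgr_gt; exact.
by apply: filterS => s; exact: F0.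
Qed.

Lemma lebesgue_step_integral n (mu : {sigma_finite_measure set 'rV[R]_n -> \bar R})
    (f : 'rV[R]_n.+1 -> R) :
  (lebesgue_step mu).-integrable setT (EFin \o f) ->
  ((@lebesgue_measure R) \x mu)%E.-integrable setT (EFin \o (f \o @vcons R n)) /\
  (\int[lebesgue_step mu]_x (f x)%:E =
   \int[(@lebesgue_measure R) \x mu]_p (f (vcons p))%:E)%E.
Proof.
move=> /integrableP[mf fi]; have mv := @measurable_vcons R n.
have stepE (g : 'rV[R]_n.+1 -> \bar R) :
    (\int[lebesgue_step mu]_x g x =
     \int[pushforward ((@lebesgue_measure R) \x mu)%E (@vcons R n)]_x g x)%E.
  exact: eq_measure_integral.
have ifv : ((@lebesgue_measure R) \x mu)%E.-integrable setT (EFin \o (f \o @vcons R n)).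
  apply/integrableP; split.
    exact: (measurableT_comp mf).
  move: fi; rewrite stepE ge0_integral_pushforward//.
  exact: measurableT_comp.
by split => //; rewrite stepE integral_pushforward.
Qed.

Lemma vcons_line0 n (x t : R) (y : 'rV[R]_n) :
  vcons (x, y) + t *: delta_mx ord0 ord0 = vcons (x + t, y).
Proof.
apply/rowP => k; rewrite [LHS]mxE [X in _ + X]mxE [X in _ + _ * X]mxE.
case: (unliftP ord0 k) => [j ->|->].
  by rewrite !vconsES /= mulr0 addr0.
by rewrite !vconsE0 eqxx mulr1.
Qed.

Lemma vcons_lineS n (x t : R) (y : 'rV[R]_n) j :
  vcons (x, y) + t *: delta_mx ord0 (lift ord0 j) =
  vcons (x, y + t *: delta_mx ord0 j).
Proof.
apply/rowP => k; rewrite [LHS]mxE [X in _ + X]mxE [X in _ + _ * X]mxE.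
case: (unliftP ord0 k) => [l ->|->].
  by rewrite !vconsES !mxE (inj_eq (@lift_inj _ ord0)).
by rewrite !vconsE0 /= mulr0 addr0.
Qed.

Lemma derive_line_eq {V V' : normedModType R} (f : V -> R) (g : V' -> R)
    (a v : V) (b w : V') : (forall t, f (a + t *: v) = g (b + t *: w)) ->
  'D_v f a = 'D_w g b /\ (derivable f a v -> derivable g b w).
Proof.
move=> fg; have E : (fun h : R => h^-1 *: ((f \o shift a) (h *: v) - f a)) =
  (fun h => h^-1 *: ((g \o shift b) (h *: w) - g b)).
  apply/funext => h /=; have := fg 0; rewrite !scale0r !addr0 => ->.
  by rewrite (addrC (h *: v)) fg (addrC b).
by rewrite /derive /derivable E.
Qed.

Lemma vcons_continuous_snd n (x : R) : continuous (fun y : 'rV[R]_n => vcons (x, y)).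
Proof.
move=> y A /nbhs_ballP[e /= e0 eA]; apply/nbhs_ballP; exists e => //= z.
move=> /(ball_rowP _ _ e0) yz; apply: eA; apply/ball_rowP => // k.
case: (unliftP ord0 k) => [l ->|->]; first by rewrite !vconsES; exact: yz.
by rewrite !vconsE0 /= subrr normr0.
Qed.

Lemma vcons_continuous_fst n (y : 'rV[R]_n) : continuous (fun x : R => vcons (x, y)).
Proof.
move=> x A /nbhs_ballP[e /= e0 eA]; apply/nbhs_ballP; exists e => //= z.
move=> xz; apply: eA; apply/ball_rowP => // k.
case: (unliftP ord0 k) => [l ->|->]; last by rewrite !vconsE0.
by rewrite !vconsES /= subrr normr0.
Qed.

(* Induction on the dimension: by Fubini it suffices to integrate first along
   the direction i, or along the remaining coordinates. *)
Lemma integral_partial0 n (f : 'rV[R]_n -> R) (i : 'I_n) (M : R) :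
  (forall x, derivable f x (delta_mx ord0 i)) -> continuous (partial i f) ->
  (forall (x : 'rV[R]_n) j, M < `|x ord0 j| -> f x = 0) ->
  (\int[lebesgueN n]_x (partial i f x)%:E = 0)%E.
Proof.
elim: n f i => [f []//|n IH f i df cf f0].
have pf0 (x : 'rV[R]_n.+1) j : M < `|x ord0 j| -> partial i f x = 0.
  move=> xj; rewrite /partial (near_eq_derive (g := cst 0)) ?derive_cst//.
  have : \forall y \near x, M < `|(y : 'rV[R]_n.+1) ord0 j|.
    have : {for x, continuous (fun y : 'rV[R]_n.+1 => `|y ord0 j|)}.
      apply: continuous_comp; first exact: coord_continuous.
      exact: norm_continuous.
    by move/cvgr_gt; exact.
  by apply: filterS => y; exact: f0.
have ig : (lebesgueN n.+1).-integrable setT (EFin \o partial i f).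
  apply: (@box_integrable _ _ _ (const_mx (- M)) (const_mx M)) => // x.
  move=> /existsNP[j]; rewrite !mxE -ler_norml => /negP; rewrite -ltNge.
  exact: pf0.
have [igv ->] := lebesgue_step_integral ig.
case: (unliftP ord0 i) => [j iE|i0].
  rewrite -integral12_prod_meas1//= /fubini_F.
  rewrite integral0_eq// => x _.
  pose fx (y : 'rV[R]_n) := f (vcons (x, y)).
  have fxE y := @derive_line_eq _ _ f fx (vcons (x, y)) (delta_mx ord0 i) y
    (delta_mx ord0 j) (fun t => congr1 f (etrans (congr1 (fun k =>
      vcons (x, y) + t *: delta_mx ord0 k) iE) (vcons_lineS x t y j))).
  have pE : partial j fx = fun y => partial i f (vcons (x, y)).
    by apply/funext => y; rewrite /partial (fxE y).1.
  have := IH fx j; rewrite pE; apply.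
  - by move=> y; apply: (fxE y).2; exact: df.
  - move=> y; apply: (@continuous_comp _ _ _ (fun y => vcons (x, y))); last exact: cf.
    exact: vcons_continuous_snd.
  - by move=> y l yl; apply: (f0 _ (lift ord0 l)); rewrite vconsES.
rewrite -integral21_prod_meas1//= /fubini_G.
rewrite integral0_eq// => y _.
pose fy (x : R) := f (vcons (x, y)).
have fyE x : 'D_(delta_mx ord0 i) f (vcons (x, y)) = 'D_1 fy x /\
    (derivable f (vcons (x, y)) (delta_mx ord0 i) -> derivable fy x 1).
  apply: derive_line_eq => t.
  by rewrite i0 vcons_line0 [t *: 1]mulr1.
have pE : 'D_1 fy = fun x => partial i f (vcons (x, y)).
  by apply/funext => x; rewrite /partial (fyE x).1.
transitivity (\int[@lebesgue_measure R]_x ('D_1 fy x)%:E)%E.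
  by apply: eq_integral => x _; rewrite /= -(fyE x).1.
apply: (@integral_derive_compact fy M).
- by move=> x; apply: (fyE x).2; exact: df.
- rewrite pE => x; apply: (@continuous_comp _ _ _ (fun x => vcons (x, y))); last exact: cf.
  exact: vcons_continuous_fst.
- by move=> x xM; apply: (f0 _ ord0); rewrite vconsE0.
Qed.

Section parts.
Variable d : nat.
Local Notation E := 'rV[R]_d.
Local Notation mu := (lebesgueN d).

Lemma integration_by_parts1 (D D' : set E) (f g : E -> R) i :
  test_function D f -> test_function D' g ->
  l2ip mu f (partial i g) = - l2ip mu (partial i f) g.
Proof.
move=> tf tg; have sf := test_smooth tf; have sg := test_smooth tg.
have df x : derivable f x (delta_mx ord0 i) by exact: smooth_derivable.
have dg x : derivable g x (delta_mx ord0 i) by exact: smooth_derivable.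
have lf := test_l2 tf; have lg := test_l2 tg.
have lpf := test_l2 (test_function_partial i tf).
have lpg := test_l2 (test_function_partial i tg).
have [a [b f0]] := test_support_box tf.
pose M := `|a| + `|b|.
have fM (x : E) j : M < `|x ord0 j| -> f x = 0.
  move=> xM; apply: f0 => /(_ j) /andP[ax xb].
  have := coord_norm_le a j; have := coord_norm_le b j.
  move: xM; rewrite /M; have [x0|x0] := leP 0 (x ord0 j).
    have := ler_norm (b ord0 j); have := normr_ge0 a.
    by rewrite (ger0_norm x0); lra.
  have := ler_norm (- a ord0 j); rewrite normrN; have := normr_ge0 b.
  by rewrite (ltr0_norm x0); lra.
have := @integral_partial0 d (f * g) i M; rewrite partialM// => /(_ _ _ _)/wrap[].
- by move=> x; exact: derivableM.
- move=> x; apply: continuousD; apply: continuousM; apply: smooth_continuous => //;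
  exact: smooth_partial.
- move=> x j /fM fx; transitivity (f x * g x); first by [].
  by rewrite fx mul0r.
rewrite /l2ip => H; apply/eqP; rewrite -addr_eq0; apply/eqP.
rewrite -RintegralD//; try exact: l2_mul_integrable.
by rewrite /Rintegral [X in fine X]H.
Qed.

Lemma integration_by_parts_seq (D D' : set E) (f g : E -> R) s :
  test_function D f -> test_function D' g ->
  l2ip mu f (foldr partial g s) = (-1) ^+ size s * l2ip mu (foldr partial f s) g.
Proof.
move=> tf tg; rewrite -(foldr_partial_rev _ (test_smooth tf)).
elim: s f tf => [|i s IH] f tf; first by rewrite mul1r.
rewrite [foldr _ _ (_ :: _)]/= (integration_by_parts1 i tf (test_function_foldr s tg)).
rewrite (IH _ (test_function_partial i tf)) /= rev_cons foldr_rcons.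
by rewrite exprS mulN1r mulNr.
Qed.

Lemma integration_by_parts (D D' : set E) (f g : E -> R) (alpha : 'I_d -> nat) :
  test_function D f -> test_function D' g ->
  l2ip mu f (multi_partial alpha g) =
  (-1) ^+ (\sum_i alpha i)%N * l2ip mu (multi_partial alpha f) g.
Proof.
move=> tf tg; rewrite !multi_partialE (integration_by_parts_seq _ tf tg).
congr (_ ^+ _ * _); rewrite size_flatten /shape -map_comp sumnE big_map.
by rewrite big_enum; apply: eq_bigr => i _ /=; rewrite size_nseq.
Qed.

End parts.

End integration_by_parts.

(** * Bump functions and the fundamental lemma *)

Section flat_functions.
Context {R : realType}.
Implicit Types (c t : R) (p : {poly R}).

Definition flat c p t : R := if 0 < t then p.[t^-1] * expR (- (c / t)) else 0.

(* With s = 1/t: d/dt (p(s) exp(- c s)) = s^2 (c p(s) - p'(s)) exp(- c s). *)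
Definition flat_deriv c p : {poly R} := 'X^2 * (c *: p - p^`()).

Lemma flat_bound c p : 0 < c -> exists K : R,
  forall t, 0 < t <= 1 -> `|flat c p t| <= K * t ^+ 2.
Proof.
move=> c0; set n := size p; set m := n.+2.
pose S := \sum_(i < n) `|p`_i|.
exists (S * (m%:R / c) ^+ m) => t /andP[t0 t1]; rewrite /flat t0 normrM.
have s0 : 0 < t^-1 by rewrite invr_gt0.
have s1 : 1 <= t^-1 by rewrite invf_ge1.
have pS : `|p.[t^-1]| <= S * t^-1 ^+ n.
  rewrite horner_coef mulr_suml; apply: (le_trans (ler_norm_sum _ _ _)).
  apply: ler_sum => i _; rewrite normrM ler_wpM2l// ger0_norm; last first.
    by rewrite exprn_ge0// ltW.
  by rewrite ler_weXn2l// ltnW.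
have m0 : 0 < m%:R :> R by rewrite ltr0n.
have eS : expR (- (c / t)) <= (m%:R / c * t) ^+ m.
  have -> : - (c / t) = m%:R * - (c / t / m%:R) by field; rewrite !gt_eqF.
  rewrite expRM_natl; apply: lerXn2r; rewrite ?nnegrE ?expR_ge0//.
    by rewrite mulr_ge0 ?divr_ge0// ltW.
  rewrite expRN -[leRHS]invrK lef_pV2 ?posrE ?expR_gt0 ?invr_gt0//; last first.
    by rewrite mulr_gt0 ?divr_gt0.
  have -> : (m%:R / c * t)^-1 = c / t / m%:R by field; rewrite !gt_eqF.
  by apply: le_trans (expR_ge1Dx _); rewrite lerDr.
rewrite [X in _ * X <= _]ger0_norm ?expR_ge0//.
apply: (@le_trans _ _ (S * t^-1 ^+ n * (m%:R / c * t) ^+ m)).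
  by apply: ler_pM; [exact: normr_ge0|exact: expR_ge0|exact: pS|exact: eS].
rewrite exprMn mulrACA le_eqVlt; apply/orP; left; apply/eqP; congr (_ * _).
by rewrite /m -addn2 exprD mulrA -exprMn mulVf ?gt_eqF// expr1n mul1r.
Qed.

Lemma is_derive_flat c p t : 0 < c ->
  is_derive t 1 (flat c p) (flat c (flat_deriv c p) t).
Proof.
move=> c0; have [t0|t0|->] := ltgtP t 0.
- rewrite [X in is_derive _ _ _ X](_ : _ = 0); last by rewrite /flat ltNge ltW.
  apply: (@near_eq_is_derive _ _ _ (cst 0)).
    have : \forall s \near t, s < 0 by exact: lt_nbhsl.
    by apply: filterS => s s0; rewrite /flat ltNge ltW.
- apply: (@near_eq_is_derive R R R (fun s : R => p.[s^-1] * expR (- (c * s^-1)))).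
    have : \forall s \near t, 0 < s by exact: lt_nbhsr.
    by apply: filterS => s s0; rewrite /flat s0.
  have t_neq0 : t != 0 by rewrite gt_eqF.
  have dV : is_derive t 1 (fun s : R => s^-1) (- t ^- 2).
    apply: DeriveDef; first exact: derivableV.
    by rewrite deriveV// derive_id scaleNr [_ *: _]mulr1.
  have dp : is_derive t 1 (horner p \o (fun s : R => s^-1)) (p^`().[t^-1] * - t ^- 2).
    exact: is_derive1_comp.
  have dn : is_derive t 1 (fun s : R => - (c * s^-1)) (- (c * - t ^- 2)).
    exact: (is_deriveN (is_deriveZ c dV)).
  have de : is_derive t 1 (expR \o (fun s : R => - (c * s^-1)))
      (expR (- (c * t^-1)) * - (c * - t ^- 2)).
    exact: is_derive1_comp.
  have := is_deriveM dp de; rewrite /= => H.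
  apply: (is_derive_eq H); rewrite /flat t0 /flat_deriv !hornerE /=.
  by rewrite exprVn /GRing.scale /=; ring.
- have -> : flat c (flat_deriv c p) 0 = 0 by rewrite /flat ltxx.
  have [K HK] := flat_bound p c0.
  have lim0 : (fun h : R => h^-1 *: ((flat c p \o shift 0) (h *: (1:R)) - flat c p 0))
      @ 0^' --> (0 : R).
    apply/cvgrPdist_le => e e0.
    have r0 : 0 < Num.min 1 (e / (`|K| + 1)) by rewrite lt_min ltr01 divr_gt0// ltr_wpDl.
    near=> h.
    have h0 : h != 0 by near: h; exact: nbhs_dnbhs_neq.
    have hr : `|h| < Num.min 1 (e / (`|K| + 1)).
      by near: h; exact: dnbhs0_lt.
    rewrite sub0r normrN /= addr0 [h *: 1]mulr1 {2}/flat ltxx subr0.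
    rewrite normrM normfV; have [hp|hn] := ltP 0 h; last first.
      by rewrite /flat ltNge hn /= normr0 mulr0 ltW.
    move: hr; rewrite (gtr0_norm hp) lt_min => /andP[h1 he].
    have h01 : 0 < h <= 1 by rewrite hp ltW.
    rewrite mulrC ler_pdivrMr//; apply: (le_trans (HK h h01)).
    rewrite expr2 mulrA ler_pM2r//.
    apply: (@le_trans _ _ ((`|K| + 1) * h)).
      by rewrite ler_pM2r//; have := ler_norm K; lra.
    by rewrite mulrC -ler_pdivlMr ?ltW// ltr_wpDl.
  apply: DeriveDef; first by apply/cvg_ex; exists 0.
  by apply: cvg_lim lim0.
Unshelve. all: by end_near. Qed.

Lemma flat1_ge0 c t : 0 <= flat c 1 t.
Proof. by rewrite /flat; case: ifP => // _; rewrite hornerC mul1r expR_ge0. Qed.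

Lemma flat1_le1 c t : 0 < c -> flat c 1 t <= 1.
Proof.
move=> c0; rewrite /flat; case: ifP => // t0; rewrite hornerC mul1r.
by rewrite -expR0 ler_expR oppr_le0 divr_ge0// ltW.
Qed.

Lemma flat1_neq0 c t : (flat c 1 t != 0) = (0 < t).
Proof.
rewrite /flat; case: ifP => [t0|_]; last by rewrite eqxx.
by rewrite hornerC mul1r gt_eqF// expR_gt0.
Qed.

Lemma flat1_cvg t : flat (n.+1%:R^-1) 1 t @[n --> \oo] --> ((0 < t)%R%:R : R).
Proof.
have [t0|t0] := ltP 0 t; last first.
  under eq_fun do rewrite /flat ltNge t0 /=.
  exact: cvg_cst.
under eq_fun do rewrite /flat t0 hornerC mul1r.
have -> : true%:R = expR (- (0 / t)) by rewrite mul0r oppr0 expR0.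
apply: (cvg_comp _ expR); last exact: continuous_expR.
apply: cvgN; apply: cvgM; last exact: cvg_cst.
exact: cvg_harmonic.
Qed.

End flat_functions.

Lemma cvg_prod_seq (R : realType) (I : Type) (s : seq I) (F : I -> nat -> R)
    (l : I -> R) : (forall i, F i n @[n --> \oo] --> l i) ->
  \prod_(i <- s) F i n @[n --> \oo] --> \prod_(i <- s) l i.
Proof.
move=> Fl; elim: s => [|i s IH].
  by rewrite big_nil; under eq_fun do rewrite big_nil; exact: cvg_cst.
by rewrite big_cons; under eq_fun do rewrite big_cons; exact: cvgM.
Qed.

Section bumps.
Context {R : realType} {d : nat}.
Local Notation E := 'rV[R]_d.

Definition coord_flat (c : R) (p : {poly R}) (i : 'I_d) (s a : R) : E -> R :=
  fun x => flat c p (s * x ord0 i + a).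

Inductive flat_algebra : set (E -> R) :=
| flat_algebra1 : flat_algebra (cst 1)
| flat_algebra_coord c p i s a : 0 < c -> flat_algebra (coord_flat c p i s a)
| flat_algebraZ k f : flat_algebra f -> flat_algebra (k *: f)
| flat_algebraD f g : flat_algebra f -> flat_algebra g -> flat_algebra (f + g)
| flat_algebraM f g : flat_algebra f -> flat_algebra g -> flat_algebra (f * g).

Lemma derive_coord_flat c p i s a j (x : E) : 0 < c ->
  derivable (coord_flat c p i s a) x (delta_mx ord0 j) /\
  'D_(delta_mx ord0 j) (coord_flat c p i s a) x =
    (s * (i == j)%:R) * coord_flat c (flat_deriv c p) i s a x.
Proof.
move=> c0; pose w := s * (i == j)%:R; pose y := s * x ord0 i + a.
have [dy Dy] := @is_derive_flat R c p y c0.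
have diffy : differentiable (flat c p) y by apply/derivable1_diffP.
have [D1 D2] : 'D_w (flat c p) y = 'D_(delta_mx ord0 j) (coord_flat c p i s a) x /\
    (derivable (flat c p) y w -> derivable (coord_flat c p i s a) x (delta_mx ord0 j)).
  apply: derive_line_eq => t; rewrite /coord_flat; congr flat.
  have -> : (x + t *: delta_mx ord0 j) ord0 i = x ord0 i + t * (i == j)%:R.
    by rewrite !mxE eqxx.
  transitivity (y + t * w) => //; rewrite /y /w; ring.
split; first by apply: D2; exact: diff_derivable.
rewrite -D1 deriveE// -[w]mulr1 -[w * 1]/(w *: (1 : R)) linearZ /=.
by rewrite -deriveE// Dy.
Qed.

Lemma flat_algebra_smooth : flat_algebra `<=` smooth.
Proof.
have der f i x : flat_algebra f -> derivable f x (delta_mx ord0 i).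
  elim=> {f} [|c p j s a c0|k f _ ?|f g _ ? _ ?|f g _ ? _ ?].
  - exact: derivable_cst.
  - exact: (derive_coord_flat p j s a i x c0).1.
  - exact: derivableZ.
  - exact: derivableD.
  - exact: derivableM.
apply: smooth_coind => //.
- move=> f; elim=> {f} [|c p j s a c0|k f _ Hf|f g _ Hf _ Hg|f g _ Hf _ Hg] x.
  + exact: cst_continuous.
  + apply: (@continuous_comp _ _ _ (fun x : E => s * x ord0 j + a)).
      apply: continuousD; last exact: cst_continuous.
      by apply: continuousM; [exact: cst_continuous|exact: coord_continuous].
    apply: differentiable_continuous; apply/derivable1_diffP.
    by have [dfl _] := @is_derive_flat R c p (s * x ord0 j + a) c0; exact: dfl.
  + by apply: continuousM; [exact: cst_continuous|exact: Hf].
  + by apply: continuousD; [exact: Hf|exact: Hg].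
  + by apply: continuousM; [exact: Hf|exact: Hg].
- move=> f i; elim=> {f} [|c p j s a c0|k f Hf ?|f g Hf ? Hg ?|f g Hf ? Hg ?].
  + rewrite (_ : partial i _ = 0 *: cst 1).
      by apply: flat_algebraZ; exact: flat_algebra1.
    apply/funext => x; rewrite /partial derive_cst.
    by transitivity ((0 : R) * 1); [rewrite mul0r|].
  + rewrite (_ : partial i _ = (s * (j == i)%:R) *: coord_flat c (flat_deriv c p) j s a).
      by apply: flat_algebraZ; exact: flat_algebra_coord.
    by apply/funext => x; rewrite /partial (derive_coord_flat p j s a i x c0).2.
  + by rewrite partialZ => [|x]; [exact: flat_algebraZ|exact: der].
  + by rewrite partialD => [|x|x]; [exact: flat_algebraD|exact: der|exact: der].
  + rewrite partialM => [|x|x]; [|exact: der|exact: der].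
    by apply: flat_algebraD; exact: flat_algebraM.
Qed.

Definition bump (c : R) (a b : E) : E -> R :=
  \prod_(i < d) (coord_flat c 1 i 1 (- a ord0 i) * coord_flat c 1 i (-1) (b ord0 i)).

Lemma bumpE c a b x : bump c a b x =
  \prod_(i < d) (flat c 1 (x ord0 i - a ord0 i) * flat c 1 (b ord0 i - x ord0 i)).
Proof.
apply: (@big_ind2 (E -> R) R (fun f v => f x = v)) => // [f u g v <- <-//|i _].
by rewrite -[LHS]/(_ x * _ x) /coord_flat mul1r mulN1r (addrC (- x _ _)).
Qed.

Lemma bump_neq0 c a b x : (bump c a b x != 0) = `[< obox a b x >].
Proof.
rewrite bumpE; apply/idP/idP.
  move=> /prodf_neq0 H; apply/asboolP => i; have := H i isT.
  by rewrite mulf_eq0 negb_or !flat1_neq0 !subr_gt0.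
move=> /asboolP H; apply/prodf_neq0 => i _.
by rewrite mulf_eq0 negb_or !flat1_neq0 !subr_gt0; exact: H.
Qed.

Lemma cbox_closed (a b : E) : closed (cbox a b).
Proof.
rewrite (_ : cbox a b = \bigcap_(i in [set: 'I_d])
   ((fun x : E => x ord0 i) @^-1` `[a ord0 i, b ord0 i])); last first.
  apply/seteqP; split => [y H i _|y H i] /=; first by rewrite in_itv /=; exact: H.
  by have := H i I; rewrite /= in_itv.
apply: closed_bigI => i _; apply: preimage_closed; last exact: itv_closed.
by move=> x _; exact: coord_continuous.
Qed.

Lemma cbox_compact (a b : E) : compact (cbox a b).
Proof.
rewrite (_ : cbox a b = [set v : E | forall i, v ord0 i \in `[a ord0 i, b ord0 i]]).
  apply: (@rV_compact _ _ (fun i => `[a ord0 i, b ord0 i]%classic)) => i.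
  exact: segment_compact.
by apply/seteqP; split => x Hx i; have := Hx i; rewrite in_itv.
Qed.

Lemma bump_test D c a b : 0 < c -> cbox a b `<=` D -> test_function D (bump c a b).
Proof.
move=> c0 abD.
have sub : closure [set x | bump c a b x != 0] `<=` cbox a b.
  rewrite [X in _ `<=` X]((closure_id _).1 (@cbox_closed a b)).
  apply: closureS => x /=; rewrite bump_neq0 => /asboolP; exact: obox_cbox.
split; last exact: subset_trans sub abD.
  apply: flat_algebra_smooth; rewrite /bump; elim/big_ind : _ => //.
  - exact: flat_algebra1.
  - exact: flat_algebraM.
  - by move=> i _; apply: flat_algebraM; exact: flat_algebra_coord.
apply: subclosed_compact (@cbox_compact a b) sub; exact: closed_closure.
Qed.

Lemma bump_ge0 c a b x : 0 <= bump c a b x.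
Proof. by rewrite bumpE prodr_ge0// => i _; rewrite mulr_ge0// flat1_ge0. Qed.

Lemma bump_le1 c a b x : 0 < c -> bump c a b x <= 1.
Proof.
move=> c0; rewrite bumpE; apply: prodr_ile1 => i _.
by rewrite mulr_ge0 ?flat1_ge0//= mulr_ile1 ?flat1_ge0 ?flat1_le1.
Qed.

Lemma bump_cvg a b x : bump (n.+1%:R^-1) a b x @[n --> \oo] --> (\1_(obox a b) x : R).
Proof.
under eq_fun do rewrite bumpE.
rewrite indicE (_ : (x \in obox a b)%:R = \prod_(i < d)
    ((0 < x ord0 i - a ord0 i)%R%:R * (0 < b ord0 i - x ord0 i)%R%:R) :> R).
  apply: cvg_prod_seq => i.
  by apply: cvgM; exact: flat1_cvg.
have [xo|xo] := boolP (x \in obox a b).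
  rewrite big1// => i _; move: xo; rewrite inE => /(_ i) /andP[h1 h2].
  by rewrite !subr_gt0 h1 h2 mulr1.
apply/esym; move: xo; rewrite notin_setE => /existsNP[i /negP].
rewrite negb_and => h; rewrite (bigD1 i)//= !subr_gt0.
by case/orP: h => /negbTE ->; rewrite ?mul0r ?mulr0 ?mul0r.
Qed.

End bumps.

Lemma l2_indic dd (T : measurableType dd) (R : realType)
    (mu : {measure set T -> \bar R}) (A : set T) :
  measurable A -> (mu A < +oo)%E -> l2 mu (\1_A).
Proof.
move=> mA fA; apply/l2P; split; first exact: measurable_indic.
have : mu.-integrable A (EFin \o (cst 1 : T -> R)).
  apply: measurable_bounded_integrable => //.
  by exists 1; split => // M M1 x _ /=; rewrite normr1 ltW.
move/(integrable_mkcond _ mA); apply: eq_integrable => // x _.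
by rewrite patchE /= indicE; case: ifP; rewrite ?expr1n ?expr0n.
Qed.

Section fundamental_lemma.
Context {R : realType} {d : nat}.
Local Notation E := 'rV[R]_d.
Local Notation mu := (@lebesgueN R d).

Lemma integral_l2_obox (D : set E) (h : E -> R) (a b : E) : l2 mu h ->
  (forall phi, test_function D phi -> l2ip mu h phi = 0) -> cbox a b `<=` D ->
  (\int[mu]_(x in obox a b) (h x)%:E = 0)%E.
Proof.
move=> lh h0 abD; have mc := @measurable_cbox R d a b.
have mh := l2_measurable lh.
have l1 : l2 mu (\1_(cbox a b)) by apply: l2_indic => //; exact: cbox_finite.
have tb n : test_function D (bump (n.+1%:R^-1) a b).
  by apply: bump_test => //; rewrite invr_gt0.
have lb n := test_l2 (tb n).
pose f_ n x := (h x * bump (n.+1%:R^-1) a b x)%:E.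
have [||||| _ _ cv] := @dominated_convergence _ _ _ mu _ measurableT f_
    (fun x => (h x * \1_(obox a b) x)%:E) (fun x => `|(h x * \1_(cbox a b) x)%:E|%E).
- move=> n; apply/measurable_EFinP; apply: measurable_funM => //.
  exact: l2_measurable (lb n).
- apply/measurable_EFinP; apply: measurable_funM => //.
  by apply: measurable_indic; exact: measurable_obox.
- apply: aeW => x _; apply/cvg_EFin; first exact: nearW.
  by apply: cvgM; [exact: cvg_cst|exact: bump_cvg].
- by apply: integrable_abse; exact: l2_mul_integrable.
- apply: aeW => x n _; rewrite /f_ lee_fin !normrM ler_wpM2l//.
  rewrite (ger0_norm (bump_ge0 _ _ _ _)) indicE.
  have [xc|xc] := boolP (x \in cbox a b).
    by rewrite normr1 bump_le1// invr_gt0.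
  rewrite normr0 le_eqVlt; apply/orP; left.
  rewrite -[_ == _]negbK bump_neq0; apply/asboolPn => /obox_cbox xab.
  by move/negP : xc; apply; rewrite inE.
have f0 n : (\int[mu]_x f_ n x = 0)%E.
  rewrite -[LHS]fineK; first by have := h0 _ (tb n); rewrite /l2ip /Rintegral => ->.
  by apply: integrable_fin_num => //; exact: (l2_mul_integrable lh (lb n)).
have -> : (\int[mu]_(x in obox a b) (h x)%:E =
    \int[mu]_x (h x * \1_(obox a b) x)%:E)%E.
  rewrite integral_mkcond; apply: eq_integral => x _.
  by rewrite patchE indicE; case: ifP; rewrite ?mulr1 ?mulr0.
move: cv; rewrite (_ : (fun n => _) = cst 0%E); last exact/funext.
by move/cvg_lim => <-//; rewrite lim_cst.
Qed.

Definition oboxes : set (set E) := [set A | exists a b, A = obox a b].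

Definition row_max (a b : E) : E := \row_i Num.max (a ord0 i) (b ord0 i).

Definition row_min (a b : E) : E := \row_i Num.min (a ord0 i) (b ord0 i).

Lemma obox_setI a b a' b' :
  obox a b `&` obox a' b' = obox (row_max a a') (row_min b b').
Proof.
apply/seteqP; split => [x [H H'] i|x H].
  by rewrite !mxE gt_max lt_min; have /andP[-> ->] := H i; have /andP[-> ->] := H' i.
by split => i; have := H i; rewrite !mxE gt_max lt_min => /andP[/andP[h1 h2] /andP[h3 h4]];
  apply/andP.
Qed.

Lemma cbox_max_min_sub a b a' b' :
  cbox (row_max a a') (row_min b b') `<=` cbox a' b'.
Proof.
move=> x H i; have := H i; rewrite !mxE ge_max le_min.
by move=> /andP[/andP[h1 h2] /andP[h3 h4]]; apply/andP.
Qed.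

Lemma oboxes_setI : setI_closed oboxes.
Proof.
by move=> _ _ [a [b ->]] [a' [b' ->]]; rewrite obox_setI; exists (row_max a a'), (row_min b b').
Qed.

Lemma measurable_oboxes : @measurable _ E = <<s oboxes >>.
Proof.
apply/seteqP; split; last first.
  apply: smallest_sub; first exact: sigma_algebra_measurable.
  by move=> _ [a [b ->]]; exact: measurable_obox.
move=> A mA.
have openG (O : set E) : open O -> (<<s oboxes >>) O.
  move=> oO; rewrite (open_bigcup_ratbox oO) bigcup_mkcond.
  apply: (@countable_bigcupT_measurable _ (g_sigma_algebraType oboxes)) => // q.
  case: ifP => _; last exact: measurable0.
  by apply: sub_sigma_algebra; exists (rat_row q.1), (rat_row q.2).
have := @measurable_rowP R d _ (g_sigma_algebraType oboxes) (@idfun E).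
move=> /(_ _)/wrap[i|/(_ measurableT A mA)]; last by rewrite setTI.
move=> mT; apply: (measurability _ (RGenOInfty.measurableE R)) => //.
move=> _ [_ [r ->] <-]; rewrite setTI; apply: openG.
by apply: open_comp; [move=> x _; exact: coord_continuous|exact: interval_open].
Qed.

Lemma fundamental_lemma (D : set E) (h : E -> R) : open D -> l2 mu h ->
  (forall phi, test_function D phi -> l2ip mu h phi = 0) ->
  {ae mu, forall x, D x -> h x = 0}.
Proof.
move=> oD lh h0.
have step (a b : E) : cbox a b `<=` D -> {ae mu, forall x, obox a b x -> h x = 0}.
  move=> abD; have mB := @measurable_obox R d a b.
  have ihB : mu.-integrable (obox a b) (EFin \o h).
    apply: (@integrableS _ _ _ _ (cbox a b)) => //.
    - exact: measurable_cbox.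
    - exact: obox_cbox.
    have l1 : l2 mu (\1_(cbox a b)).
      by apply: l2_indic; [exact: measurable_cbox|exact: cbox_finite].
    apply/(integrable_mkcond _ (@measurable_cbox R d a b)).
    have := l2_mul_integrable lh l1; apply: eq_integrable => // x _.
    by rewrite /= patchE indicE; case: ifP; rewrite ?mulr1 ?mulr0.
  pose hB := (EFin \o h) \_ (obox a b).
  have ihB' : mu.-integrable setT hB by apply/(integrable_mkcond _ mB).
  have hBS (S : set E) : (\int[mu]_(x in S) hB x =
      \int[mu]_(x in S `&` obox a b) (h x)%:E)%E by rewrite -integral_mkcondr.
  have zero (S : set E) : measurable S -> (\int[mu]_(x in S) hB x = 0)%E.
    rewrite measurable_oboxes; apply: (@dynkin_induction _ _ oboxes
      (fun S => (\int[mu]_(x in S) hB x = 0)%E) measurable_oboxes oboxes_setI).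
    - by rewrite hBS setTI (integral_l2_obox lh h0).
    - move=> _ [a' [b' ->]]; rewrite hBS obox_setI (integral_l2_obox lh h0)//.
      exact: subset_trans (@cbox_max_min_sub _ _ _ _) abD.
    - move=> {}S mS S0.
      have : (\int[mu]_(x in setT) hB x = 0)%E by rewrite hBS setTI (integral_l2_obox lh h0).
      rewrite -(setUv S) integral_setU//.
      + by rewrite S0 add0e.
      + exact: measurableC.
      + by rewrite setUv; exact: measurable_int ihB'.
      + by apply/disj_setPCl.
    - move=> F mF tF F0; rewrite integral_bigcup//.
        by apply: eseries0 => n _ _; exact: F0.
      by apply: integrableS ihB' => //; exact: bigcup_measurable.
  have : ae_eq mu setT hB (cst 0%E).
    apply: integral_ae_eq => // S _ mS.
    by rewrite zero// integral0.
  apply: filterS => x /(_ I) /= + xB.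
  by rewrite /hB patchE mem_set// => -[].
pose Q n : set (set E) := [set A | exists2 q : 'rV[rat]_d * 'rV[rat]_d,
  unpickle n = Some q & A = obox (rat_row q.1) (rat_row q.2) /\
    cbox (rat_row q.1) (rat_row q.2) `<=` D].
apply: (@negligibleS _ _ _ _ (\bigcup_n [set x | exists2 A, Q n A & A x /\ h x <> 0])).
  move=> x /= /not_implyP[Dx hx].
  have [q [qx qD]] := open_ratbox oD Dx.
  exists (pickle q) => //=; exists (obox (rat_row q.1) (rat_row q.2)) => //.
  by exists q => //; rewrite pickleK.
apply: negligible_bigcup => n.
case E : (unpickle n : option ('rV[rat]_d * 'rV[rat]_d)) => [q|]; last first.
  apply: (@negligibleS _ _ _ _ set0); last exact: negligible_set0.
  by move=> x [A [q]]; rewrite E.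
have [qD|qD] := pselect (cbox (rat_row q.1) (rat_row q.2) `<=` D); last first.
  apply: (@negligibleS _ _ _ _ set0); last exact: negligible_set0.
  by move=> x [A [q']]; rewrite E => -[<-] [_ /qD].
apply: negligibleS (step _ _ qD) => x [A [q']]; rewrite E => -[<-] [-> _] [qx hx] /=.
by apply/not_implyP.
Qed.

End fundamental_lemma.

(** * Functions with values in U *)

Lemma cvg_sum_seq (R : realType) (I : Type) (s : seq I) (F : I -> nat -> R)
    (l : I -> R) : (forall i, F i n @[n --> \oo] --> l i) ->
  \sum_(i <- s) F i n @[n --> \oo] --> \sum_(i <- s) l i.
Proof.
move=> Fl; elim: s => [|i s IH].
  by rewrite big_nil; under eq_fun do rewrite big_nil; exact: cvg_cst.
by rewrite big_cons; under eq_fun do rewrite big_cons; exact: cvgD.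
Qed.

Section L2_domain.
Context {R : realType} {d : nat}.
Local Notation E := 'rV[R]_d.
Local Notation mu := (@lebesgueN R d).
Implicit Types (D : set E) (u v : E -> R).

Lemma restrict_lin D (c : R) u v : (c *: u + v) \_ D = c *: (u \_ D) + v \_ D.
Proof.
apply/funext => x; rewrite -[RHS]/(c * (u \_ D) x + (v \_ D) x) !patchE.
by case: ifP => // _; rewrite mulr0 addr0.
Qed.

Lemma innerE D u v : inner D u v = l2ip mu (u \_ D) (v \_ D).
Proof.
rewrite /inner Rintegral_mkcond; apply: eq_Rintegral => x _; rewrite !patchE.
by case: ifP => // _; rewrite mulr0.
Qed.

Lemma L2_semi_inner D : semi_inner (L2 D) (inner D).
Proof.
have si := @l2_semi_inner _ _ _ mu; have [l0 lD] := @l2_subspace _ _ _ mu.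
split.
- split => [|c u v lu lv]; last by rewrite /L2 /= restrict_lin; exact: lD.
  by rewrite /L2 /= (_ : _ \_ D = 0)//; apply/funext => x; rewrite patchE; case: ifP.
- by move=> u v lu lv; rewrite !innerE (si_sym si).
- by move=> w lw c u v lu lv; rewrite !innerE restrict_lin (si_lin si).
- by move=> u lu; rewrite innerE (si_ge0 si).
Qed.

Lemma l2_restrict D u : measurable D -> l2 mu u ->
  l2 mu (u \_ D) /\ l2ip mu (u \_ D) (u \_ D) <= l2ip mu u u.
Proof.
move=> mD lu; have [mu' iu] := iffLR (l2P _ _) lu.
have lD : l2 mu (u \_ D).
  apply/l2P; split; first by apply/(measurable_restrictT _ mD); exact: measurable_funTS.
  apply: le_integrable iu => //.
    apply/measurable_EFinP/measurable_funX.
    by apply/(measurable_restrictT _ mD); exact: measurable_funTS.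
  move=> x _ /=; rewrite patchE lee_fin; case: ifP => // _.
  by rewrite expr0n normr0.
split => //; rewrite /l2ip; apply: le_Rintegral => //; try exact: l2_mul_integrable.
by move=> x _; rewrite patchE; case: ifP => // _; rewrite mulr0 -expr2 sqr_ge0.
Qed.

Lemma restrictB D u v : (u - v) \_ D = u \_ D - v \_ D.
Proof.
by rewrite addrC -scaleN1r restrict_lin scaleN1r addrC.
Qed.

Lemma L2_complete D : measurable D -> si_complete (L2 D) (inner D).
Proof.
move=> mD u lu cu.
have snE w : seminorm (inner D) w = seminorm (l2ip mu) (w \_ D).
  by rewrite /seminorm innerE.
have [n|n|l ll ul] := @l2_complete _ _ R mu (fun n => u n \_ D).
- exact: lu.
- by rewrite -restrictB -snE.
have [lDl _] := l2_restrict mD ll.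
exists l => //; apply: (@squeeze_cvgr _ _ _ _ (cst 0) (fun n => seminorm (l2ip mu) (u n \_ D - l))).
- near=> n; rewrite seminorm_ge0 /= snE; apply: ler_wsqrtr.
  have -> : (u n - l) \_ D = (u n \_ D - l) \_ D.
    apply/funext => x; rewrite !patchE; case: ifP => // xD.
    rewrite -[RHS]/((u n \_ D) x - l x) patchE xD//.
  apply: (l2_restrict mD _).2.
  by apply: subspaceB => //; [exact: l2_subspace|exact: lu].
- exact: cvg_cst.
- exact: ul.
Unshelve. all: by end_near. Qed.

Lemma L2_subset D D' u : measurable D' -> D' `<=` D -> L2 D u -> L2 D' u.
Proof.
move=> mD' DD' lu; have [+ _] := l2_restrict mD' lu.
congr (l2 _ _); apply/funext => x; rewrite !patchE; case: ifP => // xD'.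
by rewrite mem_set//; apply: DD'; move: xD'; rewrite inE.
Qed.

Lemma l2_ae0 u v : l2 mu u -> l2 mu v -> {ae mu, forall x, u x * v x = 0} ->
  l2ip mu u v = 0.
Proof.
move=> lu lv uv0; rewrite /l2ip /Rintegral.
rewrite (ae_eq_integral (cst 0%E))//; first by rewrite integral0.
  by have := l2_mul_integrable lu lv => /measurable_int.
by apply: filterS uv0 => x /= -> _.
Qed.

Lemma L2_null_ae D u : L2 D u -> seminorm (inner D) u = 0 ->
  {ae mu, forall x, D x -> u x = 0}.
Proof.
rewrite /seminorm innerE => lu /(l2_null lu); apply: filterS => x /= + Dx.
by rewrite patchE mem_set//; apply.
Qed.

Lemma L2_ae_null D u : L2 D u -> {ae mu, forall x, D x -> u x = 0} ->
  seminorm (inner D) u = 0.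
Proof.
move=> lu u0; rewrite /seminorm innerE l2_ae0 ?sqrtr0//.
apply: filterS u0 => x /= ux; rewrite patchE; case: ifP; rewrite ?mulr0//.
by rewrite inE => /ux ->; rewrite mulr0.
Qed.

Lemma L2_fundamental D u : open D -> L2 D u ->
  (forall phi, test_function D phi -> inner D u phi = 0) -> seminorm (inner D) u = 0.
Proof.
move=> oD lu H; apply: L2_ae_null => //.
have := fundamental_lemma oD lu => /(_ _)/wrap[phi tphi|].
  by have := H _ tphi; rewrite innerE (test_function_restrict tphi).
by apply: filterS => x + Dx => /(_ Dx); rewrite patchE mem_set.
Qed.

Lemma test_L2 D phi : test_function D phi -> L2 D phi.
Proof. by move=> tphi; rewrite /L2 /= (test_function_restrict tphi); exact: test_l2 tphi. Qed.

End L2_domain.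

Section seminorm_sum.
Context {R : realType} {V : lmodType R} (H : set V) (ip : V -> V -> R).
Hypothesis si : semi_inner H ip.

Lemma seminorm0 : seminorm ip 0 = 0.
Proof.
by rewrite /seminorm (linear_on0 (si_sub si) (si_lin si (subspace0 (si_sub si)))) sqrtr0.
Qed.

Lemma seminorm_sum (I : finType) (c : I -> R) (e : I -> V) : (forall i, H (e i)) ->
  seminorm ip (\sum_i c i *: e i) <= \sum_i `|c i| * seminorm ip (e i).
Proof.
move=> He; have HL := si_sub si.
suff [] : H (\sum_i c i *: e i) /\
  seminorm ip (\sum_i c i *: e i) <= \sum_i `|c i| * seminorm ip (e i) by [].
elim/big_ind2 : _ => [|u r v s [Hu ur] [Hv vs]|i _].
- by split; [exact: subspace0|rewrite seminorm0].
- split; first exact: subspaceD.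
  by apply: (le_trans (seminormD si Hu Hv)); rewrite lerD.
- by split; [exact: subspaceZ|rewrite (seminormZ si)].
Qed.

End seminorm_sum.

Section L2U_domain.
Context {R : realType} {d : nat} {k : value_kind}.
Local Notation E := 'rV[R]_d.
Local Notation mu := (@lebesgueN R d).
Local Notation V := (U R d k).
Local Notation L2U := (@L2U R d k).
Local Notation innerU := (@innerU R d k).
Implicit Types (D : set E) (w z : E -> V).

Definition component w (ij : 'I_(nrow d k) * 'I_(ncol d k)) : E -> R :=
  fun x => entry (w x) ij.1 ij.2.

Lemma entry_lin (c : R) (a b : V) i j :
  entry (c *: a + b) i j = c * entry a i j + entry b i j.
Proof. by rewrite /entry linearP !mxE. Qed.

Lemma component_lin (c : R) w z ij :
  component (c *: w + z) ij = c *: component w ij + component z ij.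
Proof. by apply/funext => x; exact: entry_lin. Qed.

Lemma componentB w z ij : component (w - z) ij = component w ij - component z ij.
Proof. by rewrite addrC -scaleN1r component_lin scaleN1r addrC. Qed.

Lemma L2U_component D w : L2U D w <-> forall ij, L2 D (component w ij).
Proof. by split => [H [i j]|H i j]; [exact: H|exact: (H (i, j))]. Qed.

Lemma L2_component D w ij : L2U D w -> L2 D (component w ij).
Proof. by move/L2U_component. Qed.

Lemma dotUE (a b : V) : dotU a b = \sum_ij entry a ij.1 ij.2 * entry b ij.1 ij.2.
Proof. by rewrite /dotU pair_big. Qed.

Lemma innerUE D w z : L2U D w -> L2U D z ->
  innerU D w z = \sum_ij inner D (component w ij) (component z ij).
Proof.
move=> /L2U_component lw /L2U_component lz; rewrite /innerU Rintegral_mkcond.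
under [RHS]eq_bigr do rewrite innerE.
rewrite /l2ip; rewrite -big_enum /=.
have -> : ((fun x => dotU (w x) (z x)) \_ D) = fun x =>
  \sum_(ij <- enum {: 'I_(nrow d k) * 'I_(ncol d k)})
    (component w ij \_ D) x * (component z ij \_ D) x.
  apply/funext => x; rewrite big_enum patchE /=; case: ifP => xD.
    by rewrite dotUE; apply: eq_bigr => ij _; rewrite !patchE xD.
  by rewrite big1// => ij _; rewrite !patchE xD mul0r.
elim: (enum _) => [|ij s IH].
  by under eq_Rintegral do rewrite big_nil; rewrite big_nil Rintegral_cst// mul0r.
under eq_Rintegral do rewrite big_cons.
rewrite big_cons RintegralD ?IH//; first exact: l2_mul_integrable (lw ij) (lz ij).
elim: s {IH} => [|ij' s IH].
  under eq_fun do rewrite big_nil; exact: integrable0.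
under eq_fun do rewrite big_cons.
apply: (@integrableD _ _ _ _ _ _ (EFin \o _) (EFin \o _)) => //.
exact: l2_mul_integrable (lw ij') (lz ij').
Qed.

Lemma L2U_semi_inner D : semi_inner (L2U D) (innerU D).
Proof.
have si := @L2_semi_inner R d D.
have LL : linear_subspace (L2U D).
  split => [|c u v /L2U_component lu /L2U_component lv]; apply/L2U_component => ij.
    rewrite (_ : component 0 ij = 0); first exact: subspace0 (si_sub si).
    by apply/funext => x; rewrite /component /entry linear0 mxE.
  by rewrite component_lin; case: (si_sub si) => _; exact.
split => //.
- move=> u v lu lv; rewrite !innerUE//; apply: eq_bigr => ij _.
  by rewrite (si_sym si)//; exact: L2_component.
- move=> w lw c u v lu lv; rewrite !innerUE//; last by case: LL => _; exact.
  rewrite mulr_sumr -big_split /=; apply: eq_bigr => ij _.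
  by rewrite component_lin (si_lin si)//; exact: L2_component.
- move=> u lu; rewrite innerUE//; apply: sumr_ge0 => ij _.
  by apply: (si_ge0 si); exact: L2_component.
Qed.

Lemma component_le D w ij : L2U D w ->
  seminorm (inner D) (component w ij) <= seminorm (innerU D) w.
Proof.
move=> lw; apply: ler_wsqrtr; rewrite innerUE// (bigD1 ij)//= lerDl.
apply: sumr_ge0 => kl _; apply: (si_ge0 (L2_semi_inner D)).
exact: L2_component.
Qed.

Definition unit_value (ij : 'I_(nrow d k) * 'I_(ncol d k)) : V :=
  vsproj (Uspace R d k) (delta_mx ij.1 ij.2).

Lemma vsproj_sum (M : 'M[R]_(nrow d k, ncol d k)) :
  vsproj (Uspace R d k) M = \sum_ij M ij.1 ij.2 *: unit_value ij.
Proof.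
rewrite {1}[M]matrix_sum_delta pair_big /= linear_sum; apply: eq_bigr => ij _.
by rewrite linearZ.
Qed.

Lemma entry_sum (I : finType) (c : I -> R) (a : I -> V) i j :
  entry (\sum_l c l *: a l) i j = \sum_l c l * entry (a l) i j.
Proof.
rewrite /entry linear_sum summxE; apply: eq_bigr => l _.
by rewrite linearZ mxE.
Qed.

Lemma value_sum (a : V) : a = \sum_ij entry a ij.1 ij.2 *: unit_value ij.
Proof. by rewrite -vsproj_sum vsvalK. Qed.

Lemma fct_sum_scale (I : finType) (c : I -> R) (e : I -> E -> R) (x : E) :
  (\sum_l c l *: e l) x = \sum_l c l * e l x.
Proof. by rewrite fct_sumE. Qed.

(* The componentwise limit is projected back into U; the projection of the
   ambient matrices onto U is a fixed linear map. *)
Lemma L2U_complete D : measurable D -> si_complete (L2U D) (innerU D).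
Proof.
move=> mD u lu cu; have siU := L2U_semi_inner D; have si := @L2_semi_inner R d D.
have lc n ij : L2 D (component (u n) ij) by exact: L2_component.
have /choice[g Hg] ij : exists g, L2 D g /\
    seminorm (inner D) (component (u n) ij - g) @[n --> \oo] --> (0 : R).
  have [n|n|g Lg cg] := @L2_complete R d D mD (fun n => component (u n) ij).
  - exact: lc.
  - apply: le_trans (cu n); rewrite -componentB; apply: component_le.
    exact: (subspaceB (si_sub siU) (lu _) (lu _)).
  by exists g.
pose l x := vsproj (Uspace R d k) (\matrix_(i, j) g (i, j) x).
have lE x : l x = \sum_ij g ij x *: unit_value ij.
  by rewrite /l vsproj_sum; apply: eq_bigr => -[i j] _; rewrite mxE.
have clE kl : component l kl = \sum_ij entry (unit_value ij) kl.1 kl.2 *: g ij.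
  apply/funext => x; rewrite fct_sum_scale /component lE entry_sum.
  by apply: eq_bigr => ij _; rewrite mulrC.
have cuE n kl : component (u n) kl =
    \sum_ij entry (unit_value ij) kl.1 kl.2 *: component (u n) ij.
  apply/funext => x; rewrite fct_sum_scale /component {1}[u n x]value_sum entry_sum.
  by apply: eq_bigr => ij _; rewrite mulrC.
have ll : L2U D l.
  apply/L2U_component => kl; rewrite clE; apply: subspace_sum (si_sub si) _.
  by move=> ij; have [] := Hg ij.
exists l => //.
have cl kl : seminorm (inner D) (component (u n - l) kl) @[n --> \oo] --> (0 : R).
  pose b n := \sum_ij `|entry (unit_value ij) kl.1 kl.2| *
    seminorm (inner D) (component (u n) ij - g ij).
  apply: (@squeeze_cvgr _ _ _ _ (cst 0) b).
  - near=> n; rewrite seminorm_ge0 /= componentB clE cuE -sumrB.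
    under eq_bigr do rewrite -scalerBr.
    apply: (seminorm_sum si) => ij; apply: subspaceB (si_sub si) (lc n ij) _.
    by have [] := Hg ij.
  - exact: cvg_cst.
  - rewrite /b; rewrite [X in _ --> X](_ : 0 = \sum_(ij <- enum {: 'I_(nrow d k) * 'I_(ncol d k)})
      (`|entry (unit_value ij) kl.1 kl.2| * 0)); last by rewrite big1// => ij _; rewrite mulr0.
    under eq_fun do rewrite -big_enum /=.
    apply: cvg_sum_seq => ij; apply: cvgM; first exact: cvg_cst.
    by have [] := Hg ij.
pose S n := \sum_ij seminorm (inner D) (component (u n - l) ij) ^+ 2.
have cv2 : S n @[n --> \oo] --> (0 : R).
  have -> : (0 : R) = \sum_(ij <- enum {: 'I_(nrow d k) * 'I_(ncol d k)}) (0 * 0).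
    by rewrite big1// => ij _; rewrite mulr0.
  rewrite /S; under eq_fun do rewrite -big_enum /=.
  by apply: cvg_sum_seq => ij; apply: cvgM.
have sE : (fun n => seminorm (innerU D) (u n - l)) = Num.sqrt \o S.
  apply/funext => n /=.
  have lul : L2U D (u n - l) by exact: (subspaceB (si_sub siU) (lu _) ll).
  rewrite /seminorm innerUE// /S; congr Num.sqrt; apply: eq_bigr => ij _.
  by rewrite sqr_sqrtr//; apply: (si_ge0 si); exact: L2_component.
rewrite sE -[X in _ --> X]sqrtr0.
by apply: (cvg_comp _ _ cv2); exact: sqrt_continuous.
Unshelve. all: by end_near. Qed.

Lemma L2U_subset D D' w : measurable D' -> D' `<=` D -> L2U D w -> L2U D' w.
Proof. by move=> mD' DD' lw i j; exact: L2_subset (lw i j). Qed.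

Lemma innerU_value D w (phi : E -> R) (a : V) : L2U D w -> L2 D phi ->
  innerU D w (fun x => phi x *: a) =
  inner D (\sum_ij entry a ij.1 ij.2 *: component w ij) phi.
Proof.
move=> lw lphi; have si := @L2_semi_inner R d D.
have cE ij : component (fun x => phi x *: a) ij = entry a ij.1 ij.2 *: phi.
  apply/funext => x; rewrite /component -[phi x *: a]addr0 entry_lin.
  by rewrite {2}/entry linear0 mxE addr0 mulrC.
have lc ij : L2 D (component w ij) by exact: L2_component.
rewrite innerUE//; last by apply/L2U_component => ij;
  rewrite cE; apply: subspaceZ => //; exact: si_sub si.
rewrite (linear_on_sum (si_sub si) (si_lin si lphi))//; apply: eq_bigr => ij _.
by rewrite cE (linear_onZ (si_sub si) (si_linr si _)).
Qed.

Lemma L2U_fundamental D w : open D -> L2U D w ->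
  (forall psi, test_functionU D psi -> innerU D w psi = 0) ->
  seminorm (innerU D) w = 0.
Proof.
move=> oD lw H; have si := @L2_semi_inner R d D.
have lc ij : L2 D (component w ij) by exact: L2_component.
pose wa (a : V) := \sum_ij entry a ij.1 ij.2 *: component w ij.
have lwa a : L2 D (wa a) by apply: subspace_sum => //; exact: si_sub si.
have wa0 a : seminorm (inner D) (wa a) = 0.
  apply: L2_fundamental => // phi tphi; rewrite -innerU_value//; last exact: test_L2.
  apply: H => i j; rewrite (_ : (fun x => _) = entry a i j *: phi).
    exact: test_functionZ.
  apply/funext => x; rewrite -[phi x *: a]addr0 entry_lin.
  by rewrite {2}/entry linear0 mxE addr0 mulrC.
rewrite /seminorm innerUE// [X in Num.sqrt X](_ : _ =
    \sum_ij inner D (wa (unit_value ij)) (component w ij)).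
  rewrite big1 ?sqrtr0// => ij _; by apply: (seminorm0_ip si).
have wE ij : component w ij = \sum_kl entry (unit_value kl) ij.1 ij.2 *: component w kl.
  apply/funext => x; rewrite fct_sum_scale /component {1}[w x]value_sum entry_sum.
  by apply: eq_bigr => kl _; rewrite mulrC.
transitivity (\sum_ij \sum_kl entry (unit_value kl) ij.1 ij.2 *
    inner D (component w kl) (component w ij)).
  apply: eq_bigr => ij _; rewrite {1}wE.
  by rewrite (linear_on_sum (si_sub si) (si_lin si (lc ij))).
rewrite exchange_big /=; apply: eq_bigr => kl _.
rewrite (linear_on_sum (si_sub si) (si_lin si (lc kl)))//.
by apply: eq_bigr => ij _; rewrite (si_sym si).
Qed.

Lemma L2U_null_ae D w : L2U D w -> seminorm (innerU D) w = 0 ->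
  {ae mu, forall x, D x -> w x = 0}.
Proof.
move=> lw w0.
have c0 ij : {ae mu, forall x, D x -> component w ij x = 0}.
  apply: L2_null_ae; first exact: L2_component.
  apply/eqP; rewrite eq_le seminorm_ge0 andbT -w0; exact: component_le.
have : {ae mu, forall x, forall ij, D x -> component w ij x = 0}.
  exact: filter_forall c0.
apply: filterS => x H Dx; rewrite [w x]value_sum big1// => ij _.
by rewrite -[entry _ _ _]/(component w ij x) H// scale0r.
Qed.

Lemma L2U_ae_null D w : L2U D w -> {ae mu, forall x, D x -> w x = 0} ->
  seminorm (innerU D) w = 0.
Proof.
move=> lw w0; rewrite /seminorm innerUE// big1 ?sqrtr0// => ij _.
have lc : L2 D (component w ij) by exact: L2_component.
apply: (seminorm0_ip (L2_semi_inner D)) => //; apply: L2_ae_null => //.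
by apply: filterS w0 => x H Dx; rewrite /component H// /entry linear0 mxE.
Qed.

End L2U_domain.

(** * Distributional operators *)

Section operators_theory.
Context {R : realType} {d : nat} {k : value_kind}.
Variable A : diffop R d k.
Local Notation E := 'rV[R]_d.
Local Notation mu := (@lebesgueN R d).
Local Notation V := (U R d k).
Local Notation L2U := (@L2U R d k).
Local Notation innerU := (@innerU R d k).
Implicit Types (D : set E) (w z psi : E -> V) (phi v : E -> R).

Let siX D := @L2_semi_inner R d D.
Let siU D := @L2U_semi_inner R d k D.

Lemma test_component D psi ij : test_functionU D psi ->
  test_function D (component psi ij).
Proof. by move=> H; exact: H. Qed.

Lemma test_L2U D psi : test_functionU D psi -> L2U D psi.
Proof. by move=> H i j; exact: test_L2 (H i j). Qed.

Lemma multi_partial_test D alpha phi : test_function D phi ->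
  test_function D (multi_partial alpha phi).
Proof. by move=> tphi; rewrite multi_partialE; exact: test_function_foldr. Qed.

Lemma test_combination D (I : finType) (c : I -> R) (F : I -> E -> R) :
  (forall i, test_function D (F i)) -> test_function D (\sum_i c i *: F i).
Proof. by move=> tF; apply: test_function_sum => i; exact: test_functionZ. Qed.

Definition dot_coef psi (alpha : {ffun 'I_d -> 'I_(maxdeg A).+1}) : E -> R :=
  \sum_ij entry (coef alpha) ij.1 ij.2 *: component psi ij.

Lemma apply_adjE psi : apply_adj A psi =
  \sum_(alpha : {ffun 'I_d -> 'I_(maxdeg A).+1})
    (-1) ^+ (\sum_i alpha i)%N *: multi_partial (fun i => alpha i) (dot_coef psi alpha).
Proof.
apply/funext => x; rewrite fct_sum_scale; apply: eq_bigr => alpha _.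
congr (_ * multi_partial _ _ _); apply/funext => y.
by rewrite /dot_coef fct_sum_scale dotUE.
Qed.

Lemma component_apply_op phi ij : component (apply_op A phi) ij =
  \sum_(alpha : {ffun 'I_d -> 'I_(maxdeg A).+1})
    entry (coef alpha) ij.1 ij.2 *: multi_partial (fun i => alpha i) phi.
Proof.
apply/funext => x; rewrite fct_sum_scale /component /apply_op entry_sum.
by apply: eq_bigr => alpha _; rewrite mulrC.
Qed.

Lemma dot_coef_test D psi alpha : test_functionU D psi ->
  test_function D (dot_coef psi alpha).
Proof. by move=> tpsi; apply: test_combination => ij; exact: test_component. Qed.

Lemma apply_adj_test D psi : test_functionU D psi ->
  test_function D (apply_adj A psi).
Proof.
move=> tpsi; rewrite apply_adjE; apply: test_combination => alpha.
by apply: multi_partial_test; exact: dot_coef_test.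
Qed.

Lemma apply_op_test D phi : test_function D phi -> test_functionU D (apply_op A phi).
Proof.
move=> tphi i j; rewrite -[X in test_function _ X]/(component (apply_op A phi) (i, j)).
by rewrite component_apply_op; apply: test_combination => alpha; exact: multi_partial_test.
Qed.

Lemma is_adj_test D psi : test_functionU D psi -> is_adj A D psi (apply_adj A psi).
Proof.
move=> tpsi phi tphi; have lphi := test_L2 tphi; have lpsi := test_L2U tpsi.
have HL := si_sub (siX D).
have lp alpha := test_L2 (multi_partial_test alpha tphi).
have lc ij := test_L2 (test_component ij tpsi).
have ldp (alpha : {ffun 'I_d -> 'I_(maxdeg A).+1}) :=
  test_L2 (multi_partial_test (fun i => alpha i) (dot_coef_test alpha tpsi)).
rewrite apply_adjE (linear_on_sum HL (si_lin (siX D) lphi))//.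
rewrite innerUE//; last exact: test_L2U (apply_op_test tphi).
under [RHS]eq_bigr => ij _ do
  rewrite component_apply_op (linear_on_sum HL (si_linr (siX D) (lc ij)))//.
rewrite exchange_big /=; apply: eq_bigr => alpha _.
rewrite -(linear_on_sum HL (si_lin (siX D) (lp (fun i => alpha i))))//.
have tdp := dot_coef_test alpha tpsi.
rewrite -/(dot_coef psi alpha) !innerE (test_function_restrict tphi).
rewrite (test_function_restrict (multi_partial_test _ tdp)).
rewrite (test_function_restrict tdp) (test_function_restrict (multi_partial_test _ tphi)).
by rewrite (integration_by_parts _ tdp tphi).
Qed.

Lemma is_op_lin D c v v' g g' : L2 D v -> L2 D v' -> L2U D g -> L2U D g' ->
  is_op A D v g -> is_op A D v' g' -> is_op A D (c *: v + v') (c *: g + g').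
Proof.
move=> lv lv' lg lg' vg vg' psi tpsi.
rewrite (si_lin (siU D) (test_L2U tpsi))// vg// vg'//.
by rewrite (si_lin (siX D) (test_L2 (apply_adj_test tpsi))).
Qed.

Lemma is_adj_lin D c w w' h h' : L2U D w -> L2U D w' -> L2 D h -> L2 D h' ->
  is_adj A D w h -> is_adj A D w' h' -> is_adj A D (c *: w + w') (c *: h + h').
Proof.
move=> lw lw' lh lh' wh wh' phi tphi.
rewrite (si_lin (siX D) (test_L2 tphi))// wh// wh'//.
by rewrite (si_lin (siU D) (test_L2U (apply_op_test tphi))).
Qed.

Lemma is_op_unique D v g g' : open D -> L2U D g -> L2U D g' ->
  is_op A D v g -> is_op A D v g' -> seminorm (innerU D) (g - g') = 0.
Proof.
move=> oD lg lg' vg vg'; have HL := si_sub (siU D).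
apply: L2U_fundamental => //; first exact: (subspaceB HL).
move=> psi tpsi; rewrite (linear_onB (si_lin (siU D) (test_L2U tpsi)))//.
by rewrite vg// vg'// subrr.
Qed.

Lemma is_adj_unique D w h h' : open D -> L2 D h -> L2 D h' ->
  is_adj A D w h -> is_adj A D w h' -> seminorm (inner D) (h - h') = 0.
Proof.
move=> oD lh lh' wh wh'; have HL := si_sub (siX D).
apply: L2_fundamental => //; first exact: (subspaceB HL).
move=> phi tphi; rewrite (linear_onB (si_lin (siX D) (test_L2 tphi)))//.
by rewrite wh// wh'// subrr.
Qed.

Lemma dop_spec D v : H_op A D v -> L2U D (dop A D v) /\ is_op A D v (dop A D v).
Proof.
by move=> [_ [g lg vg]]; exact: (@xgetPex _ 0 [set g | L2U D g /\ is_op A D v g]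
  (ex_intro _ g (conj lg vg))).
Qed.

Lemma dadj_spec D w : (exists2 h, L2 D h & is_adj A D w h) ->
  L2 D (dadj A D w) /\ is_adj A D w (dadj A D w).
Proof.
by move=> [h lh wh]; exact: (@xgetPex _ 0 [set h | L2 D h /\ is_adj A D w h]
  (ex_intro _ h (conj lh wh))).
Qed.

Lemma null_diff_ip (W : lmodType R) (H : set W) ip (si : semi_inner H ip) a b c :
  H a -> H b -> H c -> seminorm ip (a - b) = 0 -> ip c a = ip c b.
Proof.
move=> Ha Hb Hc ab; apply/eqP; rewrite -subr_eq0 -(linear_onB (si_linr si Hc))//.
rewrite (si_sym si)//; last exact: (subspaceB (si_sub si)).
by rewrite (seminorm0_ip si)//; exact: (subspaceB (si_sub si)).
Qed.

Lemma inner_dadj D w h u : open D -> L2U D w -> L2 D h -> is_adj A D w h -> L2 D u ->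
  inner D u (dadj A D w) = inner D u h.
Proof.
move=> oD lw lh wh lu; have [|ld wd] := @dadj_spec D w; first by exists h.
by apply: (null_diff_ip (siX D)) => //; exact: is_adj_unique wd wh.
Qed.

Lemma innerU_dop D v g z : open D -> L2 D v -> L2U D g -> is_op A D v g -> L2U D z ->
  innerU D z (dop A D v) = innerU D z g.
Proof.
move=> oD lv lg vg lz; have [|ld vd] := @dop_spec D v; first by split => //; exists g.
by apply: (null_diff_ip (siU D)) => //; exact: is_op_unique vd vg.
Qed.

Lemma H_op_subspace D : linear_subspace (H_op A D).
Proof.
have sX := si_sub (siX D); have sU := si_sub (siU D); split.
  split; first exact: subspace0.
  exists 0 => [|psi tpsi]; first exact: (subspace0 sU).
  rewrite (linear_on0 sU (si_lin (siU D) (test_L2U tpsi))).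
  by rewrite (linear_on0 sX (si_lin (siX D) (test_L2 (apply_adj_test tpsi)))).
move=> c u v [lu [gu lgu ugu]] [lv [gv lgv vgv]]; split; first by case: sX => _; exact.
by exists (c *: gu + gv); [case: sU => _; exact|exact: is_op_lin].
Qed.

Lemma H_adj_subspace D : linear_subspace (H_adj A D).
Proof.
have sX := si_sub (siX D); have sU := si_sub (siU D); split.
  split; first exact: (subspace0 sU).
  exists 0 => [|phi tphi]; first exact: (subspace0 sX).
  rewrite (linear_on0 sX (si_lin (siX D) (test_L2 tphi))).
  by rewrite (linear_on0 sU (si_lin (siU D) (test_L2U (apply_op_test tphi)))).
move=> c u v [lu [gu lgu ugu]] [lv [gv lgv vgv]]; split; first by case: sU => _; exact.
by exists (c *: gu + gv); [case: sX => _; exact|exact: is_adj_lin].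
Qed.

Lemma innerU_dop_lin D z : open D -> L2U D z ->
  linear_on (H_op A D) (fun v => innerU D z (dop A D v)).
Proof.
move=> oD lz c u v Hu Hv; have [lu uu] := dop_spec Hu; have [lv vv] := dop_spec Hv.
have [lu' _] := Hu; have [lv' _] := Hv.
have sX := si_sub (siX D); have sU := si_sub (siU D).
rewrite (innerU_dop (g := c *: dop A D u + dop A D v))//.
- by rewrite (si_linr (siU D)).
- by case: sX => _; exact.
- by case: sU => _; exact.
- exact: is_op_lin.
Qed.

Lemma inner_dadj_lin D u : open D -> L2 D u ->
  linear_on (H_adj A D) (fun w => inner D u (dadj A D w)).
Proof.
move=> oD lu c w w' Hw Hw'.
have [lw wE] := Hw; have [lw' wE'] := Hw'.
have [ld ww] := dadj_spec wE; have [ld' ww'] := dadj_spec wE'.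
have sX := si_sub (siX D); have sU := si_sub (siU D).
rewrite (inner_dadj (h := c *: dadj A D w + dadj A D w'))//.
- by rewrite (si_linr (siX D)).
- by case: sU => _; exact.
- by case: sX => _; exact.
- exact: is_adj_lin.
Qed.

Lemma test_function_subset D D' phi : D' `<=` D -> test_function D' phi ->
  test_function D phi.
Proof. by move=> DD' [sp cp pD]; split => //; exact: subset_trans pD DD'. Qed.

Lemma inner_supp D D' u phi : D' `<=` D -> test_function D' phi ->
  inner D u phi = inner D' u phi.
Proof.
move=> DD' tphi; rewrite !innerE (test_function_restrict tphi).
rewrite (test_function_restrict (test_function_subset DD' tphi)).
apply: eq_Rintegral => x _; rewrite !patchE; case: ifP => xD; case: ifP => xD' //.
  have -> : phi x = 0; last by rewrite !mulr0.
  by rewrite -(test_function_restrict tphi) patchE xD'.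
by move: xD; rewrite mem_set//; apply: DD'; move: xD'; rewrite inE.
Qed.

Lemma innerU_supp D D' w psi : measurable D' -> D' `<=` D -> L2U D w ->
  test_functionU D' psi -> innerU D w psi = innerU D' w psi.
Proof.
move=> mD' DD' lw tpsi; rewrite !innerUE//; first last.
- by apply: test_L2U => i j; exact: test_function_subset (tpsi i j).
- exact: test_L2U.
- exact: L2U_subset lw.
by apply: eq_bigr => ij _; apply: inner_supp => //; exact: test_component.
Qed.

Lemma is_adj_subset D D' w h : measurable D' -> D' `<=` D -> L2U D w ->
  is_adj A D w h -> is_adj A D' w h.
Proof.
move=> mD' DD' lw wh phi tphi.
rewrite -(inner_supp _ DD' tphi) wh; last exact: test_function_subset tphi.
by rewrite (innerU_supp _ DD')//; exact: apply_op_test.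
Qed.

Lemma is_adj_ae D w w' h : L2U D w -> L2U D w' -> seminorm (innerU D) (w - w') = 0 ->
  is_adj A D w h -> is_adj A D w' h.
Proof.
move=> lw lw' ww' wh phi tphi; rewrite wh//.
have lp := test_L2U (apply_op_test tphi).
by rewrite !(si_sym (siU D) _ lp)//; exact: (null_diff_ip (siU D)).
Qed.

Lemma H_adj_test D psi : test_functionU D psi -> H_adj A D psi.
Proof.
move=> tpsi; split; first exact: test_L2U.
exists (apply_adj A psi); first exact: test_L2 (apply_adj_test tpsi).
exact: is_adj_test.
Qed.

End operators_theory.

(** * Broken spaces and traces *)

Lemma linear_sub (R : comPzRingType) (c a b p q : R) :
  c * a + b - (c * p + q) = c * (a - p) + (b - q).
Proof. by rewrite mulrBr opprD addrACA. Qed.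

Lemma semi_inner_sub (R : realType) (V : lmodType R) (H H' : set V) ip :
  semi_inner H ip -> H' `<=` H -> linear_subspace H' -> semi_inner H' ip.
Proof.
move=> si HH HL; split => //.
- by move=> u v /HH Hu /HH Hv; exact: (si_sym si).
- by move=> w /HH Hw c u v /HH Hu /HH Hv; exact: (si_lin si).
- by move=> u /HH; exact: (si_ge0 si).
Qed.

Lemma si_complete_closed (R : realType) (V : lmodType R) (H H' : set V) ip (norm : V -> R) :
  semi_inner H ip -> (forall v, H v -> norm v = seminorm ip v) ->
  si_complete H ip -> closed_subspace H norm H' -> si_complete H' ip.
Proof.
move=> si normE Hc [HL HH Hcl] u Hu cu.
have [l Hl ul] := Hc u (fun n => HH _ (Hu n)) cu; exists l => //.
apply: Hcl => // e e0.
have [n _ Hn] : \forall n \near \oo, seminorm ip (u n - l) < e.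
  move/cvgrPdist_lt : ul => /(_ _ e0); apply: filterS => n.
  by rewrite sub0r normrN ger0_norm// seminorm_ge0.
have := Hn n (leqnn n) => /= une; exists (u n) => //.
have Hun := HH _ (Hu n); rewrite normE; last exact: (subspaceB (si_sub si)).
by rewrite (seminormC si).
Qed.

Section broken_space.
Context {R : realType} {d : nat} {k : value_kind}.
Variable A : diffop R d k.
Local Notation E := 'rV[R]_d.
Local Notation mu := (@lebesgueN R d).
Local Notation V := (U R d k).
Local Notation L2U := (@L2U R d k).
Local Notation innerU := (@innerU R d k).
Variables (Omega : set E) (N : nat) (T : 'I_N -> set E).
Hypotheses (oO : open Omega) (HT : mesh_of Omega T).
Implicit Types (w z psi : E -> V) (u v phi : E -> R).

Let siX D := @L2_semi_inner R d D.
Let siU D := @L2U_semi_inner R d k D.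
Let sX := si_sub (siX Omega).
Let sU := si_sub (siU Omega).

Let oT i : open (T i). Proof. exact: mesh_open HT i. Qed.
Let mT i : measurable (T i). Proof. exact: open_measurableN. Qed.
Let mO : measurable Omega. Proof. exact: open_measurableN. Qed.
Let TO i : T i `<=` Omega. Proof. by case: HT => H _ _; have [] := H i. Qed.
Let Tdisj i j x : T i x -> T j x -> i = j.
Proof.
case: HT => _ H _ Tix Tjx; apply/eqP/negP => /negP ij.
by have := H i j ij => /seteqP[/(_ x) + _]; apply.
Qed.

Local Notation DB := (dadj_broken A T).
Local Notation Hb := (H_adj_broken A Omega T).

Lemma inner_restrict_mesh u v i : inner Omega u (v \_ (T i)) = inner (T i) u v.
Proof.
rewrite !innerE; apply: eq_Rintegral => x _; rewrite !patchE.
case: ifP => xO; case: ifP => xT //; rewrite ?mulr0 ?mul0r//.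
by move: xO; rewrite mem_set//; apply: (@TO i); move: xT; rewrite inE.
Qed.

Lemma L2_restrict_mesh v i : L2 (T i) v -> L2 Omega (v \_ (T i)).
Proof.
congr (l2 _ _); apply/funext => x; rewrite !patchE; case: ifP => xT; case: ifP => //.
by rewrite mem_set//; apply: (@TO i); move: xT; rewrite inE.
Qed.

Lemma inner_sum_mesh u v : L2 Omega u -> L2 Omega v ->
  \sum_i inner (T i) u v = inner Omega u v.
Proof.
move=> lu lv; have lvT i := L2_subset (mT i) (@TO i) lv.
have lvR i := L2_restrict_mesh (lvT i).
transitivity (inner Omega u (\sum_i 1 *: (v \_ (T i)))).
  rewrite (linear_on_sum sX (si_linr (siX Omega) lu))//; apply: eq_bigr => i _.
  by rewrite inner_restrict_mesh mul1r.
have ls : L2 Omega (\sum_i 1 *: (v \_ (T i))) by exact: subspace_sum.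
apply: (null_diff_ip (siX Omega)) => //; apply: L2_ae_null; first exact: (subspaceB sX).
have := mesh_null HT; apply: negligibleS => x /= /not_implyP[Ox nx]; split => //.
move=> [i _ Tix]; apply: nx.
rewrite -[LHS]/((\sum_i 1 *: (v \_ (T i))) x - v x) fct_sum_scale (bigD1 i)//= big1.
  by rewrite mul1r addr0 patchE mem_set// subrr.
move=> j ji; rewrite patchE memNset ?mulr0// => Tjx.
by move/eqP : ji; apply; exact: Tdisj Tjx Tix.
Qed.

Lemma broken_local w : Hb w -> forall i, H_adj A (T i) w.
Proof. by move=> [lw H] i; split; [exact: L2U_subset lw|exact: H]. Qed.

Lemma dadj_brokenE w : DB w = \sum_i 1 *: (dadj A (T i) w \_ (T i)).
Proof.
apply/funext => x; rewrite fct_sum_scale /dadj_broken.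
by apply: eq_bigr => i _; rewrite mul1r.
Qed.

Lemma dadj_broken_on w i x : T i x -> DB w x = dadj A (T i) w x.
Proof.
move=> Tix; rewrite /dadj_broken (bigD1 i)//= big1 ?addr0; first by rewrite patchE mem_set.
move=> j ji; rewrite patchE memNset// => Tjx.
by move/eqP : ji; apply; exact: Tdisj Tjx Tix.
Qed.

Lemma dadj_broken_L2 w : Hb w -> L2 Omega (DB w).
Proof.
move=> /broken_local Hw; rewrite dadj_brokenE; apply: subspace_sum => // i.
by apply: L2_restrict_mesh; have [_ /dadj_spec[]] := Hw i.
Qed.

Lemma inner_dadj_broken w v : Hb w -> L2 Omega v ->
  inner Omega v (DB w) = inner_broken A T v w.
Proof.
move=> Hw lv; rewrite dadj_brokenE (linear_on_sum sX (si_linr (siX Omega) lv)).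
  by apply: eq_bigr => i _; rewrite mul1r inner_restrict_mesh.
by move=> i; apply: L2_restrict_mesh; have [_ /dadj_spec[]] := broken_local Hw i.
Qed.

Lemma norm_adj_brokenE w : Hb w ->
  norm_adj_broken A Omega T w = seminorm (graph_form (innerU Omega) (inner Omega) DB) w.
Proof.
move=> Hw; congr (Num.sqrt (_ + _)).
rewrite (inner_dadj_broken Hw (dadj_broken_L2 Hw)); apply: eq_bigr => i _.
rewrite !innerE; apply: eq_Rintegral => x _; rewrite !patchE; case: ifP => // xT.
by rewrite (@dadj_broken_on w i)//; move: xT; rewrite inE.
Qed.

Lemma broken_subspace : linear_subspace Hb.
Proof.
split.
  split; first exact: (subspace0 sU).
  by move=> i; have [_] := subspace0 (H_adj_subspace A (T i)).
move=> c w z Hw Hz; have [lw _] := Hw; have [lz _] := Hz.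
split; first by case: sU => _; exact.
move=> i; have [_ /(_ c _ _ (broken_local Hw i) (broken_local Hz i))[]] :=
  H_adj_subspace A (T i).
by [].
Qed.

Lemma dadj_broken_lin v : L2 Omega v -> linear_on Hb (fun w => inner Omega v (DB w)).
Proof.
move=> lv c w z Hw Hz; have Hwz : Hb (c *: w + z) by case: broken_subspace => _; exact.
rewrite !inner_dadj_broken// /inner_broken mulr_sumr -big_split /=.
apply: eq_bigr => i _; rewrite inner_dadj_lin//.
- exact: L2_subset lv.
- exact: broken_local.
- exact: broken_local.
Qed.

Local Notation gip := (graph_form (innerU Omega) (inner Omega) DB).

Let siUb := semi_inner_sub (siU Omega) (fun w (Hw : Hb w) => proj1 Hw) broken_subspace.

Lemma graph_broken_semi_inner : semi_inner Hb gip.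
Proof. exact: graph_semi_inner siUb (siX Omega) dadj_broken_L2 dadj_broken_lin. Qed.

Let siG := graph_broken_semi_inner.

Lemma dadj_brokenB w z : Hb w -> Hb z ->
  seminorm (inner Omega) (DB (w - z) - (DB w - DB z)) = 0.
Proof.
move=> Hw Hz; have Hwz := subspaceB broken_subspace Hw Hz.
have lw := dadj_broken_L2 Hw; have lz := dadj_broken_L2 Hz; have lwz := dadj_broken_L2 Hwz.
set g := _ - _; have lg : L2 Omega g by apply: (subspaceB sX) => //; exact: (subspaceB sX).
rewrite /seminorm (_ : inner Omega g g = 0) ?sqrtr0//.
rewrite {2}/g (linear_onB (si_linr (siX Omega) lg))//; last exact: (subspaceB sX).
rewrite (linear_onB (dadj_broken_lin lg))//.
by rewrite (linear_onB (si_linr (siX Omega) lg))// subrr.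
Qed.

Lemma seminorm_null_eq (W : lmodType R) (H : set W) ip (si : semi_inner H ip) a b :
  H a -> H b -> seminorm ip (a - b) = 0 -> seminorm ip a = seminorm ip b.
Proof.
move=> Ha Hb ab; congr Num.sqrt.
rewrite (null_diff_ip si Ha Hb Ha ab) (si_sym si)//.
exact: (null_diff_ip si Ha Hb Hb ab).
Qed.

Lemma dadj_broken_unique w h : Hb w -> L2 Omega h ->
  (forall i, is_adj A (T i) w h) -> seminorm (inner Omega) (DB w - h) = 0.
Proof.
move=> Hw lh wh; have lw := dadj_broken_L2 Hw.
have lg : L2 Omega (DB w - h) by exact: (subspaceB sX).
rewrite /seminorm (linear_onB (si_linr (siX Omega) lg))//.
rewrite inner_dadj_broken// -(inner_sum_mesh lg lh) -sumrB big1 ?sqrtr0// => i _.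
rewrite (inner_dadj (h := h)) ?subrr//.
- by have [lU _] := Hw; exact: L2U_subset lU.
- exact: L2_subset lh.
- exact: L2_subset lg.
Qed.

Lemma dadj_broken_conforming w h : H_adj A Omega w -> L2 Omega h ->
  is_adj A Omega w h -> Hb w /\ seminorm (inner Omega) (DB w - h) = 0.
Proof.
move=> [lw [g lg wg]] lh wh.
have Hw : Hb w.
  split => // i; exists g; first exact: L2_subset lg.
  exact: is_adj_subset wg.
split => //; apply: dadj_broken_unique => // i; exact: is_adj_subset wh.
Qed.

Lemma inner_dadj_conforming w v : H_adj A Omega w -> L2 Omega v ->
  inner Omega v (dadj A Omega w) = inner Omega v (DB w).
Proof.
move=> Hw lv; have [_ wE] := Hw; have [ld wd] := dadj_spec wE.
have [Hbw null] := dadj_broken_conforming Hw ld wd.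
apply/esym; apply: (null_diff_ip (siX Omega)) => //; exact: dadj_broken_L2.
Qed.

Lemma broken_complete : si_complete Hb gip.
Proof.
move=> w Hw cw.
have lDw n := dadj_broken_L2 (Hw n).
have lw n : L2U Omega (w n) by have [] := Hw n.
have dw n := subspaceB broken_subspace (Hw n.+1) (Hw n).
have [n|l ll cl] := L2U_complete mO lw.
  by apply: le_trans (cw n); exact: (graph_ge_base (innerU Omega) (siX Omega) dadj_broken_L2 (dw n)).
have [n|h lh ch] := L2_complete mO lDw.
  apply: le_trans (cw n); apply: le_trans (graph_ge_image (inner Omega) DB siUb (dw n)).
  rewrite -(seminorm_null_eq (siX Omega) _ _ (dadj_brokenB (Hw n.+1) (Hw n)))//.
  - exact: dadj_broken_L2.
  - exact: (subspaceB sX).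
have lT i : is_adj A (T i) l h.
  move=> phi tphi; have tp := apply_op_test A tphi.
  have tphiO := test_function_subset (@TO i) tphi.
  have tpO : test_functionU Omega (apply_op A phi).
    by move=> a b; exact: test_function_subset (tp a b).
  rewrite -(inner_supp _ (@TO i) tphi) -(innerU_supp (mT i) (@TO i) ll tp).
  have c1 := si_cvg_ip (siX Omega) lDw lh (test_L2 tphiO) ch.
  have c2 := si_cvg_ip (siU Omega) lw ll (test_L2U tpO) cl.
  have E n : inner Omega (DB (w n)) phi = innerU Omega (w n) (apply_op A phi).
    rewrite (inner_supp _ (@TO i) tphi) (innerU_supp (mT i) (@TO i) (lw n) tp).
    have [_ /dadj_spec[ld wd]] := broken_local (Hw n) i.
    rewrite -wd// !innerE; apply: eq_Rintegral => x _; rewrite !patchE; case: ifP => // xT.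
    by rewrite (@dadj_broken_on (w n) i)//; move: xT; rewrite inE.
  move: c1; rewrite (_ : (fun n => _) = fun n => innerU Omega (w n) (apply_op A phi)).
    by move=> c1; rewrite -(cvg_lim _ c1)// (cvg_lim _ c2).
  by apply/funext => n; exact: E.
have Hl : Hb l by split => // i; exists h => //; exact: L2_subset lh.
have lDl := dadj_broken_L2 Hl.
exists l => //.
apply: (@squeeze_cvgr _ _ _ _ (cst 0) (fun n => seminorm (innerU Omega) (w n - l) +
  seminorm (inner Omega) (DB (w n) - h))).
- near=> n; rewrite seminorm_ge0 /=.
  have Hwl := subspaceB broken_subspace (Hw n) Hl.
  apply: (le_trans (graph_le siUb (siX Omega) dadj_broken_L2 dadj_broken_lin Hwl)).
  rewrite lerD2l.
  have lwl := subspaceB sX (lDw n) lDl.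
  rewrite (seminorm_null_eq (siX Omega) (dadj_broken_L2 Hwl) lwl (dadj_brokenB (Hw n) Hl)).
  apply: (le_trans (seminorm_dist (siX Omega) (lDw n) lh lDl)).
  rewrite (seminormC (siX Omega) lh lDl).
  by rewrite (dadj_broken_unique Hl lh lT) addr0.
- exact: cvg_cst.
- by rewrite -[X in _ --> X]addr0; exact: cvgD.
Unshelve. all: by end_near. Qed.

Section trace_space.
Variable Ht : set (E -> V).
Implicit Types eta : (E -> V) -> R.
Hypothesis Ht_closed : closed_subspace Hb (norm_adj_broken A Omega T) Ht.
Hypothesis H_adj_sub : H_adj A Omega `<=` Ht.

Let HtL : linear_subspace Ht. Proof. by case: Ht_closed. Qed.
Let HtHb : Ht `<=` Hb. Proof. by case: Ht_closed. Qed.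

Lemma graph_Ht_semi_inner : semi_inner Ht gip.
Proof. exact: semi_inner_sub siG HtHb HtL. Qed.

Lemma graph_Ht_complete : si_complete Ht gip.
Proof. exact: si_complete_closed siG norm_adj_brokenE broken_complete Ht_closed. Qed.

Local Notation tr := (trace_skel A Omega T Ht).

Lemma trace_skelE v w : H_op A Omega v -> Ht w ->
  tr v w = innerU Omega (dop A Omega v) w - inner Omega v (DB w).
Proof.
move=> [lv _] Hw; rewrite /trace_skel patchE mem_set//.
by rewrite inner_dadj_broken//; exact: HtHb.
Qed.

Lemma trace_skel_out v w : ~ Ht w -> tr v w = 0.
Proof. by move=> Hw; rewrite /trace_skel patchE memNset. Qed.

Lemma trace_skel_lin c u v : H_op A Omega u -> H_op A Omega v ->
  tr (c *: u + v) = c *: tr u + tr v.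
Proof.
move=> Hu Hv; apply/funext => w; rewrite -[RHS]/(c * tr u w + tr v w).
have Huv : H_op A Omega (c *: u + v) by case: (H_op_subspace A Omega) => _; exact.
have [Hw|Hw] := pselect (Ht w); last by rewrite !trace_skel_out// mulr0 addr0.
have [lu _] := Hu; have [lv _] := Hv.
have [lw _] := HtHb Hw; have lDw := dadj_broken_L2 (HtHb Hw).
have ld x : H_op A Omega x -> L2U Omega (dop A Omega x) by move=> /dop_spec[].
have symE x : H_op A Omega x ->
    innerU Omega (dop A Omega x) w = innerU Omega w (dop A Omega x).
  by move=> Hx; exact: (si_sym (siU Omega) (ld _ Hx) lw).
have E1 := etrans (symE _ Huv) (innerU_dop_lin oO lw c Hu Hv).
have E2 := si_lin (siX Omega) lDw c lu lv.
rewrite (trace_skelE Huv Hw) (trace_skelE Hu Hw) (trace_skelE Hv Hw).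
rewrite (symE _ Hu) (symE _ Hv).
exact: etrans (congr2 (fun a b => a - b) E1 E2) (linear_sub _ _ _ _ _).
Qed.

Lemma trace_bdry0P v : H_op A Omega v ->
  trace_bdry A Omega v = 0 <-> forall w, H_adj A Omega w -> tr v w = 0.
Proof.
move=> Hv; have [lv _] := Hv; split=> [t0 w Hw|t0].
  rewrite trace_skelE//; last exact: H_adj_sub.
  rewrite -inner_dadj_conforming//.
  by have := congr1 (@^~ w) t0; rewrite /trace_bdry patchE mem_set.
apply/funext => w; rewrite /trace_bdry patchE; case: ifP => // wH.
have {wH}Hw : H_adj A Omega w by move: wH; rewrite inE.
have := t0 _ Hw; rewrite trace_skelE//; last exact: H_adj_sub.
by rewrite inner_dadj_conforming.
Qed.

Lemma H_op0_subspace : linear_subspace (H_op0 A Omega).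
Proof.
have HL := H_op_subspace A Omega; split.
  split; first exact: subspace0.
  apply/trace_bdry0P => [|w Hw]; first exact: subspace0.
  have Hw' := H_adj_sub Hw; have [lw _] := Hw.
  have H0 := subspace0 HL; have [ld0 _] := dop_spec H0.
  rewrite trace_skelE// (si_sym (siU Omega) ld0 lw).
  rewrite (linear_on0 HL (innerU_dop_lin oO lw)).
  by rewrite (linear_on0 sX (si_lin (siX Omega) (dadj_broken_L2 (HtHb Hw')))) subr0.
move=> c u v [Hu u0] [Hv v0].
have Huv : H_op A Omega (c *: u + v) by case: HL => _; exact.
split => //; apply/trace_bdry0P => // w Hw.
rewrite trace_skel_lin// -[LHS]/(c * tr u w + tr v w).
by rewrite (iffLR (trace_bdry0P Hu) u0 _ Hw) (iffLR (trace_bdry0P Hv) v0 _ Hw) mulr0 addr0.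
Qed.

Local Notation S0 := (H_skel0 A Omega T Ht).

Lemma H_skel0_subspace : linear_subspace S0.
Proof.
have HL := H_op0_subspace; split.
  exists 0; first exact: subspace0.
  have [H0 _] := subspace0 HL.
  by have := @trace_skel_lin (-1) _ _ H0 H0; rewrite !scaleN1r !addNr.
move=> c _ _ [u Hu <-] [v Hv <-]; exists (c *: u + v); first by case: HL => _; exact.
by rewrite trace_skel_lin//; [case: Hu|case: Hv].
Qed.

Lemma H_skel0_conforming eta w : S0 eta -> H_adj A Omega w -> eta w = 0.
Proof. by move=> [v [Hv v0] <-] Hw; exact: (iffLR (trace_bdry0P Hv)). Qed.

Lemma H_skel0_lin eta : S0 eta -> linear_on Ht eta.
Proof.
move=> [v [Hv _] <-] c w z Hw Hz.
have Hwz : Ht (c *: w + z) by case: HtL => _; exact.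
have [ld _] := dop_spec Hv; have [lv _] := Hv.
have [lw _] := HtHb Hw; have [lz _] := HtHb Hz.
have E1 := si_linr (siU Omega) ld c lw lz.
have E2 := dadj_broken_lin lv c (HtHb Hw) (HtHb Hz).
rewrite (trace_skelE Hv Hwz) (trace_skelE Hv Hw) (trace_skelE Hv Hz).
exact: etrans (congr2 (fun a b => a - b) E1 E2) (linear_sub _ _ _ _ _).
Qed.

Lemma H_skel0_out eta w : S0 eta -> ~ Ht w -> eta w = 0.
Proof. by move=> [v _ <-]; exact: trace_skel_out. Qed.

Local Notation nskel := (norm_skel A Omega T Ht).
Local Notation nA := (seminorm gip).

Lemma trace_skel_bound v w : H_op A Omega v -> Ht w ->
  `|tr v w| <= norm_op A Omega v * nA w.
Proof.
move=> Hv Hw; have [ld _] := dop_spec Hv; have [lv _] := Hv.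
have Hbw := HtHb Hw; have [lw _] := Hbw; have lDw := dadj_broken_L2 Hbw.
rewrite trace_skelE//.
set a := seminorm (innerU Omega) (dop A Omega v); set b := seminorm (inner Omega) v.
set p := seminorm (innerU Omega) w; set q := seminorm (inner Omega) (DB w).
have a0 : 0 <= a := seminorm_ge0 _ _; have b0 : 0 <= b := seminorm_ge0 _ _.
have p0 : 0 <= p := seminorm_ge0 _ _; have q0 : 0 <= q := seminorm_ge0 _ _.
have h1 : `|innerU Omega (dop A Omega v) w| <= a * p := si_CauchySchwarz (siU Omega) ld lw.
have h2 : `|inner Omega v (DB w)| <= b * q := si_CauchySchwarz (siX Omega) lv lDw.
apply: (le_trans (ler_normB _ _)); apply: (le_trans (lerD h1 h2)).
have n1 : norm_op A Omega v ^+ 2 = b ^+ 2 + a ^+ 2.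
  rewrite /a /b (seminorm_sqr (siX Omega) lv) (seminorm_sqr (siU Omega) ld) sqr_sqrtr//.
  by rewrite addr_ge0//; [exact: (si_ge0 (siX Omega))|exact: (si_ge0 (siU Omega))].
have n2 : nA w ^+ 2 = p ^+ 2 + q ^+ 2.
  by rewrite /p /q (seminorm_sqr siG Hbw) (seminorm_sqr (siU Omega) lw)
    (seminorm_sqr (siX Omega) lDw).
have nv0 : 0 <= norm_op A Omega v by exact: sqrtr_ge0.
have nw0 := seminorm_ge0 gip w.
move: n1 n2 nv0 nw0; move: (norm_op A Omega v) (nA w) => x y.
move: a b p q a0 b0 p0 q0 {h1 h2} => a b p q a0 b0 p0 q0 n1 n2 x0 y0.
rewrite -(@ler_pXn2r _ 2)//; last 2 first.
- by rewrite nnegrE addr_ge0// mulr_ge0.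
- by rewrite nnegrE mulr_ge0.
by rewrite exprMn n1 n2; have := sqr_ge0 (a * q - b * p); rewrite !expr2; lra.
Qed.

Lemma norm_skel_ge0 eta : 0 <= nskel eta.
Proof.
rewrite /norm_skel; set S := (X in inf X); have [->|/set0P ne] := eqVneq S set0.
  by rewrite inf0.
by apply: lb_le_inf => // _ [v _ <-]; exact: sqrtr_ge0.
Qed.

Lemma norm_skel_dual eta w : S0 eta -> Ht w -> `|eta w| <= nskel eta * nA w.
Proof.
move=> [v0 [Hv0 _] pE] Hw.
have [w0|w0] := eqVneq (nA w) 0.
  by rewrite w0 mulr0 -pE; have := trace_skel_bound Hv0 Hw; rewrite w0 mulr0.
have w1 : 0 < nA w by rewrite lt_neqAle eq_sym w0 seminorm_ge0.
rewrite -ler_pdivrMr//; apply: lb_le_inf.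
  by exists (norm_op A Omega v0); exists v0.
by move=> _ [v [Hv <-] <-]; rewrite ler_pdivrMr//; exact: trace_skel_bound.
Qed.

(* The Riesz representer w0 of eta satisfies, on test fields, the weak form of
   A (A^*_T w0) = - w0, so that - A^*_T w0 extends eta and has the same norm. *)
Lemma norm_skel_le eta M : S0 eta -> 0 <= M ->
  (forall w, Ht w -> `|eta w| <= M * nA w) -> nskel eta <= M.
Proof.
move=> Sphi M0 pM.
have [w0 Hw0 w0E] := riesz_representation graph_Ht_semi_inner graph_Ht_complete
  (H_skel0_lin Sphi) pM.
have Hbw0 := HtHb Hw0; have [lw0 _] := Hbw0; have lD := dadj_broken_L2 Hbw0.
pose v : E -> R := - DB w0.
have lv : L2 Omega v by rewrite /v -scaleN1r; exact: subspaceZ.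
have innerN (z : E -> R) : L2 Omega z -> inner Omega v z = - inner Omega (DB w0) z.
  by move=> lz; rewrite /v -scaleN1r (linear_onZ sX (si_lin (siX Omega) lz))// mulN1r.
have opv : is_op A Omega v w0.
  move=> psi tpsi; have Hpsi := H_adj_test A tpsi.
  have := w0E _ (H_adj_sub Hpsi); rewrite (H_skel0_conforming Sphi Hpsi) /graph_form.
  have tadj := apply_adj_test A tpsi.
  rewrite innerN; last exact: test_L2 tadj.
  rewrite -(inner_dadj_conforming Hpsi lD).
  rewrite (inner_dadj (h := apply_adj A psi))//.
  - by move/eqP; rewrite eq_sym addr_eq0 => /eqP.
  - exact: test_L2U.
  - exact: test_L2 tadj.
  - exact: is_adj_test.
have Hv : H_op A Omega v by split => //; exists w0.
have [ldv _] := dop_spec Hv.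
have dopE z : L2U Omega z -> innerU Omega z (dop A Omega v) = innerU Omega z w0.
  by move=> lz; exact: innerU_dop.
have trv : tr v = eta.
  apply/funext => w; have [Hw|Hw] := pselect (Ht w); last first.
    by rewrite trace_skel_out// (H_skel0_out Sphi).
  have [lw _] := HtHb Hw.
  rewrite trace_skelE// w0E// (si_sym (siU Omega) ldv lw) dopE//.
  rewrite (innerN _ (dadj_broken_L2 (HtHb Hw))) opprK.
  by rewrite /graph_form (si_sym (siU Omega) lw lw0).
have nE : norm_op A Omega v = nA w0.
  congr Num.sqrt; rewrite /graph_form addrC dopE//.
  rewrite (si_sym (siU Omega) ldv lw0) dopE//; congr (_ + _).
  by rewrite innerN// (si_sym (siX Omega) lD lv) innerN// opprK.
apply: (@le_trans _ _ (nA w0)).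
  rewrite -nE; apply: ge_inf; last by exists v.
  by exists 0 => _ [u _ <-]; exact: sqrtr_ge0.
have := pM _ Hw0; rewrite w0E// -(seminorm_sqr siG)// ger0_norm ?sqr_ge0//.
have [->//|n0] := eqVneq (nA w0) 0.
have n1 : 0 < nA w0 by rewrite lt_neqAle eq_sym n0 seminorm_ge0.
by rewrite expr2 ler_pM2r.
Qed.

Lemma norm_skel_eq0 eta : S0 eta -> nskel eta = 0 -> eta = 0.
Proof.
move=> Sphi p0; apply/funext => w; have [Hw|Hw] := pselect (Ht w).
  by have := norm_skel_dual Sphi Hw; rewrite p0 mul0r normr_le0 => /eqP.
by rewrite (H_skel0_out Sphi).
Qed.

End trace_space.
End broken_space.

(** * The tensor form *)

Section off_null.
Context dd (T : measurableType dd) (R : realType) (mu : {measure set T -> \bar R}).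

Import HBNNSimple.

Local Notation nnint f := (ereal_sup [set sintegral mu h |
  h in [set h : {nnsfun T >-> R} | forall x, ((h x)%:E <= f x)%E]]).

Lemma le_nnintegral_off_null (N : set T) (f g : T -> \bar R) :
  measurable N -> mu N = 0%E -> (forall x, 0%E <= g x)%E ->
  (forall x, ~ N x -> f x <= g x)%E -> (nnint f <= nnint g)%E.
Proof.
move=> mN N0 g0 fg; apply: ge_ereal_sup => _ [h /= hf <-].
pose h' := proj_nnsfun h (measurableC mN).
apply: (@le_trans _ _ (sintegral mu h')); last first.
  apply: ereal_sup_ubound; exists h' => //= x.
  have [Nx|Nx] := pselect (N x).
    by rewrite mindicE /= memNset ?mulr0//; exact.
  by rewrite mindicE /= mem_set// mulr1; apply: le_trans (fg _ Nx).
rewrite -!integralT_nnsfun le_eqVlt; apply/orP; left; apply/eqP.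
apply: ge0_ae_eq_integral => //.
- by apply/measurable_EFinP.
- by apply/measurable_EFinP.
- by move=> x _; rewrite lee_fin.
- by move=> x _; rewrite lee_fin.
exists N; split => // x /= /not_implyP[_ hx]; apply: contrapT => Nx; apply: hx.
by rewrite mindicE /= mem_set// mulr1.
Qed.

(* No measurability is required: the generalized inverse may fail to be
   measurable on the null set where C is not invertible. *)
Lemma integral_off_null (N : set T) (f g : T -> \bar R) :
  measurable N -> mu N = 0%E -> (forall x, ~ N x -> f x = g x) ->
  (\int[mu]_x f x = \int[mu]_x g x)%E.
Proof.
move=> mN N0 fg; rewrite /integral !patch_setT.
congr (_ - _)%E; apply/eqP; rewrite eq_le; apply/andP; split;
  apply: (le_nnintegral_off_null mN N0) => x; rewrite ?funepos_ge0 ?funeneg_ge0//;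
  by move=> Nx; rewrite ?funeposE ?funenegE fg.
Qed.

End off_null.

Lemma measurable_inv (R : realType) : measurable_fun setT (@GRing.inv R).
Proof.
have -> : [set: R] = [set 0] `|` ~` [set 0] by rewrite setUv.
apply/measurable_funU => //; first exact: measurableC.
split; first exact: measurable_fun_set1.
apply: open_continuous_measurable_fun; first by apply: closed_openC; exact: closed_eq.
by move=> x; rewrite inE /= => /eqP x0; exact: inv_continuous.
Qed.

Section measurable_matrix.
Context dd (T : measurableType dd) (R : realType).

Lemma measurable_det n (M : T -> 'M[R]_n) :
  (forall i j, measurable_fun setT (fun x => M x i j)) ->
  measurable_fun setT (fun x => \det (M x)).
Proof.
move=> mM; rewrite /determinant; apply: measurable_sum => s.
apply: measurable_funM; first exact: measurable_cst.
by apply: measurable_prod => i _; exact: mM.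
Qed.

Lemma measurable_adj n (M : T -> 'M[R]_n) i j :
  (forall i j, measurable_fun setT (fun x => M x i j)) ->
  measurable_fun setT (fun x => (\adj (M x)) i j).
Proof.
move=> mM; under eq_fun do rewrite mxE /cofactor.
apply: measurable_funM; first exact: measurable_cst.
by apply: measurable_det => k l; under eq_fun do rewrite !mxE; exact: mM.
Qed.

End measurable_matrix.

Section ess_bound.
Context dd (T : measurableType dd) (R : realType) (mu : {measure set T -> \bar R}).

Lemma Lfun_infty_bound (f : T -> R) : f \in Lfun mu +oo%E ->
  measurable_fun setT f /\ exists2 M : R, 0 <= M & {ae mu, forall x, `|f x| <= M}.
Proof.
move=> fL; split; first by move: fL => /sub_Lfun_mfun; rewrite inE.
move: fL => /sub_Lfun_finLfun; rewrite inE /= /finite_norm unlock.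
have [mu0|mu0] := ltP 0%E (mu setT); last first.
  move=> _; exists 0 => //; exists setT; split => //; apply/eqP.
  by rewrite eq_le mu0 measure_ge0.
move=> /ess_supr_bounded [M] /= fM; exists `|M| => //.
by apply: filterS fM => x /= /le_trans; apply; rewrite ler_norm.
Qed.

End ess_bound.

Section pointwise.
Context {R : realType} {d : nat} {k : value_kind}.
Local Notation V := (U R d k).
Implicit Types (f : 'End(V)) (a b : V) (c M : R).

Lemma dotU_semi_inner : semi_inner setT (@dotU R d k).
Proof.
split => //.
- by move=> a b _ _; rewrite !dotUE; apply: eq_bigr => ij _; rewrite mulrC.
- move=> b _ c a a' _ _; rewrite !dotUE mulr_sumr -big_split /=.
  by apply: eq_bigr => ij _; rewrite entry_lin mulrDl mulrA.
- by move=> a _; rewrite dotUE; apply: sumr_ge0 => ij _; rewrite -expr2 sqr_ge0.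
Qed.

Local Notation nU := (seminorm (@dotU R d k)).
Let si := dotU_semi_inner.

Lemma entry_le_seminorm a i j : `|entry a i j| <= nU a.
Proof.
rewrite -(@ler_pXn2r _ 2)//; last by rewrite nnegrE seminorm_ge0.
rewrite (seminorm_sqr si)// real_normK ?num_real// dotUE (bigD1 (i, j))//= expr2 lerDl.
by apply: sumr_ge0 => ij _; rewrite -expr2 sqr_ge0.
Qed.

Lemma dotU_eq0 a : dotU a a = 0 -> a = 0.
Proof.
move=> a0; rewrite [a]value_sum big1// => ij _.
have := entry_le_seminorm a ij.1 ij.2.
by rewrite /seminorm a0 sqrtr0 normr_le0 => /eqP ->; rewrite scale0r.
Qed.

Lemma dotU_linear f b : linear_on setT (fun a => dotU (f a) b).
Proof. by move=> c u v _ _; rewrite linearP (si_lin si). Qed.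

Lemma dotU_entry_bound f M : 0 <= M ->
  (forall ij kl, `|dotU (f (unit_value ij)) (unit_value kl)| <= M) ->
  forall a, nU (f a) <= M * #|{: 'I_(nrow d k) * 'I_(ncol d k)}|%:R ^+ 2 * nU a.
Proof.
move=> M0 fM a; set n := #|_|.
have H b : dotU (f a) b <= M * n%:R ^+ 2 * nU a * nU b.
  have -> : dotU (f a) b = \sum_ij entry a ij.1 ij.2 *
      \sum_kl entry b kl.1 kl.2 * dotU (f (unit_value ij)) (unit_value kl).
    rewrite {1}[a]value_sum (linear_on_sum (si_sub si) (dotU_linear f b))//.
    apply: eq_bigr => ij _; congr (_ * _).
    by rewrite {1}[b]value_sum (linear_on_sum (si_sub si) (si_linr si _)).
  apply: le_trans (ler_norm _) _; apply: le_trans (ler_norm_sum _ _ _) _.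
  rewrite (_ : M * _ * _ * _ = \sum_(ij : 'I_(nrow d k) * 'I_(ncol d k))
      nU a * \sum_(kl : 'I_(nrow d k) * 'I_(ncol d k)) (nU b * M)); last first.
    rewrite !sumr_const -/n -(mulr_natr (nU b * M)) -(mulr_natr (nU a * _)); ring.
  apply: ler_sum => ij _; rewrite normrM ler_pM// ?entry_le_seminorm//.
  apply: le_trans (ler_norm_sum _ _ _) _; apply: ler_sum => kl _.
  by rewrite normrM ler_pM// entry_le_seminorm.
have := H (f a); rewrite -(seminorm_sqr si)// expr2.
have [->|p] := eqVneq (nU (f a)) 0.
  by move=> _; rewrite !mulr_ge0// ?seminorm_ge0// exprn_ge0.
by rewrite ler_pM2r// lt_neqAle eq_sym p seminorm_ge0.
Qed.

Section inverse.
Context f c M (c_gt0 : 0 < c) (M_gt0 : 0 < M)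
  (f_sym : forall a b, dotU (f a) b = dotU a (f b))
  (f_coer : forall a, c * dotU a a <= dotU (f a) a)
  (f_bound : forall a, nU (f a) <= M * nU a).

Lemma coercive_ker0 : lker f == 0%VS.
Proof.
apply/lker0P => a b /= fab; apply/eqP; rewrite -subr_eq0; apply/eqP/dotU_eq0.
have := f_coer (a - b); rewrite linearB /= fab subrr.
rewrite (linear_on0 (si_sub si) (si_lin si _))// pmulr_rle0// => ab.
by apply/eqP; rewrite eq_le ab (si_ge0 si).
Qed.

Let fK : cancel f^-1%VF f. Proof. exact: lker0_lfunVK coercive_ker0. Qed.

Lemma inverse_sym a b : dotU (f^-1%VF a) b = dotU a (f^-1%VF b).
Proof. by rewrite -[b in LHS]fK -[a in RHS]fK f_sym. Qed.

Lemma inverse_bound a : nU (f^-1%VF a) <= c^-1 * nU a.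
Proof.
set y := f^-1%VF a; rewrite ler_pdivlMl//.
have := f_coer y; rewrite fK -(seminorm_sqr si)// expr2 => H.
have [->|p] := eqVneq (nU y) 0; first by rewrite mulr0 seminorm_ge0.
have y0 : 0 < nU y by rewrite lt_neqAle eq_sym p seminorm_ge0.
rewrite -(ler_pM2r y0) -mulrA; apply: le_trans H _.
by apply: le_trans (ler_norm _) _; exact: (si_CauchySchwarz si).
Qed.

Lemma inverse_coercive a : c / M ^+ 2 * dotU a a <= dotU (f^-1%VF a) a.
Proof.
set y := f^-1%VF a; have fy : f y = a by exact: fK.
rewrite (si_sym si (u := y))// -{2}fy.
have := f_coer y; rewrite fy; apply: le_trans; rewrite -mulrA ler_pM2l//.
rewrite ler_pdivrMl ?exprn_gt0// -!(seminorm_sqr si)// -exprMn.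
have := f_bound y; rewrite fy => H.
by rewrite ler_pXn2r// nnegrE ?mulr_ge0 ?seminorm_ge0// ltW.
Qed.

End inverse.

End pointwise.

Section vector_coordinates.
Context {R : realType} {d : nat} {k : value_kind}.
Local Notation V := (U R d k).
Local Notation n := (\dim {: V}).

Definition basis_vector (i : 'I_n) : V := (vbasis {: V})`_i.

Definition coordinates (a : V) : 'rV[R]_n := \row_i coord (vbasis {: V}) i a.

Lemma coordinates_sum a : a = \sum_i coordinates a 0 i *: basis_vector i.
Proof.
rewrite {1}(coord_vbasis (memvf a)); apply: eq_bigr => i _; by rewrite mxE.
Qed.

Lemma coordinatesK (v : 'rV[R]_n) : coordinates (\sum_i v 0 i *: basis_vector i) = v.
Proof.
apply/rowP => j; rewrite mxE coord_sum_free//.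
exact: basis_free (vbasisP _).
Qed.

Definition gram (f : 'End(V)) : 'M[R]_n :=
  \matrix_(i, j) dotU (f (basis_vector i)) (basis_vector j).

Lemma mul_gram (f : 'End(V)) a j : (coordinates a *m gram f) 0 j = dotU (f a) (basis_vector j).
Proof.
rewrite mxE [a in RHS]coordinates_sum.
rewrite (linear_on_sum (si_sub dotU_semi_inner) (dotU_linear f _))//.
by apply: eq_bigr => i _; rewrite [gram f _ _]mxE.
Qed.

(* Cramer's rule: it shows that the inverse depends measurably on f. *)
Lemma coordinates_inverse (f : 'End(V)) (c : R) a : 0 < c ->
  (forall a, c * dotU a a <= dotU (f a) a) ->
  coordinates (f^-1%VF a) =
  (\det (gram f))^-1 *: ((\row_j dotU a (basis_vector j)) *m \adj (gram f)).
Proof.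
move=> c0 fc; have fK := lker0_lfunVK (coercive_ker0 c0 fc).
have Gu : gram f \in unitmx.
  rewrite -row_free_unit; apply/inj_row_free => v vG.
  set b := \sum_i v 0 i *: basis_vector i.
  have bG : dotU (f b) b = 0.
    rewrite {2}[b]coordinates_sum (linear_on_sum (si_sub dotU_semi_inner)
      (si_linr dotU_semi_inner _))// big1// => j _.
    by rewrite -mul_gram coordinatesK vG mxE mulr0.
  have b0 : b = 0.
    apply: dotU_eq0; apply/eqP; rewrite eq_le (si_ge0 dotU_semi_inner)// andbT.
    by have := fc b; rewrite bG pmulr_rle0.
  by rewrite -[v]coordinatesK -/b b0; apply/rowP => j; rewrite !mxE linear0.
have -> : \row_j dotU a (basis_vector j) = coordinates (f^-1%VF a) *m gram f.
  by apply/rowP => j; rewrite mul_gram fK mxE.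
rewrite -mulmxA mul_mx_adj mul_mx_scalar scalerA mulVf ?scale1r//.
by move: Gu; rewrite unitmxE unitfE.
Qed.

End vector_coordinates.

Section tensor.
Context {R : realType} {d : nat} {k : value_kind}.
Local Notation E := 'rV[R]_d.
Local Notation V := (U R d k).
Local Notation mu := (lebesgueN d).
Local Notation nU := (seminorm (@dotU R d k)).
Implicit Types (w z : E -> V) (D : set E).
Let si := @dotU_semi_inner R d k.

Lemma dotU_integrable D w z : L2U D w -> L2U D z ->
  mu.-integrable setT (EFin \o ((fun x => dotU (w x) (z x)) \_ D)).
Proof.
move=> /L2U_component lw /L2U_component lz.
rewrite (_ : _ \o _ = fun x => (\sum_ij
    ((component w ij \_ D) x * (component z ij \_ D) x)%:E)%E).
  apply: integrable_sum => // ij _.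
  exact: l2_mul_integrable (lw ij) (lz ij).
apply/funext => x; rewrite /= sumEFin patchE; congr EFin; case: ifP => xD.
  by rewrite dotUE; apply: eq_bigr => ij _; rewrite !patchE xD.
by rewrite big1// => ij _; rewrite !patchE xD mul0r.
Qed.

Lemma innerU_le D w z w' z' : L2U D w -> L2U D z -> L2U D w' -> L2U D z' ->
  (forall x, dotU (w x) (z x) <= dotU (w' x) (z' x)) ->
  innerU D w z <= innerU D w' z'.
Proof.
move=> lw lz lw' lz' H; rewrite /innerU [leLHS]Rintegral_mkcond [leRHS]Rintegral_mkcond.
apply: le_Rintegral => //; try exact: dotU_integrable.
by move=> x _; rewrite !patchE; case: ifP.
Qed.

Lemma tensor_good_set (Omega : set E) (C : E -> 'End(V)) : admissible_tensor Omega C ->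
  exists N c M, [/\ measurable N, mu N = 0%E, 0 < c :> R, 0 < M :> R &
    forall x, Omega x -> ~ N x ->
    [/\ forall a b, dotU (C x a) b = dotU a (C x b),
        forall a, c * dotU a a <= dotU (C x a) a &
        forall a, nU (C x a) <= M * nU a]].
Proof.
move=> [CL Csym [c c0 Ccoer]].
pose G ij kl x := dotU (C x (unit_value ij)) (unit_value kl).
have /choice[m mP] ijkl : exists m : R, 0 <= m /\
    {ae mu, forall x, Omega x -> `|G ijkl.1 ijkl.2 x| <= m}.
  have [_ [m m0 mb]] := Lfun_infty_bound (CL (unit_value ijkl.1) (unit_value ijkl.2)).
  exists m; split => //; apply: filterS mb => x + Ox.
  by rewrite patchE mem_set.
pose m1 := 1 + \sum_ijkl m ijkl.
have mle ijkl : m ijkl <= m1.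
  rewrite /m1 (bigD1 ijkl)//= addrCA lerDl addr_ge0// sumr_ge0// => j _.
  by have [] := mP j.
have m10 : 0 < m1 by rewrite ltr_wpDr// sumr_ge0// => j _; have [] := mP j.
have Cb : {ae mu, forall x, forall ijkl, Omega x -> `|G ijkl.1 ijkl.2 x| <= m ijkl}.
  by apply: filter_forall => ijkl; have [] := mP ijkl.
have [N [mN N0 sN]] : mu.-negligible (~` [set x | Omega x ->
    [/\ forall a b, dotU (C x a) b = dotU a (C x b),
        forall a, c * dotU a a <= dotU (C x a) a &
        forall ij kl, `|G ij kl x| <= m1]]).
  apply: filterS3 Csym Ccoer Cb => x Hs Hc Hb Ox; split; [exact: Hs|exact: Hc|].
  by move=> ij kl; apply: le_trans (Hb (ij, kl) Ox) (mle _).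
exists N, c, (m1 * #|{: 'I_(nrow d k) * 'I_(ncol d k)}|%:R ^+ 2 + 1).
split => //; first by rewrite ltr_wpDl// mulr_ge0 ?exprn_ge0// ltW.
move=> x Ox Nx; have /contrapT /(_ Ox)[Hs Hc Hb] := fun H => Nx (sN x H).
split => // a; rewrite mulrDl mul1r ler_wpDr ?seminorm_ge0//.
exact: (dotU_entry_bound (ltW m10) Hb).
Qed.

Lemma tensor_form (Omega : set E) (C : E -> 'End(V)) : measurable Omega ->
  admissible_tensor Omega C ->
  let a w z := innerU Omega (apply_inv C w) z in
  exists2 alpha : R, 0 < alpha & exists2 beta : R, 0 < beta &
  [/\ forall z, L2U Omega z -> linear_on (L2U Omega) (a ^~ z),
      forall w z, L2U Omega w -> L2U Omega z -> a w z = a z w,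
      forall w, L2U Omega w -> alpha * innerU Omega w w <= a w w &
      forall w z, L2U Omega w -> L2U Omega z ->
        `|a w z| <= beta * (seminorm (innerU Omega) w * seminorm (innerU Omega) z)].
Proof.
move=> mO HC a.
have [N [c0 [M0 [mN N0 c0_gt0 M0_gt0 good]]]] := tensor_good_set HC.
have siU := L2U_semi_inner (R := R) (d := d) (k := k) Omega.
have mON : measurable (Omega `\` N) by exact: measurableD.
pose C' x : 'End(V) := if x \in Omega `\` N then C x else \1%VF.
pose c := Num.min c0 1; pose M := Num.max M0 1.
have c_gt0 : 0 < c by rewrite lt_min c0_gt0 ltr01.
have M_gt0 : 0 < M by rewrite lt_max ltr01 orbT.
have C'sym x b e : dotU (C' x b) e = dotU b (C' x e).
  rewrite /C'; case: ifPn => [/set_mem[Ox Nx]|_]; last by rewrite !id_lfunE.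
  by have [->] := good x Ox Nx.
have C'coer x b : c * dotU b b <= dotU (C' x b) b.
  have b0 : 0 <= dotU b b by exact: (si_ge0 si).
  rewrite /C'; case: ifPn => [/set_mem[Ox Nx]|_]; last first.
    by rewrite id_lfunE ler_piMl// ge_min lexx orbT.
  have [_ /(_ b) + _] := good x Ox Nx; apply: le_trans.
  by rewrite ler_wpM2r// ge_min lexx.
have C'bound x b : nU (C' x b) <= M * nU b.
  have b0 := seminorm_ge0 (@dotU R d k) b.
  rewrite /C'; case: ifPn => [/set_mem[Ox Nx]|_]; last first.
    by rewrite id_lfunE ler_peMl// le_max lexx orbT.
  have [_ _ /(_ b)] := good x Ox Nx => /le_trans; apply.
  by rewrite ler_wpM2r// le_max lexx.
pose Y w : E -> V := fun x => (C' x)^-1%VF (w x).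
have aE w z : a w z = innerU Omega (Y w) z.
  rewrite /a /innerU [LHS]Rintegral_mkcond [RHS]Rintegral_mkcond /Rintegral.
  congr fine; apply: (integral_off_null mN N0) => x Nx.
  rewrite !patchE; case: ifPn => // /set_mem Ox; congr (_%:E).
  by rewrite /apply_inv /Y /C' mem_set.
have Ylin e w z : Y (e *: w + z) = e *: Y w + Y z.
  by apply/funext => x; exact: linearP.
have mG i j : measurable_fun setT (fun x => gram (C' x) i j).
  rewrite (_ : (fun x => _) = fun x => if x \in Omega `\` N
      then ((fun x => dotU (C x (basis_vector i)) (basis_vector j)) \_ Omega) x
      else dotU (basis_vector i) (basis_vector j)); last first.
    apply/funext => x; rewrite mxE /C'; case: ifPn => [|_]; last by rewrite id_lfunE.
    by move=> /set_mem[Ox _]; rewrite patchE mem_set.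
  rewrite (_ : (fun x => _) = fun x =>
      (((fun x => dotU (C x (basis_vector i)) (basis_vector j)) \_ Omega) \_ (Omega `\` N)) x
      + (cst (dotU (basis_vector i) (basis_vector j)) \_ (~` (Omega `\` N))) x).
    apply: measurable_funD.
      apply/(measurable_restrictT _ mON); apply: measurable_funTS.
      by have [/(_ (basis_vector i) (basis_vector j)) /Lfun_infty_bound[]] := HC.
    by apply/(measurable_restrictT _ (measurableC mON)).
  apply/funext => x; rewrite ![(_ \_ _) x]patchE in_setC.
  by case: (x \in Omega `\` N); rewrite ?addr0 ?add0r.
have Yle w x : nU (Y w x) <= c^-1 * nU (w x) by exact: inverse_bound c_gt0 (C'coer x) _.
have YL2 w : L2U Omega w -> L2U Omega (Y w).
  move=> lw; apply/L2U_component => ij; apply/l2P.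
  have mY : measurable_fun setT (component (Y w) ij \_ Omega).
    rewrite (_ : _ \_ _ = fun x => \sum_l ((\det (gram (C' x)))^-1 *
        \sum_m ((fun x => dotU (w x) (basis_vector m)) \_ Omega) x *
          \adj (gram (C' x)) m l) * entry (basis_vector l) ij.1 ij.2).
      apply: measurable_sum => l; apply: measurable_funM; last exact: measurable_cst.
      apply: measurable_funM.
        exact: measurableT_comp (@measurable_inv R) (measurable_det mG).
      apply: measurable_sum => m; apply: measurable_funM; last exact: measurable_adj.
      rewrite (_ : _ \_ _ = fun x => \sum_ij (component w ij \_ Omega) x *
          entry (basis_vector m) ij.1 ij.2).
        apply: measurable_sum => kl; apply: measurable_funM; last exact: measurable_cst.
        by apply: l2_measurable; exact: (L2_component kl lw).
      apply/funext => x; rewrite patchE; case: ifPn => xO.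
        by rewrite dotUE; apply: eq_bigr => kl _; rewrite patchE xO.
      by rewrite big1// => kl _; rewrite patchE (negbTE xO) mul0r.
    apply/funext => x; rewrite patchE; case: ifPn => xO; last first.
      rewrite big1// => l _; rewrite big1 ?mulr0 ?mul0r// => m _.
      by rewrite patchE (negbTE xO) mul0r.
    rewrite /component [Y w x]coordinates_sum entry_sum; apply: eq_bigr => l _.
    rewrite (coordinates_inverse _ c_gt0 (C'coer x)) mxE mxE.
    congr (_ * _ * _); apply: eq_bigr => m _.
    by rewrite mxE patchE xO.
  split => //; apply: le_integrable
    (integrableZl measurableT (c^-1 ^+ 2) (dotU_integrable lw lw)) => //.
    by apply/measurable_EFinP; exact: measurable_funX.
  move=> x _; rewrite /= lee_fin ger0_norm ?sqr_ge0// ger0_norm; last first.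
    by rewrite mulr_ge0 ?sqr_ge0// patchE; case: ifP => // _; exact: (si_ge0 si).
  rewrite !patchE; case: ifP => _; last by rewrite expr0n mulr0.
  rewrite -(seminorm_sqr si)// -exprMn -real_normK ?num_real//.
  rewrite ler_pXn2r ?nnegrE ?mulr_ge0 ?invr_ge0 ?seminorm_ge0 ?(ltW c_gt0)//.
  by apply: le_trans (Yle _ _); exact: entry_le_seminorm.
have Ybound w : L2U Omega w -> seminorm (innerU Omega) (Y w) <=
    c^-1 * seminorm (innerU Omega) w.
  move=> lw; rewrite -[c^-1]gtr0_norm ?invr_gt0// -(seminormZ siU)//.
  apply: ler_wsqrtr; apply: innerU_le; [exact: YL2|exact: YL2| | |];
    try exact: (subspaceZ _ (si_sub siU)).
  move=> x; rewrite -!(seminorm_sqr si)// ler_pXn2r ?nnegrE ?seminorm_ge0//.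
  by rewrite (seminormZ si)// gtr0_norm ?invr_gt0// Yle.
exists (c / M ^+ 2); first by rewrite divr_gt0// exprn_gt0.
exists c^-1; first by rewrite invr_gt0.
split.
- move=> z lz e u v lu lv /=; rewrite !aE Ylin (si_lin siU lz)//; exact: YL2.
- move=> w z lw lz; rewrite !aE (si_sym siU (YL2 _ lz))//.
  by apply: eq_Rintegral => x _; exact: (inverse_sym c_gt0).
- move=> w lw; rewrite aE -(linear_onZ (si_sub siU) (si_lin siU _))//.
  apply: innerU_le => //; [exact: (subspaceZ _ (si_sub siU))|exact: YL2|].
  move=> x; have := inverse_coercive c_gt0 M_gt0 (C'coer x) (C'bound x) (w x).
  by rewrite -(linear_onZ (si_sub si) (si_lin si _)).
- move=> w z lw lz; rewrite aE; apply: le_trans (si_CauchySchwarz siU (YL2 _ lw) lz) _.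
  by rewrite mulrA ler_wpM2r ?seminorm_ge0// Ybound.
Qed.

End tensor.

(** * The mixed formulation *)

Section mixed_formulation.
Context {R : realType} {d : nat} {k : value_kind}.
Variable A : diffop R d k.
Local Notation E := 'rV[R]_d.
Local Notation V := (U R d k).
Local Notation L2U := (@L2U R d k).
Local Notation innerU := (@innerU R d k).
Variables (Omega : set E) (N : nat) (T : 'I_N -> set E).
Hypotheses (oO : open Omega) (HT : mesh_of Omega T).
Local Notation DB := (dadj_broken A T).
Local Notation Hb := (H_adj_broken A Omega T).
Local Notation gip := (graph_form (innerU Omega) (inner Omega) DB).
Implicit Types (w z : E -> V) (u v : E -> R).

Let siX D := @L2_semi_inner R d D.
Let siU D := @L2U_semi_inner R d k D.
Let sX := si_sub (siX Omega).
Let sU := si_sub (siU Omega).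

Let HbL : linear_subspace Hb. Proof. exact: broken_subspace. Qed.
Let DL2 w : Hb w -> L2 Omega (DB w). Proof. exact: dadj_broken_L2. Qed.
Let Dlin v : L2 Omega v -> linear_on Hb (fun w => inner Omega v (DB w)).
Proof. exact: dadj_broken_lin. Qed.

Lemma is_adj0 D : is_adj A D 0 0.
Proof.
move=> phi tphi.
rewrite (linear_on0 (si_sub (siX D)) (si_lin (siX D) (test_L2 tphi))).
by rewrite (linear_on0 (si_sub (siU D))
  (si_lin (siU D) (test_L2U (apply_op_test A tphi)))).
Qed.

Lemma broken_ae_null w z : Hb w -> Hb z -> ae_equal Omega w z ->
  seminorm gip (w - z) = 0.
Proof.
move=> Hw Hz wz.
have Hwz := subspaceB HbL Hw Hz; have [lwz _] := Hwz.
have wz0 : {ae lebesgueN d, forall x, Omega x -> (w - z) x = 0}.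
  by apply: filterS wz => x /= H Ox; rewrite -[LHS]/(w x - z x) H// subrr.
have D0 : seminorm (inner Omega) (DB (w - z) - 0) = 0.
  apply: dadj_broken_unique => //; first exact: (subspace0 sX).
  move=> i; have mT : measurable (T i) by apply: open_measurableN; exact: mesh_open HT i.
  have TO : T i `<=` Omega by case: HT => H _ _; have [] := H i.
  have lTwz := L2U_subset mT TO lwz; have L := si_sub (siU (T i)).
  apply: (@is_adj_ae _ _ _ A (T i) 0 _ 0 (subspace0 L) lTwz _ (@is_adj0 (T i))).
  apply: L2U_ae_null; first exact: (subspaceB L (subspace0 L) lTwz).
  by apply: filterS wz0 => x H /TO/H H0; rewrite -[LHS]/(0 - (w - z) x) H0 subrr.
apply/eqP; rewrite eq_le seminorm_ge0 andbT.
have := @graph_le _ _ _ Hb (L2 Omega) (innerU Omega) (inner Omega) DB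
  (semi_inner_sub (siU Omega) (fun w => @proj1 _ _) HbL) (siX Omega)
  DL2 Dlin _ Hwz.
by rewrite (L2U_ae_null lwz wz0) add0r -[DB _]subr0 D0.
Qed.

Lemma norm_adj_conforming w : H_adj A Omega w -> norm_adj A Omega w = seminorm gip w.
Proof.
move=> Hw; have [_ wE] := Hw; have [ld wd] := dadj_spec wE.
have [Hbw _] := dadj_broken_conforming HT Hw ld wd.
have lD := DL2 Hbw.
rewrite /norm_adj (inner_dadj_conforming HT Hw ld) (si_sym (siX Omega))//.
by rewrite (inner_dadj_conforming HT Hw lD).
Qed.

Lemma inf_sup_conforming c : 0 < c ->
  (forall v, L2 Omega v -> c * norm2 Omega v <=
    sup [set inner Omega (dadj A Omega w) v |
         w in [set w | H_adj A Omega w /\ norm_adj A Omega w = 1]]) ->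
  forall v, L2 Omega v -> exists z, [/\ H_adj A Omega z, seminorm gip z <= 1 &
    c / 2 * seminorm (inner Omega) v <= inner Omega v (DB z)].
Proof.
move=> c0 H v lv; have := H v lv; rewrite -/(seminorm (inner Omega) v).
set S := (X in sup X) => cS.
have [v0|v0] := eqVneq (seminorm (inner Omega) v) 0.
  exists 0; have H0 := subspace0 (H_adj_subspace A Omega).
  split => //; last by rewrite v0 mulr0 (linear_on0 HbL (Dlin lv)).
  by rewrite (seminorm0 (graph_broken_semi_inner A HT)).
have v1 : 0 < seminorm (inner Omega) v by rewrite lt_neqAle eq_sym v0 seminorm_ge0.
have lt : c / 2 * seminorm (inner Omega) v < sup S.
  by apply: lt_le_trans cS; rewrite ltr_pM2r// ltr_pdivrMr// ltr_pMr// ltr1n.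
have [|_ [w [Hw w1] <-] wv] := sup_gt _ lt.
  apply/set0P/negP => /eqP S0; move: cS; rewrite S0 sup0 leNgt.
  by rewrite mulr_gt0.
exists w; split => //; first by rewrite -norm_adj_conforming// w1.
have [_ wE] := Hw; have [ld _] := dadj_spec wE.
by rewrite -(inner_dadj_conforming HT Hw lv) (si_sym (siX Omega))// ltW.
Qed.

Section setting.
Variable Ht : set (E -> V).
Hypothesis Ht_closed : closed_subspace Hb (norm_adj_broken A Omega T) Ht.
Hypothesis H_adj_sub : H_adj A Omega `<=` Ht.
Local Notation S0 := (H_skel0 A Omega T Ht).
Local Notation nskel := (norm_skel A Omega T Ht).

Let HtL : linear_subspace Ht. Proof. by case: Ht_closed. Qed.
Let HtHb : Ht `<=` Hb. Proof. by case: Ht_closed. Qed.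
Let HtU : Ht `<=` L2U Omega. Proof. by move=> w /HtHb[]. Qed.

Lemma mixed_setting_skel (a : (E -> V) -> (E -> V) -> R) alpha beta c :
  0 < alpha -> 0 < beta -> 0 < c ->
  (forall z, L2U Omega z -> linear_on (L2U Omega) (a ^~ z)) ->
  (forall w z, L2U Omega w -> L2U Omega z -> a w z = a z w) ->
  (forall w, L2U Omega w -> alpha * innerU Omega w w <= a w w) ->
  (forall w z, L2U Omega w -> L2U Omega z ->
    `|a w z| <= beta * (seminorm (innerU Omega) w * seminorm (innerU Omega) z)) ->
  (forall v, L2 Omega v -> c * norm2 Omega v <=
    sup [set inner Omega (dadj A Omega w) v |
         w in [set w | H_adj A Omega w /\ norm_adj A Omega w = 1]]) ->
  mixed_setting Ht (H_adj A Omega) (L2 Omega) S0 (innerU Omega) (inner Omega) a DB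
    (fun phi w => phi w) nskel alpha beta (c / 2).
Proof.
move=> alpha0 beta0 c0 alin asym acoer abound infsup; split => //.
- exact: semi_inner_sub (siU Omega) HtU HtL.
- by move=> w /HtHb; exact: dadj_broken_L2.
- by move=> v lv e w z /HtHb Hw /HtHb Hz; exact: (Dlin lv).
- by move=> z /HtU lz e u v /HtU lu /HtU lv; exact: alin.
- by move=> w z /HtU lw /HtU lz; exact: asym.
- by move=> w /HtU; exact: acoer.
- by move=> w z /HtU lw /HtU lz; exact: abound.
- exact: H_skel0_subspace.
- by move=> phi Hphi; exact: (H_skel0_lin HT Ht_closed Hphi).
- by move=> phi; exact: norm_skel_ge0.
- by move=> phi w Hphi Hw; exact: (norm_skel_dual HT Ht_closed).
- by move=> phi M Hphi M0; exact: (norm_skel_le oO HT Ht_closed).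
- by move=> phi w Hphi Hw; exact: (H_skel0_conforming HT Ht_closed H_adj_sub Hphi Hw).
- by rewrite divr_gt0.
- exact: inf_sup_conforming.
Qed.

Lemma mixed_solutionE C f (W : set (E -> V)) X Phi w u phi :
  W `<=` Ht -> X `<=` L2 Omega ->
  mixed_solution A Omega T C f W X Phi w u phi <->
  mixed_eq (inner Omega) (fun w z => innerU Omega (apply_inv C w) z) DB
    (fun phi w => phi w) f W X Phi w u phi.
Proof.
move=> WHt XL2.
have B v z : X v -> W z -> inner Omega v (DB z) = inner_broken A T v z.
  by move=> /XL2 lv /WHt/HtHb Hz; exact: (inner_dadj_broken HT Hz lv).
split => -[Hw Hu Hphi E1 E2]; split => //.
- by move=> z Hz; rewrite B//; exact: E1.
- by move=> v eta Hv Heta; rewrite B//; exact: E2.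
- by move=> z Hz; rewrite -B//; exact: E1.
- by move=> v eta Hv Heta; rewrite -B//; exact: E2.
Qed.

End setting.
End mixed_formulation.

Lemma fin_dim_null (R : realType) (V : lmodType R) (eqv : V -> V -> Prop) (S : set V)
    (nrm : V -> R) : (forall u v, S u -> S v -> eqv u v -> nrm (u - v) = 0) ->
  finite_dim_subspace eqv S ->
  exists n (e : 'I_n -> V), (forall i, S (e i)) /\
    forall v, S v -> exists c, nrm (v - \sum_i c i *: e i) = 0.
Proof.
move=> H [SL [n [e [Se span]]]]; exists n, e; split => // v Sv.
have [c vE] := span v Sv; exists c; apply: H => //; exact: subspace_sum.
Qed.

Theorem theorem5 (R : realType) (d : nat) (d_gt0 : (0 < d)%N)
    (Omega : set 'rV[R]_d) (HOmega : bounded_lipschitz_domain Omega)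
    (k : value_kind) (A : diffop R d k)
    (C : 'rV[R]_d -> 'End(U R d k)) (HC : admissible_tensor Omega C)
    (C_PF c_is C1 C2 : R)
    (C_PF_gt0 : 0 < C_PF) (c_is_gt0 : 0 < c_is) (C1_gt0 : 0 < C1) (C2_gt0 : 0 < C2)
    (poincare_friedrichs : forall v, H_op0 A Omega v ->
      norm2 Omega v <= C_PF * norm2U Omega (dop A Omega v))
    (inf_sup : forall v, L2 Omega v ->
      c_is * norm2 Omega v <=
      sup [set inner Omega (dadj A Omega w) v |
           w in [set w | H_adj A Omega w /\ norm_adj A Omega w = 1]]) :
  exists2 Cst : R, 0 < Cst &
  forall (N : nat) (T : 'I_N -> set 'rV[R]_d) (HT : mesh_of Omega T)
    (Ht : set ('rV[R]_d -> U R d k))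
    (Ht_closed : closed_subspace (H_adj_broken A Omega T)
                   (norm_adj_broken A Omega T) Ht)
    (H_adj_sub : H_adj A Omega `<=` Ht)
    (f : 'rV[R]_d -> R) (Hf : L2 Omega f)
    (w : 'rV[R]_d -> U R d k) (u : 'rV[R]_d -> R)
    (phi : ('rV[R]_d -> U R d k) -> R)
    (sol : mixed_solution A Omega T C f
             Ht (L2 Omega) (H_skel0 A Omega T Ht) w u phi)
    (Wh : set ('rV[R]_d -> U R d k)) (Xh : set ('rV[R]_d -> R))
    (Phih : set (('rV[R]_d -> U R d k) -> R))
    (Wh_fin : finite_dim_subspace (ae_equal Omega) Wh)
    (Xh_fin : finite_dim_subspace (ae_equal Omega) Xh)
    (Phih_fin : finite_dim_subspace eq Phih)
    (Wh_sub : Wh `<=` Ht) (Xh_sub : Xh `<=` L2 Omega)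
    (Phih_sub : Phih `<=` H_skel0 A Omega T Ht)
    (Wh_adj : forall wh, Wh wh ->
      exists2 xh, Xh xh & ae_equal Omega (dadj_broken A T wh) xh)
    (F1 F2 : ('rV[R]_d -> U R d k) -> ('rV[R]_d -> U R d k))
    (F1_in : forall z, Ht z -> (Wh `&` H_adj A Omega) (F1 z))
    (F2_in : forall z, Ht z -> Wh (F2 z))
    (F1_orth : forall z, Ht z -> forall du, Xh du ->
      inner_broken A T du (z - F1 z) = 0)
    (F2_orth : forall z, Ht z -> forall dphi, Phih dphi ->
      dphi (z - F2 z) = 0)
    (F1_bound : forall z, Ht z ->
      norm_adj_broken A Omega T (F1 z) <= C1 * norm_adj_broken A Omega T z)
    (F2_bound : forall z, Ht z ->
      norm_adj_broken A Omega T (F2 z) <= C2 * norm_adj_broken A Omega T z),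
  exists wh uh phih,
    [/\ mixed_solution A Omega T C f Wh Xh Phih wh uh phih,
        forall wh' uh' phih',
          mixed_solution A Omega T C f Wh Xh Phih wh' uh' phih' ->
          [/\ ae_equal Omega wh' wh, ae_equal Omega uh' uh & phih' = phih] &
        forall z v eta, Wh z -> Xh v -> Phih eta ->
          norm_adj_broken A Omega T (w - wh) + norm2 Omega (u - uh) +
            norm_skel A Omega T Ht (phi - phih) <=
          Cst * (norm_adj_broken A Omega T (w - z) + norm2 Omega (u - v) +
            norm_skel A Omega T Ht (phi - eta))].
Proof.
have oO : open Omega by case: HOmega.
have mO := open_measurableN oO.
have [alpha alpha0 [beta beta0 [alin asym acoer abound]]] := tensor_form mO HC.
have c0 : 0 < c_is / 2 by rewrite divr_gt0.
have [K K0 HK] := stability_constant alpha0 beta0 c0 C1_gt0 C2_gt0.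
exists (1 + K * (beta + 1)); first by rewrite addr_gt0// mulr_gt0// addr_gt0.
move=> N T HT Ht Ht_closed H_adj_sub f Hf w u phi sol Wh Xh Phih Wh_fin Xh_fin
  Phih_fin Wh_sub Xh_sub Phih_sub Wh_adj F1 F2 F1_in F2_in F1_orth F2_orth F1_bound F2_bound.
have ms := mixed_setting_skel oO HT Ht_closed H_adj_sub alpha0 beta0 c_is_gt0
  alin asym acoer abound inf_sup.
have [WhL _] := Wh_fin; have [XhL _] := Xh_fin; have [PhL _] := Phih_fin.
have [HtL HtHb _] := Ht_closed.
set gip := graph_form (innerU Omega) (inner Omega) (dadj_broken A T).
have nAE z : Ht z -> norm_adj_broken A Omega T z = seminorm gip z.
  by move=> /HtHb; exact: norm_adj_brokenE.
have siX := @L2_semi_inner R d Omega; have sX := si_sub siX.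
have null2 v v' : L2 Omega v -> L2 Omega v' -> ae_equal Omega v v' ->
    seminorm (inner Omega) (v - v') = 0.
  move=> lv lv' vv'; apply: L2_ae_null; first exact: (subspaceB sX).
  by apply: filterS vv' => x /= H Ox; rewrite -[LHS]/(v x - v' x) H// subrr.
have F1_in' z : Ht z -> (Wh `&` H_adj A Omega) (F1 z) by exact: F1_in.
have DWh z : Wh z -> exists2 x, Xh x & seminorm (inner Omega) (dadj_broken A T z - x) = 0.
  move=> Hz; have [x Xx zx] := Wh_adj z Hz; exists x => //; apply: null2 => //.
    exact: (dadj_broken_L2 HT (HtHb _ (Wh_sub _ Hz))).
  exact: Xh_sub.
have F1_orth' z : Ht z -> forall v, Xh v ->
    inner Omega v (dadj_broken A T (z - F1 z)) = 0.
  move=> Hz v Hv; have [WF _] := F1_in z Hz.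
  rewrite (inner_dadj_broken HT (HtHb _ (subspaceB HtL Hz (Wh_sub _ WF))) (Xh_sub _ Hv)).
  exact: F1_orth.
have F1_bound' z : Ht z -> seminorm gip (F1 z) <= C1 * seminorm gip z.
  move=> Hz; have [WF _] := F1_in z Hz.
  by rewrite -(nAE _ Hz) -(nAE _ (Wh_sub _ WF)); exact: F1_bound.
have F2_bound' z : Ht z -> seminorm gip (F2 z) <= C2 * seminorm gip z.
  by move=> Hz; rewrite -(nAE _ Hz) -(nAE _ (Wh_sub _ (F2_in _ Hz))); exact: F2_bound.
have [n1 [e1 [We1 span1]]] := fin_dim_null (nrm := seminorm gip)
  (fun z z' Hz Hz' => broken_ae_null HT (HtHb _ (Wh_sub _ Hz)) (HtHb _ (Wh_sub _ Hz'))) Wh_fin.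
have [n2 [e2 [Xe2 span2]]] := fin_dim_null (nrm := seminorm (inner Omega))
  (fun v v' Hv Hv' => null2 _ _ (Xh_sub _ Hv) (Xh_sub _ Hv')) Xh_fin.
have [_ [n3 [e3 [Pe3 span3]]]] := Phih_fin.
have [wh [uh [phih sol_h]]] : exists wh uh phih,
    mixed_solution A Omega T C f Wh Xh Phih wh uh phih.
  have [wh [uh [phih /(mixed_solutionE HT Ht_closed) E]]] :=
    discrete_exists ms WhL XhL PhL Wh_sub Xh_sub Phih_sub C1_gt0 C2_gt0 DWh F1_in' F2_in
      F1_orth' F2_orth F1_bound' F2_bound' HK Hf We1 Xe2 Pe3 span1 span2 span3.
  by exists wh, uh, phih; exact: E.
have /(mixed_solutionE HT Ht_closed _ _ _ _ _ _ Wh_sub Xh_sub) eq_h := sol_h.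
have [Hwh Huh Hph _ _] := sol_h.
exists wh, uh, phih; split => //.
  move=> wh' uh' phih' sol'.
  have /(mixed_solutionE HT Ht_closed _ _ _ _ _ _ Wh_sub Xh_sub) eq' := sol'.
  have [Hwh' Huh' Hph' _ _] := sol'.
  have [w0 u0 p0] := discrete_unique ms WhL XhL PhL Wh_sub Xh_sub Phih_sub C1_gt0 C2_gt0
    DWh F1_in' F2_in F1_orth' F2_orth F1_bound' F2_bound' HK eq_h eq'.
  have tw := subspaceB HtL (Wh_sub _ Hwh') (Wh_sub _ Hwh).
  have lu := subspaceB sX (Xh_sub _ Huh') (Xh_sub _ Huh).
  have Sp := H_skel0_subspace oO HT Ht_closed H_adj_sub.
  split.
  - have [lw _] := HtHb _ tw; have w1 : seminorm (innerU Omega) (wh' - wh) = 0.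
      apply/eqP; rewrite eq_le seminorm_ge0 andbT -w0.
      exact: (graph_ge_base (innerU Omega) siX (ms_D ms) tw).
    by apply: filterS (L2U_null_ae lw w1) => x H Ox; apply/eqP; rewrite -subr_eq0; apply/eqP/H.
  - by apply: filterS (L2_null_ae lu u0) => x H Ox; apply/eqP; rewrite -subr_eq0; apply/eqP/H.
  - apply/eqP; rewrite -subr_eq0; apply/eqP.
    exact: (norm_skel_eq0 HT Ht_closed (subspaceB Sp (Phih_sub _ Hph') (Phih_sub _ Hph)) p0).
move=> z v eta Hz Hv Heta.
have /(mixed_solutionE HT Ht_closed _ _ _ _ _ _ (@subset_refl _ _) (@subset_refl _ _)) eq_c := sol.
have [Hw Hu Hp _ _] := sol.
rewrite (nAE _ (subspaceB HtL Hw (Wh_sub _ Hwh))) (nAE _ (subspaceB HtL Hw (Wh_sub _ Hz))).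
exact: (quasi_optimality ms WhL XhL PhL Wh_sub Xh_sub Phih_sub C1_gt0 C2_gt0
    DWh F1_in' F2_in F1_orth' F2_orth F1_bound' F2_bound' HK K0 eq_c eq_h).
Qed.
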